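(* Assume the setting and standing assumptions of the context, and suppose that $\psi$ is $\mu_\psi$-strongly convex with $\mu_\psi=1$. Let $c_0>0$, let $P$, $Q$, $L_{\Phi_0}$ be the constants of the context, and let $b>0$, $\hat b_0>0$ be batch sizes with $b_0:=c_0\hat b_0$, $\hat b_1=\hat b_2:=b$, $b_1=b_2:=c_0b$. Let $\{x_t\}_{t=0}^T$ be generated by the algorithm of the context using $$\gamma_t:=0,\quad \beta_t=\hat\beta_t:=1-\frac{1}{(t+2)^{2/3}},\quad \theta_t:=\frac{L_{\Phi_0}\sqrt b}{P(t+2)^{1/3}},\quad \eta_t:=\frac{2}{L_{\Phi_0}(3+\theta_t)},$$ where the batch size is such that $\theta_t\in(0,1]$. Then, for all $T\ge0$ and $(\bar x_T,\bar\eta_T)$ chosen randomly so that $\mathbf{Prob}\{\mathcal{G}_{\bar\eta_T}(\bar x_T)=\mathcal{G}_{\eta_t}(x_t)\}=\frac{\theta_t}{\sum_{t=0}^T\theta_t}$ (i.e. $(\bar x_T,\bar\eta_T)=(x_t,\eta_t)$ with this probability, $t=0,\dots,T$), we have $$\mathbb{E}\big[\|\mathcal{G}_{\bar\eta_T}(\bar x_T)\|^2\big]\le\frac{32P[\Psi_0(x_0)-\Psi_0^\star]}{3\sqrt b\,\big[(T+3)^{2/3}-2^{2/3}\big]}+\frac{32Q}{3\big[(T+3)^{2/3}-2^{2/3}\big]}\left[\frac{2^{1/3}}{\hat b_0}+\frac{2(1+\log(T+1))}{b}\right].$$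
   Context: Problem. $\mathbf{F}:\mathbb{R}^p\times\Omega\to\mathbb{R}^q$ is a stochastic vector function on a probability space $(\Omega,\mathbb{P})$, $F(x):=\mathbb{E}_\xi[\mathbf{F}(x,\xi)]$, with Jacobians $\mathbf{F}'(x,\xi)$ and $F'(x)=\mathbb{E}_\xi[\mathbf{F}'(x,\xi)]$; $K\in\mathbb{R}^{q\times n}$; $\psi:\mathbb{R}^n\to\mathbb{R}\cup\{+\infty\}$ and $\mathcal{R}:\mathbb{R}^p\to\mathbb{R}\cup\{+\infty\}$ are proper, closed, convex. The minimax problem is $\min_x\max_y\{\mathcal{R}(x)+\mathbb{E}_\xi[\langle Ky,\mathbf{F}(x,\xi)\rangle]-\psi(y)\}$, equivalently $\min_x\Psi_0(x):=\phi_0(F(x))+\mathcal{R}(x)$ with $\phi_0(u):=\max_{y}\{\langle K^\top u,y\rangle-\psi(y)\}$. It is assumed that $\Psi_0^\star:=\inf_x\Psi_0(x)>-\infty$. Norms are Euclidean (spectral norm for $K$, Frobenius norm for Jacobians). Assumptions. There are constants $L_F,\sigma_F,\sigma_J,M_F,M_\psi\in(0,+\infty)$ such that for all $x,y\in\mathrm{dom}(\Psi_0)$: $\mathbb{E}_\xi[\|\mathbf{F}'(x,\xi)-\mathbf{F}'(y,\xi)\|^2]\le L_F^2\|x-y\|^2$; $\mathbb{E}_\xi[\|\mathbf{F}(x,\xi)-F(x)\|^2]\le\sigma_F^2$; $\mathbb{E}_\xi[\|\mathbf{F}'(x,\xi)-F'(x)\|^2]\le\sigma_J^2$; $\mathbb{E}_\xi[\|\mathbf{F}'(x,\xi)\|^2]\le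 M_F^2$; and $\sup\{\|y\|:y\in\mathrm{dom}(\psi)\}\le M_\psi$. Functions. For strongly convex $\psi$, $y_0^*(u):=\arg\max_y\{\langle u,Ky\rangle-\psi(y)\}$ is unique; $\Phi_0(x):=\phi_0(F(x))$ is differentiable with $\nabla\Phi_0(x)=F'(x)^\top Ky_0^*(F(x))$. The gradient mapping is $\mathcal{G}_\eta(x):=\frac1\eta\big(x-\mathrm{prox}_{\eta\mathcal{R}}(x-\eta\nabla\Phi_0(x))\big)$. Algorithm (with $\gamma_t=0$). Start from $x_0\in\mathrm{dom}(\Psi_0)$. Set $\tilde F_0:=\frac1{b_0}\sum_{\xi_i\in\mathcal{B}^0}\mathbf{F}(x_0,\xi_i)$, $\tilde J_0:=\frac1{\hat b_0}\sum_{\hat\xi_i\in\hat{\mathcal{B}}^0}\mathbf{F}'(x_0,\hat\xi_i)$. For $t\ge1$, $\tilde F_t:=\beta_{t-1}\tilde F_{t-1}+\frac{\beta_{t-1}}{b_1}\sum_{\xi_i\in\mathcal{B}_t^1}[\mathbf{F}(x_t,\xi_i)-\mathbf{F}(x_{t-1},\xi_i)]+\frac{1-\beta_{t-1}}{b_2}\sum_{\zeta_i\in\mathcal{B}_t^2}\mathbf{F}(x_t,\zeta_i)$, $\tilde J_t:=\hat\beta_{t-1}\tilde J_{t-1}+\frac{\hat\beta_{t-1}}{\hat b_1}\sum_{\hat\xi_i\in\hat{\mathcal{B}}_t^1}[\mathbf{F}'(x_t,\hat\xi_i)-\mathbf{F}'(x_{t-1},\hat\xi_i)]+\frac{1-\hat\beta_{t-1}}{\hat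 b_2}\sum_{\hat\zeta_i\in\hat{\mathcal{B}}_t^2}\mathbf{F}'(x_t,\hat\zeta_i)$. For $t=0,1,\dots,T$: $v_t:=\tilde J_t^\top Ky_0^*(\tilde F_t)$, $\hat x_{t+1}:=\mathrm{prox}_{\eta_t\mathcal{R}}(x_t-\eta_tv_t)$, $x_{t+1}:=(1-\theta_t)x_t+\theta_t\hat x_{t+1}$. The mini-batches $\mathcal{B}^0,\hat{\mathcal{B}}^0,\mathcal{B}_t^1,\hat{\mathcal{B}}_t^1,\mathcal{B}_t^2,\hat{\mathcal{B}}_t^2$ have sizes $b_0,\hat b_0,b_1,\hat b_1,b_2,\hat b_2$ (integers; rounding is ignored in formulas); each consists of i.i.d. copies of $\xi$ drawn independently of the past iterations; the mini-batches within one iteration may be correlated with each other. Constants. $\kappa:=1$ if $\mathcal{B}_t^1$ is independent of $\mathcal{B}_t^2$ and $\kappa:=2$ otherwise; $\hat\kappa:=1$ if $\hat{\mathcal{B}}_t^1$ is independent of $\hat{\mathcal{B}}_t^2$ and $\hat\kappa:=2$ otherwise. For given $c_0>0$: $P:=\frac{\sqrt{26}\|K\|}{3\sqrt{c_0}}\sqrt{\kappa M_F^4\|K\|^2+c_0\hat\kappa L_F^2M_\psi^2}$, $Q:=\frac{26}{9c_0}\|K\|^2\big(\kappa M_F^2\|K\|^2\sigma_F^2+c_0\hat\kappa M_\psi^2\sigma_J^2\big)$, $L_{\Phi_0}:=L_FM_\psi\|K\|+M_F^2\|K\|^2$. *)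

(* Defs.v *)
From HB Require Import structures.
From mathcomp Require Import all_boot all_order all_algebra.
From mathcomp Require Import all_classical all_reals all_analysis.

Set Implicit Arguments.
Unset Strict Implicit.
Unset Printing Implicit Defensive.

Import Order.TTheory GRing.Theory Num.Theory.
Import numFieldNormedType.Exports.

Local Open Scope classical_set_scope.
Local Open Scope ring_scope.

(* R^n is 'cV[R]_n.  The norm `|_| that MathComp-Analysis puts on matrices is
   the sup norm, so the Euclidean / Frobenius and spectral norms are defined
   here; on column vectors [frob] is the Euclidean norm. *)
Definition frob (R : realType) (m n : nat) (A : 'M[R]_(m, n)) : R :=
  Num.sqrt (\sum_i \sum_j A i j ^+ 2).

Definition inner (R : realType) (n : nat) (u v : 'cV[R]_n) : R :=
  (u^T *m v) 0 0.

Definition specnorm (R : realType) (m n : nat) (A : 'M[R]_(m, n)) : R :=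
  sup [set frob (A *m y) | y in [set y : 'cV[R]_n | frob y <= 1]].

(* MathComp-Analysis' [jacobian] acts on row vectors from the right; [jac f x]
   is the usual q x p Jacobian of a map between column vectors. *)
Definition jac (R : realType) (p q : nat) (f : 'cV[R]_p -> 'cV[R]_q)
    (x : 'cV[R]_p) : 'M[R]_(q, p) :=
  \matrix_(i, j) ('d f x (delta_mx j (0 : 'I_1)) : 'cV[R]_q) i 0.

Definition grad (R : realType) (p : nat) (f : 'cV[R]_p -> R) (x : 'cV[R]_p) :
    'cV[R]_p :=
  \col_j ('d f x (delta_mx j (0 : 'I_1)) : R).

Definition edom (R : realType) (n : nat) (f : 'cV[R]_n -> \bar R) :
    set 'cV[R]_n :=
  [set x | (f x < +oo)%E].

Definition proper_efun (R : realType) (n : nat) (f : 'cV[R]_n -> \bar R) :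
    Prop :=
  edom f !=set0 /\ forall x, (-oo < f x)%E.

Definition convex_efun (R : realType) (n : nat) (f : 'cV[R]_n -> \bar R) :
    Prop :=
  forall (x y : 'cV[R]_n) (a : R), 0 <= a <= 1 ->
    (f (a *: x + (1 - a) *: y)%R <= a%:E * f x + (1 - a)%:E * f y)%E.

Definition strongly_convex (R : realType) (n : nat) (mu : R)
    (f : 'cV[R]_n -> \bar R) : Prop :=
  convex_efun (fun x => (f x - (mu / 2 * frob x ^+ 2)%:E)%E).

(* The minimizer is unique for proper closed convex [f]. *)
Definition prox (R : realType) (n : nat) (f : 'cV[R]_n -> \bar R)
    (x : 'cV[R]_n) : 'cV[R]_n :=
  let obj z := (f z + (2^-1 * frob (z - x) ^+ 2)%:E)%E in
  xget 0 [set z | forall z', (obj z <= obj z')%E].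

Definition integrable_mx d (T : measurableType d) (R : realType)
    (P : probability T R) (m n : nat) (X : T -> 'M[R]_(m, n)) : Prop :=
  forall i j, P.-integrable setT (fun s => (X s i j)%:E).

Definition expect_mx d (T : measurableType d) (R : realType)
    (P : probability T R) (m n : nat) (X : T -> 'M[R]_(m, n)) : 'M[R]_(m, n) :=
  \matrix_(i, j) fine ('E_P[fun s => X s i j])%E.

(* The stochastic vector function is [F x s], with s distributed as [Pxi]. *)

Definition phi0 (R : realType) (q n : nat) (K : 'M[R]_(q, n))
    (psi : 'cV[R]_n -> \bar R) (u : 'cV[R]_q) : \bar R :=
  ereal_sup (range (fun y => ((inner (K^T *m u) y)%:E - psi y)%E)).

Definition y0star (R : realType) (q n : nat) (K : 'M[R]_(q, n))
    (psi : 'cV[R]_n -> \bar R) (u : 'cV[R]_q) : 'cV[R]_n :=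
  let obj y := ((inner u (K *m y))%:E - psi y)%E in
  xget 0 [set y | forall y', (obj y' <= obj y)%E].

Definition Fmean d (Xi : measurableType d) (R : realType)
    (Pxi : probability Xi R) (p q : nat) (F : 'cV[R]_p -> Xi -> 'cV[R]_q)
    (x : 'cV[R]_p) : 'cV[R]_q :=
  expect_mx Pxi (F x).

Definition Fjac (Xi : Type) (R : realType) (p q : nat)
    (F : 'cV[R]_p -> Xi -> 'cV[R]_q) (x : 'cV[R]_p) (s : Xi) : 'M[R]_(q, p) :=
  jac (F ^~ s) x.

Definition Psi0 d (Xi : measurableType d) (R : realType)
    (Pxi : probability Xi R) (p q n : nat) (F : 'cV[R]_p -> Xi -> 'cV[R]_q)
    (K : 'M[R]_(q, n)) (psi : 'cV[R]_n -> \bar R) (Rg : 'cV[R]_p -> \bar R)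
    (x : 'cV[R]_p) : \bar R :=
  (phi0 K psi (Fmean Pxi F x) + Rg x)%E.

Definition Psi0star d (Xi : measurableType d) (R : realType)
    (Pxi : probability Xi R) (p q n : nat) (F : 'cV[R]_p -> Xi -> 'cV[R]_q)
    (K : 'M[R]_(q, n)) (psi : 'cV[R]_n -> \bar R) (Rg : 'cV[R]_p -> \bar R) :
    \bar R :=
  ereal_inf (range (Psi0 Pxi F K psi Rg)).

(* No information is lost by [fine]: [phi0] is finite everywhere when dom psi is nonempty and bounded. *)
Definition Phi0 d (Xi : measurableType d) (R : realType)
    (Pxi : probability Xi R) (p q n : nat) (F : 'cV[R]_p -> Xi -> 'cV[R]_q)
    (K : 'M[R]_(q, n)) (psi : 'cV[R]_n -> \bar R) (x : 'cV[R]_p) : R :=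
  fine (phi0 K psi (Fmean Pxi F x)).

Definition grad_map d (Xi : measurableType d) (R : realType)
    (Pxi : probability Xi R) (p q n : nat) (F : 'cV[R]_p -> Xi -> 'cV[R]_q)
    (K : 'M[R]_(q, n)) (psi : 'cV[R]_n -> \bar R) (Rg : 'cV[R]_p -> \bar R)
    (eta : R) (x : 'cV[R]_p) : 'cV[R]_p :=
  eta^-1 *: (x - prox (fun z => (eta%:E * Rg z)%E)
                      (x - eta *: grad (Phi0 Pxi F K psi) x)).

Definition independent_events d (W : measurableType d) (R : realType)
    (P : probability W R) (G H : set (set W)) : Prop :=
  forall A B, G A -> H B -> P (A `&` B) = (P A * P B)%E.

Definition sigma_of (W : Type) d (Xi : measurableType d) (S : set (W -> Xi)) :
    set (set W) :=
  <<s [set A | exists2 X, S X & exists2 C, measurable C & A = X @^-1` C] >>.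

Record iid_copies d (W : measurableType d) d' (Xi : measurableType d')
    (R : realType) (P : probability W R) (Pxi : probability Xi R) (b : nat)
    (X : 'I_b -> W -> Xi) : Prop := IidCopies {
  iid_measurable : forall i, measurable_fun setT (X i);
  iid_law : forall i C, measurable C -> P (X i @^-1` C) = Pxi C;
  iid_independent : forall C : 'I_b -> set Xi, (forall i, measurable (C i)) ->
    P (\bigcap_(i in [set: 'I_b]) (X i @^-1` C i)) =
    (\prod_(i < b) P (X i @^-1` C i))%E
}.

(* The mini-batches as families of random elements.  The letter h stands for
   the hat: B-batches estimate F, hB-batches estimate its Jacobian; the values
   of [B1], [hB1], [B2], [hB2] at t = 0 are not used. *)
Record minibatches (W Xi : Type) (b0 hb0 b1 hb1 b2 hb2 : nat) := Minibatches {
  B0 : 'I_b0 -> W -> Xi;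
  hB0 : 'I_hb0 -> W -> Xi;
  B1 : nat -> 'I_b1 -> W -> Xi;
  hB1 : nat -> 'I_hb1 -> W -> Xi;
  B2 : nat -> 'I_b2 -> W -> Xi;
  hB2 : nat -> 'I_hb2 -> W -> Xi
}.

Definition draws (W Xi : Type) (b0 hb0 b1 hb1 b2 hb2 : nat)
    (B : minibatches W Xi b0 hb0 b1 hb1 b2 hb2) (t : nat) : set (W -> Xi) :=
  if t is 0%N then range (B0 B) `|` range (hB0 B)
  else range (B1 B t) `|` range (hB1 B t) `|` range (B2 B t) `|`
       range (hB2 B t).

(* The batches of one iteration may depend on each other in any way; together
   they are independent of everything drawn before.  Independence batch by
   batch would be too weak when kappa = 1, where the cross terms vanish only if
   the two batches are independent given the past. *)
Record sampling d (W : measurableType d) d' (Xi : measurableType d')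
    (R : realType) (P : probability W R) (Pxi : probability Xi R)
    (b0 hb0 b1 hb1 b2 hb2 : nat)
    (B : minibatches W Xi b0 hb0 b1 hb1 b2 hb2) (T : nat) : Prop := Sampling {
  sampling_B0 : iid_copies P Pxi (B0 B);
  sampling_hB0 : iid_copies P Pxi (hB0 B);
  sampling_B1 : forall t, (1 <= t <= T)%N -> iid_copies P Pxi (B1 B t);
  sampling_hB1 : forall t, (1 <= t <= T)%N -> iid_copies P Pxi (hB1 B t);
  sampling_B2 : forall t, (1 <= t <= T)%N -> iid_copies P Pxi (B2 B t);
  sampling_hB2 : forall t, (1 <= t <= T)%N -> iid_copies P Pxi (hB2 B t);
  sampling_past : forall t, (1 <= t <= T)%N ->
    independent_events P (sigma_of (draws B t))
      (sigma_of (\bigcup_(s in [set s | (s < t)%N]) draws B s))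
}.

Definition kappa_of d (W : measurableType d) d' (Xi : measurableType d')
    (R : realType) (P : probability W R) (c1 c2 : nat)
    (X : nat -> 'I_c1 -> W -> Xi) (Y : nat -> 'I_c2 -> W -> Xi) (T : nat) : R :=
  if `[< forall t, (1 <= t <= T)%N ->
         independent_events P (sigma_of (range (X t))) (sigma_of (range (Y t)))
      >] then 1 else 2.

Record hybrid_run (W Xi : Type) (R : realType) (p q n : nat)
    (F : 'cV[R]_p -> Xi -> 'cV[R]_q) (K : 'M[R]_(q, n))
    (psi : 'cV[R]_n -> \bar R) (Rg : 'cV[R]_p -> \bar R)
    (b0 hb0 b1 hb1 b2 hb2 : nat)
    (B : minibatches W Xi b0 hb0 b1 hb1 b2 hb2)
    (beta hbeta theta eta : nat -> R) (x0 : 'cV[R]_p) (T : nat)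
    (Ft : nat -> W -> 'cV[R]_q) (Jt : nat -> W -> 'M[R]_(q, p))
    (v xhat x : nat -> W -> 'cV[R]_p) : Prop := HybridRun {
  run_x0 : forall w, x 0%N w = x0;
  run_F0 : forall w, Ft 0%N w = b0%:R^-1 *: \sum_i F x0 (B0 B i w);
  run_J0 : forall w, Jt 0%N w = hb0%:R^-1 *: \sum_i Fjac F x0 (hB0 B i w);
  run_F : forall t w, (t < T)%N ->
    Ft t.+1 w = beta t *: Ft t w
      + (beta t / b1%:R) *:
          \sum_i (F (x t.+1 w) (B1 B t.+1 i w) - F (x t w) (B1 B t.+1 i w))
      + ((1 - beta t) / b2%:R) *: \sum_i F (x t.+1 w) (B2 B t.+1 i w);
  run_J : forall t w, (t < T)%N ->
    Jt t.+1 w = hbeta t *: Jt t w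
      + (hbeta t / hb1%:R) *:
          \sum_i (Fjac F (x t.+1 w) (hB1 B t.+1 i w)
                  - Fjac F (x t w) (hB1 B t.+1 i w))
      + ((1 - hbeta t) / hb2%:R) *:
          \sum_i Fjac F (x t.+1 w) (hB2 B t.+1 i w);
  run_v : forall t w, (t <= T)%N ->
    v t w = (Jt t w)^T *m (K *m y0star K psi (Ft t w));
  run_xhat : forall t w, (t <= T)%N ->
    xhat t.+1 w = prox (fun z => ((eta t)%:E * Rg z)%E)
                       (x t w - eta t *: v t w);
  run_x : forall t w, (t <= T)%N ->
    x t.+1 w = (1 - theta t) *: x t w + theta t *: xhat t.+1 w
}.

Definition constP (R : realType) (c0 nK kappa hkappa L_F M_F M_psi : R) : R :=
  Num.sqrt 26 * nK / (3 * Num.sqrt c0) *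
  Num.sqrt (kappa * M_F ^+ 4 * nK ^+ 2 + c0 * hkappa * L_F ^+ 2 * M_psi ^+ 2).

Definition constQ (R : realType)
    (c0 nK kappa hkappa M_F M_psi sigma_F sigma_J : R) : R :=
  26 / (9 * c0) * nK ^+ 2 *
  (kappa * M_F ^+ 2 * nK ^+ 2 * sigma_F ^+ 2
   + c0 * hkappa * M_psi ^+ 2 * sigma_J ^+ 2).

Definition constLPhi (R : realType) (nK L_F M_F M_psi : R) : R :=
  L_F * M_psi * nK + M_F ^+ 2 * nK ^+ 2.

(* Main.v *)
Require Import Defs.
From HB Require Import structures.
From mathcomp Require Import all_boot all_order all_algebra.
From mathcomp Require Import all_classical all_reals all_analysis.
From mathcomp Require Import measurable_realfun ring lra.

Set Implicit Arguments.
Unset Strict Implicit.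
Unset Printing Implicit Defensive.

Import Order.TTheory GRing.Theory Num.Theory.
Import numFieldNormedType.Exports.

Local Open Scope classical_set_scope.
Local Open Scope ring_scope.

(** The proof combines a pathwise descent inequality for an inexact proximal
gradient step with a recursion for the mean-square error of the two hybrid
estimators.

Strong convexity makes the dual maximizer [y0star] unique and Lipschitz with
constant [|K|], so [phi0] is smooth with gradient [K y0star] ([phi_diff]) and
[Phi0] has a gradient that is [L_Phi]-Lipschitz along the domain of the
regularizer.  Nonexpansiveness of the proximal map then gives [one_step]: up to
[13 / 8 * theta / L] times the squared error of the direction [v], each step
decreases the objective by [theta / (16 L)] times the squared gradient mapping,
and by [theta L] times the squared move [xhat - x].  The error of [v] is
controlled by the errors of the estimators of [F] and of its Jacobian
([grad_estimator_error]).

The error of a hybrid estimator is [beta] times its previous error plus two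
noises that are centered given the past.  Freezing the past ([freezing]) makes
fresh draws orthogonal to it, so second moments add up ([pythagoras_batch]), with
a factor [kappa = 2] when the two batches may depend on each other
([two_batches]).  The increments are as small as the last move, because the
sampled map and its Jacobian are Lipschitz in mean square; for the sampled map
this has to be derived from the bound on its Jacobian by integrating along
segments ([mean_square_lipschitz]), where the derivative is not known to be
continuous ([increment_le_integral]).  The outcome is [hybrid_error].  The
iterates are functions of the draws made so far, measurable because Jacobians are
limits of difference quotients and the other maps involved are continuous
([run_adapted]).

Let [e] be the weighted sum of the two mean-square errors that bounds the error
of [v], and [d] the mean square of the move.  The constants [P] and [Q] are such
that [e (t + 1) <= beta^2 e t + beta^2 (9 P^2 / 13 b) theta^2 d t
+ (1 - beta)^2 (9 Q / 13 b)].  Multiplied by [13 / 9 * (sqrt b / P) * (t + 2)^(1/3)]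
and added to the descent inequality, this cancels the moves and the errors
([weight_decrease]), and what is left of the noise is a harmonic sum, whence the
logarithm ([average_rate]).  The random index is independent of the run, so the
expectation at the random iterate is the average with weights [theta]
([random_index_integral]). *)

(** * Euclidean geometry of matrices *)

Section Frobenius.
Variable R : realType.
Implicit Types m n k : nat.

(** The bilinear form whose norm is [frob]; on column vectors it is [inner]. *)
Definition mxdot m n (A B : 'M[R]_(m, n)) : R := \sum_i \sum_j A i j * B i j.

Lemma mxdotC m n (A B : 'M[R]_(m, n)) : mxdot A B = mxdot B A.
Proof. by apply: eq_bigr => i _; apply: eq_bigr => j _; rewrite mulrC. Qed.

Lemma mxdotDl m n (A B C : 'M[R]_(m, n)) :
  mxdot (A + B) C = mxdot A C + mxdot B C.
Proof.
rewrite -big_split /=; apply: eq_bigr => i _; rewrite -big_split /=.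
by apply: eq_bigr => j _; rewrite mxE mulrDl.
Qed.

Lemma mxdotZl m n (a : R) (A B : 'M[R]_(m, n)) :
  mxdot (a *: A) B = a * mxdot A B.
Proof.
rewrite mulr_sumr; apply: eq_bigr => i _; rewrite mulr_sumr.
by apply: eq_bigr => j _; rewrite mxE mulrA.
Qed.

Lemma mxdotNl m n (A B : 'M[R]_(m, n)) : mxdot (- A) B = - mxdot A B.
Proof. by rewrite -scaleN1r mxdotZl mulN1r. Qed.

Lemma mxdotBl m n (A B C : 'M[R]_(m, n)) :
  mxdot (A - B) C = mxdot A C - mxdot B C.
Proof. by rewrite mxdotDl mxdotNl. Qed.

Lemma mxdotDr m n (A B C : 'M[R]_(m, n)) :
  mxdot C (A + B) = mxdot C A + mxdot C B.
Proof. by rewrite mxdotC mxdotDl !(mxdotC C). Qed.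

Lemma mxdotZr m n (a : R) (A B : 'M[R]_(m, n)) :
  mxdot A (a *: B) = a * mxdot A B.
Proof. by rewrite mxdotC mxdotZl mxdotC. Qed.

Lemma mxdotNr m n (A B : 'M[R]_(m, n)) : mxdot A (- B) = - mxdot A B.
Proof. by rewrite mxdotC mxdotNl mxdotC. Qed.

Lemma mxdotBr m n (A B C : 'M[R]_(m, n)) :
  mxdot C (A - B) = mxdot C A - mxdot C B.
Proof. by rewrite mxdotDr mxdotNr. Qed.

Lemma mxdot0l m n (A : 'M[R]_(m, n)) : mxdot 0 A = 0.
Proof. by rewrite -(scale0r 0) mxdotZl mul0r. Qed.

Lemma mxdot0r m n (A : 'M[R]_(m, n)) : mxdot A 0 = 0.
Proof. by rewrite mxdotC mxdot0l. Qed.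

Definition mxdotE := (mxdotDl, mxdotDr, mxdotBl, mxdotBr, mxdotNl, mxdotNr,
  mxdotZl, mxdotZr).

Lemma mxdot_ge0 m n (A : 'M[R]_(m, n)) : 0 <= mxdot A A.
Proof.
by apply: sumr_ge0 => i _; apply: sumr_ge0 => j _; rewrite -expr2 sqr_ge0.
Qed.

Lemma frobE m n (A : 'M[R]_(m, n)) : frob A ^+ 2 = mxdot A A.
Proof.
rewrite /frob sqr_sqrtr; last first.
  by apply: sumr_ge0 => i _; apply: sumr_ge0 => j _; rewrite sqr_ge0.
by apply: eq_bigr => i _; apply: eq_bigr => j _; rewrite expr2.
Qed.

Lemma frob_ge0 m n (A : 'M[R]_(m, n)) : 0 <= frob A.
Proof. exact: sqrtr_ge0. Qed.

Lemma frob0 m n : frob (0 : 'M[R]_(m, n)) = 0.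
Proof. by apply/eqP; rewrite -sqrf_eq0 frobE mxdot0l. Qed.

Lemma frobZ m n (a : R) (A : 'M[R]_(m, n)) : frob (a *: A) = `|a| * frob A.
Proof.
apply/eqP; rewrite -(@eqrXn2 _ 2) ?frob_ge0 ?mulr_ge0 ?frob_ge0 ?normr_ge0 //.
by rewrite exprMn !frobE real_normK ?num_real // mxdotZl mxdotZr mulrA expr2.
Qed.

Lemma frobN m n (A : 'M[R]_(m, n)) : frob (- A) = frob A.
Proof. by rewrite -scaleN1r frobZ normrN1 mul1r. Qed.

Lemma frobBC m n (A B : 'M[R]_(m, n)) : frob (A - B) = frob (B - A).
Proof. by rewrite -frobN opprB. Qed.

Lemma frob_eq0 m n (A : 'M[R]_(m, n)) : frob A = 0 -> A = 0.
Proof.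
move=> /(congr1 (fun x => x ^+ 2)); rewrite frobE expr0n /= => /eqP.
rewrite psumr_eq0; last first.
  by move=> i _; apply: sumr_ge0 => j _; rewrite -expr2 sqr_ge0.
move=> /allP A0; apply/matrixP => i j; rewrite mxE.
have := A0 i (mem_index_enum _); rewrite /= psumr_eq0; last first.
  by move=> k _; rewrite -expr2 sqr_ge0.
move=> /allP /(_ j (mem_index_enum _)) /=.
by rewrite -expr2 sqrf_eq0 => /eqP.
Qed.

(** Cauchy-Schwarz, from the sign of the square of [frob B *: A - frob A *: B]. *)
Lemma mxdot_le m n (A B : 'M[R]_(m, n)) : mxdot A B <= frob A * frob B.
Proof.
have [a0|a_neq0] := eqVneq (frob A) 0.
  by rewrite a0 mul0r (frob_eq0 a0) mxdot0l.
have [b0|b_neq0] := eqVneq (frob B) 0.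
  by rewrite b0 mulr0 (frob_eq0 b0) mxdot0r.
have a_gt0 : 0 < frob A by rewrite lt_def a_neq0 frob_ge0.
have b_gt0 : 0 < frob B by rewrite lt_def b_neq0 frob_ge0.
have ab_gt0 := mulr_gt0 a_gt0 b_gt0.
have := mxdot_ge0 (frob B *: A - frob A *: B).
rewrite !mxdotE -!frobE (mxdotC B A) => h.
suff : frob A * frob B * mxdot A B <= (frob A * frob B) * (frob A * frob B).
  by rewrite ler_pM2l.
by nra.
Qed.

Lemma mxdot_le_norm m n (A B : 'M[R]_(m, n)) : `|mxdot A B| <= frob A * frob B.
Proof.
by rewrite ler_norml mxdot_le andbT lerNl -mxdotNl -(frobN A) mxdot_le.
Qed.

Lemma frobD m n (A B : 'M[R]_(m, n)) : frob (A + B) <= frob A + frob B.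
Proof.
rewrite -ler_sqr ?nnegrE ?addr_ge0 ?frob_ge0 //.
rewrite frobE !mxdotE -!frobE (mxdotC B A); have := mxdot_le A B; nra.
Qed.

Lemma frob_tr m n (A : 'M[R]_(m, n)) : frob A^T = frob A.
Proof.
rewrite /frob exchange_big /=; congr Num.sqrt.
by apply: eq_bigr => i _; apply: eq_bigr => j _; rewrite mxE.
Qed.

Lemma coord_le_frob m n (A : 'M[R]_(m, n)) i j : `|A i j| <= frob A.
Proof.
rewrite -ler_sqr ?nnegrE ?frob_ge0 ?normr_ge0 //.
rewrite real_normK ?num_real // frobE.
rewrite /mxdot (bigD1 i) //= (bigD1 j) //= -expr2 -addrA lerDl.
rewrite addr_ge0 //; first by apply: sumr_ge0 => k _; rewrite -expr2 sqr_ge0.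
by apply: sumr_ge0 => k _; apply: sumr_ge0 => l _; rewrite -expr2 sqr_ge0.
Qed.

Lemma mxnorm_le_frob m n (A : 'M[R]_(m, n)) : `|A| <= frob A.
Proof.
rewrite [leLHS]/Num.norm /= mx_normrE; apply/bigmax_leP.
by split=> [|ij _]; rewrite ?frob_ge0 ?coord_le_frob.
Qed.

(** Together with [mxnorm_le_frob], this lets Euclidean estimates be used for
the topology, which is that of the sup norm. *)
Lemma frob_le_mxnorm m n (A : 'M[R]_(m, n)) :
  frob A <= (m * n)%:R * `|A|.
Proof.
have [mn0|mn_gt0] := posnP (m * n).
  rewrite mn0 mul0r /frob; suff -> : \sum_i \sum_j A i j ^+ 2 = 0.
    by rewrite sqrtr0.
  apply: big1 => i _; apply: big1 => j _.
  have := leq_mul (leq_ltn_trans (leq0n i) (ltn_ord i))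
                  (leq_ltn_trans (leq0n j) (ltn_ord j)).
  by rewrite mn0.
rewrite -ler_sqr ?nnegrE ?frob_ge0 ?mulr_ge0 ?normr_ge0 //.
rewrite frobE exprMn.
have Ale i j : A i j * A i j <= `|A| ^+ 2.
  rewrite -expr2 -real_normK ?num_real // ler_sqr ?nnegrE ?normr_ge0 //.
  rewrite [leRHS]/Num.norm /= mx_normrE; apply/bigmax_geP; right => /=.
  by exists (i, j).
apply: (@le_trans _ _ ((m * n)%:R * `|A| ^+ 2)).
  rewrite /mxdot.
  apply: (@le_trans _ _ (\sum_(i < m) \sum_(j < n) `|A| ^+ 2)).
    by apply: ler_sum => i _; apply: ler_sum => j _; exact: Ale.
  by rewrite !sumr_const !card_ord -mulrnA -[leLHS]mulr_natl mulnC lexx.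
rewrite ler_wpM2r ?sqr_ge0 // -natrX ler_nat.
by rewrite expnS expn1 leq_pmulr.
Qed.

Lemma mxdot_mulmxl m n k (A : 'M[R]_(m, n)) (B : 'M[R]_(n, k))
    (C : 'M[R]_(m, k)) : mxdot (A *m B) C = mxdot B (A^T *m C).
Proof.
transitivity (\sum_i \sum_j \sum_l A i l * B l j * C i j).
  apply: eq_bigr => i _; apply: eq_bigr => j _.
  by rewrite mxE mulr_suml.
rewrite /mxdot exchange_big /= [RHS]exchange_big /=.
apply: eq_bigr => j _; rewrite exchange_big /=; apply: eq_bigr => l _.
rewrite mxE mulr_sumr; apply: eq_bigr => i _; rewrite mxE; ring.
Qed.

Lemma frobM m n k (A : 'M[R]_(m, n)) (B : 'M[R]_(n, k)) :
  frob (A *m B) <= frob A * frob B.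
Proof.
rewrite -ler_sqr ?nnegrE ?mulr_ge0 ?frob_ge0 //.
rewrite exprMn !frobE.
have dotE i j : (A *m B) i j = mxdot (row i A) (col j B)^T.
  rewrite mxE /mxdot big_ord_recl big_ord0 addr0.
  by apply: eq_bigr => l _; rewrite !mxE.
apply: (@le_trans _ _ (\sum_i \sum_j
    (frob (row i A) ^+ 2 * frob (col j B)^T ^+ 2))).
  apply: ler_sum => i _; apply: ler_sum => j _.
  rewrite dotE -expr2 -real_normK ?num_real // -exprMn.
  by rewrite ler_sqr ?nnegrE ?mulr_ge0 ?frob_ge0 ?normr_ge0 ?mxdot_le_norm.
have -> : mxdot A A = \sum_i frob (row i A) ^+ 2.
  apply: eq_bigr => i _; rewrite frobE /mxdot big_ord_recl big_ord0 addr0.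
  by apply: eq_bigr => l _; rewrite !mxE.
have -> : mxdot B B = \sum_j frob (col j B)^T ^+ 2.
  rewrite /mxdot exchange_big /=; apply: eq_bigr => i _.
  rewrite frobE /mxdot big_ord_recl big_ord0 addr0.
  by apply: eq_bigr => l _; rewrite !mxE.
by rewrite mulr_suml; apply: ler_sum => i _; rewrite mulr_sumr.
Qed.

Lemma innerE n (u v : 'cV[R]_n) : inner u v = mxdot u v.
Proof.
rewrite /inner mxE; apply: eq_bigr => i _; rewrite mxE.
by rewrite big_ord_recl big_ord0 addr0.
Qed.

Lemma specnorm_has_sup m n (A : 'M[R]_(m, n)) :
  has_sup [set frob (A *m y) | y in [set y : 'cV[R]_n | frob y <= 1]].
Proof.
split; first by exists (frob (A *m (0 : 'cV[R]_n))); exists (0 : 'cV[R]_n); rewrite //= frob0 ler01.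
exists (frob A) => _ [y /= y1 <-]; apply: le_trans (frobM _ _) _.
by rewrite ler_piMr ?frob_ge0.
Qed.

Lemma specnorm_ge0 m n (A : 'M[R]_(m, n)) : 0 <= specnorm A.
Proof.
apply: (@le_trans _ _ (frob (A *m (0 : 'cV_n)))); first exact: frob_ge0.
by apply: (sup_upper_bound (specnorm_has_sup A)); exists 0; rewrite //= frob0.
Qed.

Lemma frob_mulmx_specnorm m n (A : 'M[R]_(m, n)) (y : 'cV[R]_n) :
  frob (A *m y) <= specnorm A * frob y.
Proof.
have [y0|y_neq0] := eqVneq (frob y) 0.
  by rewrite (frob_eq0 y0) mulmx0 !frob0 mulr0.
have y_gt0 : 0 < frob y by rewrite lt_def y_neq0 frob_ge0.
rewrite -ler_pdivrMr // mulrC.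
suff: frob (A *m ((frob y)^-1 *: y)) <= specnorm A.
  by rewrite -scalemxAr frobZ ger0_norm // invr_ge0 frob_ge0.
apply: (sup_upper_bound (specnorm_has_sup A)); exists ((frob y)^-1 *: y) => //=.
by rewrite frobZ ger0_norm ?invr_ge0 ?frob_ge0 // mulVf.
Qed.

(** The spectral norm of the adjoint: [|A^T u|^2 = <u, A (A^T u)>]. *)
Lemma frob_trmx_specnorm m n (A : 'M[R]_(m, n)) (u : 'cV[R]_m) :
  frob (A^T *m u) <= specnorm A * frob u.
Proof.
have [y0|y_neq0] := eqVneq (frob (A^T *m u)) 0.
  by rewrite y0 mulr_ge0 ?specnorm_ge0 ?frob_ge0.
have y_gt0 : 0 < frob (A^T *m u) by rewrite lt_def y_neq0 frob_ge0.
rewrite -(ler_pM2r y_gt0) -expr2 frobE -mxdot_mulmxl mxdotC.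
apply: le_trans (mxdot_le _ _) _.
by rewrite [leRHS]mulrAC mulrC ler_wpM2r ?frob_ge0 // frob_mulmx_specnorm.
Qed.

Lemma frob_convex m n (x y : 'M[R]_(m, n)) (a : R) :
  frob (a *: x + (1 - a) *: y) ^+ 2 =
  a * frob x ^+ 2 + (1 - a) * frob y ^+ 2 - a * (1 - a) * frob (x - y) ^+ 2.
Proof. by rewrite !frobE !mxdotE (mxdotC y x); ring. Qed.

End Frobenius.

(** * Minimizers of strongly convex functions *)

Section StronglyConvex.
Variables (R : realType) (n : nat) (f : 'cV[R]_n -> \bar R).
Hypothesis f_proper : proper_efun f.
Hypothesis f_lsc : lower_semicontinuous f.
Hypothesis f_sconvex : strongly_convex 1 f.

Lemma strongly_convex_le (x y : 'cV[R]_n) (a b t : R) : 0 <= t <= 1 ->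
  f x = a%:E -> f y = b%:E ->
  (f (t *: x + (1 - t) *: y)%R <=
   (t * a + (1 - t) * b - 2^-1 * (t * (1 - t) * frob (x - y) ^+ 2))%:E)%E.
Proof.
move=> t01 fx fy; have := f_sconvex x y t01; rewrite fx fy.
rewrite -!EFinB -!EFinM -EFinD leeBlDr // -EFinD frob_convex.
case: (f _) => [u| |]; last 2 first.
- by rewrite leye_eq.
- by move=> _; rewrite leNye.
by rewrite !lee_fin; lra.
Qed.

(** Lower semicontinuity bounds [f] below on a ball, and strong convexity
along rays turns this into a quadratic lower bound outside the ball. *)
Lemma strongly_convex_bounded_below : exists m : R, forall x, (m%:E <= f x)%E.
Proof.
have [[x0 dx0] fNoo] := f_proper.
have [a0 fx0] : exists a0, f x0 = a0%:E.
  move: dx0 (fNoo x0); rewrite /edom /=.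
  by case: (f x0) => [a0| |] // _ _; exists a0.
have [V /nbhs_ballP [r /= r_gt0 rV] Vf] : exists2 V, nbhs x0 V &
    forall y, V y -> ((a0 - 1)%:E < f y)%E.
  by apply: f_lsc; rewrite fx0 lte_fin; lra.
have near_x0 y : frob (y - x0) < r -> ((a0 - 1)%:E < f y)%E.
  move=> yr; apply/Vf/rV; rewrite -ball_normE /ball_ /=.
  by apply: le_lt_trans (mxnorm_le_frob _) _; rewrite frobBC.
exists (a0 - 1 - 4 / r ^+ 2) => x.
have r2_gt0 : 0 < 4 / r ^+ 2 by rewrite divr_gt0 ?exprn_gt0.
have [Dr|rD] := ltP (frob (x - x0)) r.
  by apply: le_trans (ltW (near_x0 x Dr)); rewrite lee_fin; lra.
case fx : (f x) => [b| |]; last 2 first.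
- by rewrite leey.
- by have := fNoo x; rewrite fx.
set D := frob (x - x0) in rD; have D_gt0 : 0 < D by exact: lt_le_trans r_gt0 rD.
pose t := r / (2 * D).
have tD : t * D = r / 2 by rewrite /t; field; rewrite gt_eqF.
have t_gt0 : 0 < t by rewrite divr_gt0 // mulr_gt0.
have t_le : t <= 2^-1 by rewrite ler_pdivrMr ?mulr_gt0 //; lra.
have t01 : 0 <= t <= 1 by apply/andP; split; lra.
have := strongly_convex_le t01 fx fx0; rewrite -/D.
have zx0 : frob (t *: x + (1 - t) *: x0 - x0) < r.
  have -> : t *: x + (1 - t) *: x0 - x0 = t *: (x - x0).
    by apply/matrixP => i j; rewrite !mxE; ring.
  by rewrite frobZ gtr0_norm // -/D tD; lra.
move=> /(lt_le_trans (near_x0 _ zx0)); rewrite lte_fin lee_fin => h.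
(* dividing by t, b - a0 > - 2 D / r + D^2 / 4 = (D / 2 - 2 / r)^2 - 4 / r^2 *)
have h1 : t * (b - a0) > t * (- (2 * D / r) + 2^-1 * ((1 - t) * D ^+ 2)).
  have -> : t * (- (2 * D / r) + 2^-1 * ((1 - t) * D ^+ 2)) =
            - (2 * (t * D) / r) + 2^-1 * (t * (1 - t) * D ^+ 2) by ring.
  have -> : 2 * (t * D) / r = 1 by rewrite tD; field; rewrite gt_eqF.
  lra.
rewrite ltr_pM2l // in h1.
have h2 : 2^-1 * ((1 - t) * D ^+ 2) >= 4^-1 * D ^+ 2 by nra.
have := sqr_ge0 (D / 2 - 2 / r).
have -> : (D / 2 - 2 / r) ^+ 2 = 4^-1 * D ^+ 2 - 2 * D / r + 4 / r ^+ 2.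
  by field; rewrite gt_eqF.
lra.
Qed.

(** A minimizing sequence is Cauchy, because the values at midpoints cannot fall
below the infimum. *)
Lemma strongly_convex_minimizer : exists z a, f z = a%:E /\
  forall x, (a%:E <= f x)%E.
Proof.
have [m fm] := strongly_convex_bounded_below.
have [[x0 dx0] fNoo] := f_proper.
pose S := [set b : R | exists x, f x = b%:E].
have S0 : S !=set0.
  move: dx0 (fNoo x0); rewrite /edom /=.
  by case fx0 : (f x0) => [a0| |] // _ _; exists a0, x0.
have Slb : has_inf S.
  by split=> //; exists m => b [x fx]; have := fm x; rewrite fx lee_fin.
pose I := inf S.
have I_le x : (I%:E <= f x)%E.
  case fx : (f x) => [b| |]; last 2 first.
  - by rewrite leey.
  - by have := fNoo x; rewrite fx.
  by rewrite lee_fin; apply: (inf_lbound Slb.2); exists x.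
have /choice [u uP] : forall k : nat, exists x, exists2 b,
    f x = b%:E & b < I + k.+1%:R^-1.
  move=> k; have k0 : 0 < k.+1%:R^-1 :> R by rewrite invr_gt0.
  by have [b [x fx] bI] := inf_adherent k0 Slb; exists x, b.
have u_cauchy k l : frob (u k - u l) ^+ 2 <= 4 * (k.+1%:R^-1 + l.+1%:R^-1).
  have [[b fk bk] [c fl cl]] := (uP k, uP l).
  have half01 : 0 <= (2^-1 : R) <= 1 by apply/andP; split; lra.
  have := le_trans (I_le _) (strongly_convex_le half01 fk fl).
  rewrite lee_fin; move: (k.+1%:R^-1) (l.+1%:R^-1) bk cl => d e bk cl.
  by move: (frob _ ^+ 2) => D; lra.
have u_cvg : cvgn u.
  apply/cauchy_cvgP/cauchy_ballP => e e_gt0; near_simpl.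
  have [N Ne] : exists N : nat, 8 / N.+1%:R < e ^+ 2.
    have e2 : 0 < 8 / e ^+ 2 by rewrite divr_gt0 ?exprn_gt0.
    exists (Num.bound (8 / e ^+ 2)).
    rewrite ltr_pdivrMr // mulrC -ltr_pdivrMr ?exprn_gt0 //.
    apply: lt_trans (archi_boundP (ltW e2)) _.
    by rewrite ltr_nat.
  exists ([set k | (N <= k)%N], [set k | (N <= k)%N]).
    by split; exists N.
  move=> [k l] /= [Nk Nl]; rewrite -ball_normE /ball_ /=.
  apply: le_lt_trans (mxnorm_le_frob _) _.
  rewrite -ltr_sqr ?nnegrE ?frob_ge0 ?ltW //.
  apply: le_lt_trans (u_cauchy k l) (le_lt_trans _ Ne).
  have inv_le j : (N <= j)%N -> j.+1%:R^-1 <= N.+1%:R^-1 :> R.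
    by move=> Nj; rewrite lef_pV2 ?posrE ?ltr0n // ler_nat.
  move: (inv_le _ Nk) (inv_le _ Nl).
  by move: (k.+1%:R^-1) (l.+1%:R^-1) (N.+1%:R^-1) => *; lra.
pose z := limn u.
have u_z : u @ \oo --> z by [].
have fz : (f z <= I%:E)%E.
  rewrite leNgt; apply/negP => Ifz.
  have [c Ic cfz] : exists2 c, I < c & (c%:E < f z)%E.
    move: Ifz; case: (f z) => [a| |] //.
      by rewrite lte_fin => Ia; exists ((I + a) / 2); rewrite ?lte_fin; lra.
    by exists (I + 1); [lra | rewrite ltry].
  have [V Vz Vf] := f_lsc cfz.
  have [N _ NV] := u_z _ Vz.
  have cI : 0 < (c - I)^-1 by rewrite invr_gt0 subr_gt0.
  pose k := maxn N (Num.bound (c - I)^-1).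
  have [b fk bk] := uP k.
  have := Vf _ (NV k (leq_maxl _ _)); rewrite fk lte_fin; apply/negP.
  rewrite -leNgt; apply: ltW; apply: (lt_trans bk).
  rewrite addrC -ltrBrDr -[ltRHS]invrK ltf_pV2 ?posrE ?ltr0n //.
  apply: lt_le_trans (archi_boundP (ltW cI)) _.
  by rewrite ler_nat leqW // leq_maxr.
exists z, I; split; last exact: I_le.
by apply/eqP; rewrite eq_le fz I_le.
Qed.

(** A strongly convex function grows quadratically away from its minimizer:
compare the minimum with the value at a point close to the minimizer on the
segment towards [x]. *)
Lemma strongly_convex_argmin : exists2 z, edom f z &
  forall x, (f z + (2^-1 * frob (x - z) ^+ 2)%:E <= f x)%E.
Proof.
have [z [I [fz I_le]]] := strongly_convex_minimizer.
exists z => [|x]; first by rewrite /edom /= fz ltry.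
case fx : (f x) => [b| |]; last 2 first.
- by rewrite leey.
- by have := I_le x; rewrite fx.
rewrite fz -EFinD lee_fin leNgt; apply/negP => h.
set D2 := frob (x - z) ^+ 2 in h.
have D2_ge0 : 0 <= D2 by rewrite sqr_ge0.
pose gap := I + 2^-1 * D2 - b; have gap_gt0 : 0 < gap by rewrite subr_gt0.
pose t := gap / (D2 + gap).
have Dgap : 0 < D2 + gap by lra.
have t_gt0 : 0 < t by rewrite divr_gt0.
have tE : t * (D2 + gap) = gap by rewrite divfK // gt_eqF.
have t01 : 0 <= t <= 1.
  by rewrite ltW //= ler_pdivrMr // mul1r; lra.
have := le_trans (I_le _) (strongly_convex_le t01 fx fz).
rewrite lee_fin -/D2 => h1.
have h2 : 0 <= t * (b - I - 2^-1 * ((1 - t) * D2)) by lra.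
rewrite pmulr_rge0 // in h2.
by move: h2; rewrite /gap in gap_gt0 tE *; nra.
Qed.
End StronglyConvex.

(** * Continuity and quadratic differentiability in the Euclidean norm *)

Section EuclideanTopology.
Variable R : realType.

Lemma lipschitz_continuous (V W : normedModType R) (h : V -> W) (C : R) :
  (forall x y, `|h x - h y| <= C * `|x - y|) -> continuous h.
Proof.
move=> hC x; apply/cvgrPdist_lt => e e_gt0.
pose D := `|C| + 1; have D_gt0 : 0 < D by rewrite ltr_pwDr.
near=> y; apply: le_lt_trans (hC _ _) _.
apply: (@le_lt_trans _ _ (D * `|x - y|)).
  by rewrite ler_wpM2r // (le_trans (ler_norm _)) // lerDl.
rewrite -ltr_pdivlMl //; near: y; apply: cvgr_dist_lt => //.
by rewrite mulr_gt0 // invr_gt0.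
Unshelve. all: by end_near. Qed.

Lemma frob_lipschitz_continuous m n k l (h : 'M[R]_(m, n) -> 'M[R]_(k, l))
    (C : R) :
  (forall x y, frob (h x - h y) <= C * frob (x - y)) -> continuous h.
Proof.
move=> hC; apply: (@lipschitz_continuous _ _ _ (`|C| * (m * n)%:R)) => x y.
apply: le_trans (mxnorm_le_frob _) (le_trans (hC _ _) _).
apply: le_trans (ler_wpM2r (frob_ge0 _) (ler_norm C)) _.
by rewrite -mulrA ler_wpM2l // frob_le_mxnorm.
Qed.

Lemma frob_continuous m n : continuous (@frob R m n).
Proof.
apply: (@lipschitz_continuous _ _ _ (m * n)%:R) => x y.
apply: le_trans (frob_le_mxnorm _).
have := frobD (x - y) y; have := frobD (y - x) x; rewrite !subrK frobBC => h1 h2.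
by rewrite ler_norml; apply/andP; split; lra.
Qed.

Lemma sqdist_continuous m n (x : 'M[R]_(m, n)) :
  continuous (fun z : 'M[R]_(m, n) => frob (z - x) ^+ 2).
Proof.
have subc : continuous (fun z : 'M[R]_(m, n) => z - x).
  apply: (@lipschitz_continuous _ _ _ 1) => y z.
  by rewrite opprB addrA subrK mul1r.
have frobc : continuous (fun z : 'M[R]_(m, n) => frob (z - x)).
  by move=> z; apply: (continuous_comp (subc z)); exact: frob_continuous.
move=> z; exact: (continuous_comp (frobc z) (@exprn_continuous _ 2 _)).
Qed.

Lemma mxdot_continuous m n (A : 'M[R]_(m, n)) : continuous (mxdot A).
Proof.
apply: (@lipschitz_continuous _ _ _ (frob A * (m * n)%:R)) => x y.
rewrite -mxdotBr; apply: le_trans (mxdot_le_norm _ _) _.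
by rewrite -mulrA ler_wpM2l ?frob_ge0 // frob_le_mxnorm.
Qed.

(** The quadratic remainder is little-o of the increment, so the affine part is
the differential. *)
Lemma quadratic_diff n (f : 'cV[R]_n -> R) (x c : 'cV[R]_n) (C : R) :
  (forall u, `|f u - f x - mxdot c (u - x)| <= C * frob (u - x) ^+ 2) ->
  differentiable f x /\ forall h, 'd f x h = mxdot c h.
Proof.
move=> fC.
have lin : linear (mxdot c) by move=> a u v; rewrite mxdotDr mxdotZr.
pose linM := GRing.isLinear.Build _ _ _ _ _ lin.
pose df : {linear _ -> _} := HB.pack (mxdot c) linM.
have dfc : continuous df by exact: mxdot_continuous.
have fE : f \o shift x = cst (f x) + df +o_ (0 : 'cV[R]_n) id.
  apply/eqaddoP => e e_gt0.
  pose k : R := (n * 1)%:R; pose D := `|C| * k ^+ 2 + 1.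
  have D_gt0 : 0 < D by rewrite ltr_pwDr // mulr_ge0 ?sqr_ge0.
  have small : \forall h \near (0 : 'cV[R]_n), `|h| <= D^-1 * e.
    by apply: nbhs0_le; rewrite mulr_gt0 ?invr_gt0.
  apply: filterS small => h small.
  have -> : (f \o shift x - (cst (f x) + df)) h =
            f (h + x) - f x - mxdot c (h + x - x).
    by rewrite addrK /= !fctE /df /=; ring.
  apply: le_trans (fC _) _; rewrite addrK.
  have hk : frob h ^+ 2 <= k ^+ 2 * `|h| ^+ 2.
    by rewrite -exprMn ler_sqr ?nnegrE ?frob_ge0 ?mulr_ge0 // frob_le_mxnorm.
  apply: (@le_trans _ _ (D * `|h| ^+ 2)).
    apply: (@le_trans _ _ (`|C| * frob h ^+ 2)).
      by rewrite ler_wpM2r ?sqr_ge0 // ler_norm.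
    apply: (@le_trans _ _ (`|C| * (k ^+ 2 * `|h| ^+ 2))).
      by rewrite ler_wpM2l.
    by rewrite mulrA ler_wpM2r ?sqr_ge0 // lerDl.
  by rewrite expr2 mulrA ler_wpM2r // -ler_pdivlMl.
have dE := diff_unique dfc fE.
split; last by move=> h; rewrite dE.
by apply/diff_locallyP; rewrite dE.
Qed.

Lemma lower_semicontinuousD n (f : 'cV[R]_n -> \bar R) (h : 'cV[R]_n -> R) :
  lower_semicontinuous f -> continuous h ->
  lower_semicontinuous (fun x => f x + (h x)%:E)%E.
Proof.
move=> f_lsc h_cont x a; rewrite -lteBlDr // -EFinB => afx.
have [c ac cfx] : exists2 c, a - h x < c & (c%:E < f x)%E.
  move: afx; case: (f x) => [b| |] //.
    by rewrite lte_fin => Ia; exists ((a - h x + b) / 2); rewrite ?lte_fin; lra.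
  by exists (a - h x + 1); [lra | rewrite ltry].
have [V Vx Vf] := f_lsc _ _ cfx.
have hx : \forall y \near x, a - c < h y.
  by apply: (cvgr_gt _ (h_cont x)); lra.
exists (V `&` [set y | a - c < h y]); first exact: filterI.
move=> y [/Vf cfy /= hy]; rewrite -lteBlDr // -EFinB.
by apply: lt_trans cfy; rewrite lte_fin; lra.
Qed.

Lemma lower_semicontinuousZ n (f : 'cV[R]_n -> \bar R) (a : R) : 0 < a ->
  lower_semicontinuous f -> lower_semicontinuous (fun x => a%:E * f x)%E.
Proof.
move=> a_gt0 f_lsc x c; rewrite -lte_pdivrMl // -EFinM => /f_lsc [V Vx Vf].
by exists V => // y /Vf; rewrite EFinM lte_pdivrMl.
Qed.

End EuclideanTopology.

(** * Proximal points and the smoothed max-function *)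

Section Argmin.
Variable R : realType.

Lemma convex_efunD n (f : 'cV[R]_n -> \bar R) (l : 'cV[R]_n -> R) :
  convex_efun f ->
  (forall x y t, l (t *: x + (1 - t) *: y) = t * l x + (1 - t) * l y) ->
  convex_efun (fun x => f x + (l x)%:E)%E.
Proof.
move=> f_convex lE x y t t01; rewrite lE !muleDr ?fin_num_adde_defl //.
by rewrite addeACA EFinD !EFinM; apply: leeD2r; exact: f_convex.
Qed.

Lemma edom_fine n (f : 'cV[R]_n -> \bar R) (x : 'cV[R]_n) :
  proper_efun f -> edom f x -> f x = (fine (f x))%:E.
Proof.
by move=> [_ fNoo] fx; rewrite fineK // fin_numElt fNoo.
Qed.

Lemma proper_edomP n (f : 'cV[R]_n -> \bar R) (x : 'cV[R]_n) :
  proper_efun f -> edom f x \/ f x = +oo%E.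
Proof.
move=> f_proper; have [fx|] := ltP (f x) +oo%E; first by left.
by rewrite leye_eq => /eqP; right.
Qed.

Lemma proper_efunD n (f : 'cV[R]_n -> \bar R) (l : 'cV[R]_n -> R) :
  proper_efun f -> proper_efun (fun x => f x + (l x)%:E)%E.
Proof.
move=> [[x0 dx0] fNoo]; split.
  by exists x0; rewrite /edom /= lte_add_pinfty // ltry.
by move=> x; have := fNoo x; case: (f x) => [a| |] //= _; rewrite ?ltNyr.
Qed.

(** The equations for [g] and [A] let the proximal point and the dual maximizer,
which [xget] selects from differently written sets, share one statement. *)
Lemma xget_argmin n (f g : 'cV[R]_n -> \bar R) (l : 'cV[R]_n -> R)
    (A : set 'cV[R]_n) :
  g = (fun x => f x + (l x)%:E)%E -> A = [set z | forall z', (g z <= g z')%E] ->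
  proper_efun f -> lower_semicontinuous g -> strongly_convex 1 g ->
  edom f (xget 0 A) /\ forall x, edom f x ->
    fine (f (xget 0 A)) + l (xget 0 A) + 2^-1 * frob (x - xget 0 A) ^+ 2
    <= fine (f x) + l x.
Proof.
move=> gE AE f_proper g_lsc g_sconvex.
have g_proper : proper_efun g by rewrite gE; exact: proper_efunD.
have [z dz zmin] := strongly_convex_argmin g_proper g_lsc g_sconvex.
have Az : A z.
  rewrite AE => x; apply: le_trans (zmin x); rewrite leeDl // lee_fin.
  by rewrite mulr_ge0 ?sqr_ge0.
have Ap := xgetPex 0 (ex_intro _ z Az); set p := xget 0 A in Ap *.
have pz : p = z.
  rewrite AE in Ap; have := le_trans (zmin p) (Ap z).
  rewrite (edom_fine g_proper dz) -EFinD lee_fin gerDl => h.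
  apply/subr0_eq/frob_eq0/eqP; rewrite -sqrf_eq0 eq_le sqr_ge0 andbT.
  by move: h; rewrite pmulr_rle0.
have dfg x : edom f x -> edom g x.
  by rewrite /edom gE /= => dx; rewrite lte_add_pinfty // ltry.
have dgf x : edom g x -> edom f x.
  by rewrite /edom gE /=; case: (f x) => [a| |] //= _; rewrite ltry.
rewrite pz; split; first exact: dgf.
move=> x dx; have := zmin x; rewrite gE (edom_fine f_proper dx).
by rewrite (edom_fine f_proper (dgf _ dz)) -!EFinD lee_fin.
Qed.

End Argmin.

Section Prox.
Variables (R : realType) (n : nat) (f : 'cV[R]_n -> \bar R).
Hypothesis f_proper : proper_efun f.
Hypothesis f_lsc : lower_semicontinuous f.
Hypothesis f_convex : convex_efun f.

Lemma prox_argmin (x : 'cV[R]_n) : edom f (prox f x) /\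
  forall z, edom f z ->
    fine (f (prox f x)) + 2^-1 * frob (prox f x - x) ^+ 2
      + 2^-1 * frob (z - prox f x) ^+ 2
    <= fine (f z) + 2^-1 * frob (z - x) ^+ 2.
Proof.
pose l z := 2^-1 * frob (z - x) ^+ 2.
apply: (@xget_argmin _ _ f (fun z => f z + (l z)%:E)%E l) => //.
- apply: lower_semicontinuousD => // z.
  have := @cvgMl_tmp _ _ _ _ _ (2^-1) _ (@sqdist_continuous _ _ _ x z).
  exact.
- have -> : strongly_convex 1 (fun z => (f z + (l z)%:E)%E) =
      convex_efun (fun z => (f z + (2^-1 * frob x ^+ 2 - mxdot z x)%:E)%E).
    rewrite /strongly_convex; congr convex_efun; apply/funext => z.
    rewrite -addeA -EFinB; congr (_ + _%:E)%E.
    by rewrite /l !frobE !mxdotE (mxdotC x z); field.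
  apply: convex_efunD => // y z t.
  by rewrite !mxdotE; ring.
Qed.

Lemma prox_dom (x : 'cV[R]_n) : edom f (prox f x).
Proof. by have [] := prox_argmin x. Qed.

Lemma prox_nonexpansive (x y : 'cV[R]_n) :
  frob (prox f x - prox f y) <= 1 * frob (x - y).
Proof.
have [dx hx] := prox_argmin x; have [dy hy] := prox_argmin y.
move: (prox f x) (prox f y) dx dy hx hy => p q dx dy hx hy.
have := hx _ dy; have := hy _ dx; rewrite mul1r (frobBC q p) => h1 h2.
have h : frob (p - q) ^+ 2 <= mxdot (p - q) (x - y).
  move: h1 h2; rewrite !frobE !mxdotE.
  rewrite (mxdotC q p) (mxdotC y p) (mxdotC x p) (mxdotC x q) (mxdotC y q).
  lra.
have {h} := le_trans h (mxdot_le _ _).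
have [-> _|pq_neq0] := eqVneq (frob (p - q)) 0; first exact: frob_ge0.
by rewrite expr2 ler_pM2l // lt_def pq_neq0 frob_ge0.
Qed.

Lemma prox_continuous : continuous (prox f).
Proof. exact: frob_lipschitz_continuous prox_nonexpansive. Qed.

End Prox.

Section ProxStep.
Variables (R : realType) (n : nat) (g : 'cV[R]_n -> \bar R) (eta : R).
Hypothesis eta_gt0 : 0 < eta.
Hypothesis g_proper : proper_efun g.
Hypothesis g_lsc : lower_semicontinuous g.
Hypothesis g_convex : convex_efun g.

Let f z := (eta%:E * g z)%E.

Lemma edomZ z : edom f z <-> edom g z.
Proof.
rewrite /edom /f /=; have := g_proper.2 z.
case: (g z) => [a| |] // _; first by rewrite -EFinM !ltry.
by rewrite gt0_muley ?lte_fin.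
Qed.

Lemma proper_efunZ : proper_efun f.
Proof.
split; first by have [[x dx] _] := g_proper; exists x; apply/edomZ.
move=> z; have := g_proper.2 z; rewrite /f.
case: (g z) => [a| |] // _; first by rewrite -EFinM !ltNyr.
by rewrite gt0_muley ?lte_fin.
Qed.

Lemma convex_efunZ : convex_efun f.
Proof.
move=> x y a a01; rewrite /f.
apply: le_trans (lee_wpmul2l _ (g_convex x y a01)) _.
  by rewrite lee_fin ltW.
have gNoo c z : 0 <= c -> (-oo < c%:E * g z)%E.
  rewrite le_eqVlt => /predU1P[<-|c_gt0]; first by rewrite mul0e ltNyr.
  have := g_proper.2 z; case: (g z) => [e| |] // _; first by rewrite ltNyr.
  by rewrite gt0_muley ?lte_fin.
rewrite muleDr //; last first.
  by apply: ltninfty_adde_def; rewrite inE; apply: gNoo; lra.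
by rewrite !muleA -!EFinM (mulrC eta a) (mulrC eta (1 - a)).
Qed.

Lemma prox_scaled_dom x : edom g (prox f x).
Proof.
apply/edomZ; apply: prox_dom proper_efunZ _ convex_efunZ _.
exact: lower_semicontinuousZ.
Qed.

Lemma prox_scaled_continuous : continuous (prox f).
Proof.
apply: prox_continuous proper_efunZ _ convex_efunZ.
exact: lower_semicontinuousZ.
Qed.

Lemma prox_scaled_nonexpansive x y :
  frob (prox f x - prox f y) <= frob (x - y).
Proof.
rewrite -[leRHS]mul1r; apply: prox_nonexpansive proper_efunZ _ convex_efunZ _ _.
exact: lower_semicontinuousZ.
Qed.

(** The inequality that a proximal gradient step with direction [v] gives:
the regularizer pays for the move [p - x] up to the term linear in [v]. *)
Lemma prox_step_le x v (p := prox f (x - eta *: v)) : edom g x ->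
  fine (g p) + eta^-1 * frob (p - x) ^+ 2 + mxdot v (p - x) <= fine (g x).
Proof.
move=> dx; have fineZ z : edom g z -> fine (f z) = eta * fine (g z).
  by move=> dz; rewrite /f (edom_fine g_proper dz).
have [_] := prox_argmin proper_efunZ (lower_semicontinuousZ eta_gt0 g_lsc)
  convex_efunZ (x - eta *: v).
move=> /(_ x); rewrite -/p => /(_ ((edomZ x).2 dx)).
rewrite !fineZ //; last exact: prox_scaled_dom.
have -> : frob (p - (x - eta *: v)) ^+ 2 =
    frob (p - x) ^+ 2 + 2 * (eta * mxdot v (p - x)) + eta ^+ 2 * frob v ^+ 2.
  rewrite !frobE !mxdotE (mxdotC v p) (mxdotC v x) (mxdotC x p); ring.
have -> : frob (x - (x - eta *: v)) ^+ 2 = eta ^+ 2 * frob v ^+ 2.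
  by rewrite subKr frobZ exprMn real_normK ?num_real.
rewrite (frobBC x p) => h.
rewrite -(ler_pM2l eta_gt0) !mulrDr mulrA mulfV ?gt_eqF // mul1r.
lra.
Qed.

End ProxStep.

(** ** The maximizer in the definition of the smoothed function *)

Section Dual.
Variables (R : realType) (q n : nat) (K : 'M[R]_(q, n)).
Variable psi : 'cV[R]_n -> \bar R.
Hypothesis psi_proper : proper_efun psi.
Hypothesis psi_lsc : lower_semicontinuous psi.
Hypothesis psi_sconvex : strongly_convex 1 psi.

Let ystar := y0star K psi.
Let phi u := fine (phi0 K psi u).

Lemma y0star_argmax (u : 'cV[R]_q) : edom psi (ystar u) /\
  forall y, edom psi y ->
    mxdot u (K *m y) - fine (psi y) + 2^-1 * frob (y - ystar u) ^+ 2
    <= mxdot u (K *m ystar u) - fine (psi (ystar u)).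
Proof.
pose l y := - mxdot u (K *m y).
have [] := @xget_argmin _ _ psi (fun z => psi z + (l z)%:E)%E l
  [set y | forall y', ((inner u (K *m y'))%:E - psi y' <=
                       (inner u (K *m y))%:E - psi y)%E] => //.
- have objE y : ((inner u (K *m y))%:E - psi y = - (psi y + (l y)%:E))%E.
    rewrite innerE /l; case: (psi y) => [a| |] //.
    by rewrite -EFinB -EFinD -EFinN; congr EFin; ring.
  apply/seteqP; split=> y /= ymax y'; have := ymax y'.
  + by rewrite !objE leeN2.
  + by rewrite -leeN2 -!objE.
- apply: lower_semicontinuousD => // y; rewrite /l.
  have -> : (fun y => - mxdot u (K *m y)) = mxdot (- (K^T *m u)).
    by apply/funext => z; rewrite mxdotNl mxdotC mxdot_mulmxl mxdotC.
  exact: mxdot_continuous.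
- have -> : strongly_convex 1 (fun z => (psi z + (l z)%:E)%E) = convex_efun
     (fun z => ((psi z - (1 / 2 * frob z ^+ 2)%:E) + (l z)%:E)%E).
    by rewrite /strongly_convex; congr convex_efun; apply/funext => z;
      rewrite addeAC.
  apply: convex_efunD => // y z t.
  by rewrite /l mulmxDr -!scalemxAr !mxdotE; ring.
- rewrite -/(y0star K psi u) -/ystar /l => dy ymin; split=> // y /ymin.
  lra.
Qed.

(** Add the growth inequalities of the two maximizers, each tested at the
other. *)
Lemma y0star_lipschitz (u w : 'cV[R]_q) :
  frob (ystar u - ystar w) <= specnorm K * frob (u - w).
Proof.
have [du hu] := y0star_argmax u; have [dw hw] := y0star_argmax w.
have := hu _ dw; have := hw _ du; set y := ystar u; set z := ystar w.
rewrite (frobBC z y) => h1 h2.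
have h : frob (y - z) ^+ 2 <= mxdot (K^T *m (u - w)) (y - z).
  rewrite mxdot_mulmxl trmxK mulmxBr !mxdotE; lra.
have {}h := le_trans h (mxdot_le _ _).
have [->|yz_neq0] := eqVneq (frob (y - z)) 0.
  by rewrite mulr_ge0 ?frob_ge0 ?specnorm_ge0.
apply: le_trans (frob_trmx_specnorm K (u - w)).
by move: h; rewrite expr2 ler_pM2r // lt_def yz_neq0 frob_ge0.
Qed.

Lemma y0star_continuous : continuous ystar.
Proof. exact: frob_lipschitz_continuous y0star_lipschitz. Qed.

Lemma phi0E u : phi0 K psi u =
  (mxdot u (K *m ystar u) - fine (psi (ystar u)))%:E.
Proof.
have [du hu] := y0star_argmax u.
have innerK y : inner (K^T *m u) y = mxdot u (K *m y).
  by rewrite innerE mxdot_mulmxl trmxK.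
apply/eqP; rewrite eq_le; apply/andP; split.
  apply: ge_ereal_sup => _ [y _ <-]; rewrite innerK.
  have [dy|->] := proper_edomP y psi_proper; last by rewrite leNye.
  rewrite (edom_fine psi_proper dy) -EFinB lee_fin; apply: le_trans (hu _ dy).
  by rewrite lerDl mulr_ge0 ?sqr_ge0.
apply: ereal_sup_ubound; exists (ystar u) => //.
by rewrite innerK (edom_fine psi_proper du) EFinB.
Qed.

Lemma phi_subgradient u w : phi u + mxdot (K *m ystar u) (w - u) <= phi w.
Proof.
rewrite /phi !phi0E /=; have [du _] := y0star_argmax u.
have [_ /(_ _ du)] := y0star_argmax w.
have := sqr_ge0 (frob (ystar u - ystar w)).
rewrite !mxdotBr (mxdotC _ w) (mxdotC _ u); lra.
Qed.

(** Danskin: the maximizer is the gradient, because the two subgradient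
inequalities sandwich the remainder by the Lipschitz bound on [y0star]. *)
Lemma phi_diff u : differentiable phi u /\
  forall h, 'd phi u h = mxdot (K *m ystar u) h.
Proof.
apply: (@quadratic_diff _ _ _ _ _ (specnorm K ^+ 2)) => w.
have h1 := phi_subgradient u w; have h2 := phi_subgradient w u.
have h3 : mxdot (K *m (ystar w - ystar u)) (w - u) <=
    specnorm K ^+ 2 * frob (w - u) ^+ 2.
  apply: le_trans (mxdot_le _ _) _; rewrite expr2 [_ ^+ 2]expr2.
  rewrite mulrA ler_wpM2r ?frob_ge0 //.
  apply: le_trans (frob_mulmx_specnorm _ _) _.
  by rewrite -mulrA ler_wpM2l ?specnorm_ge0 // y0star_lipschitz.
rewrite ger0_norm; last by lra.
move: h2 h3; rewrite mulmxBr !mxdotE; lra.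
Qed.

Section Chain.
Variables (p : nat) (G : 'cV[R]_p -> 'cV[R]_q).
Hypothesis G_diff : forall x, differentiable G x.

Lemma phi_comp_diff x : differentiable (fun x => phi (G x)) x.
Proof. by apply: differentiable_comp => //; have [] := phi_diff (G x). Qed.

Lemma grad_phi_comp x :
  grad (fun x => phi (G x)) x = (jac G x)^T *m (K *m ystar (G x)).
Proof.
apply/matrixP => j k; rewrite !mxE ord1.
have [dphi dphiE] := phi_diff (G x).
have := @diff_comp _ _ _ _ G phi x (G_diff x) dphi.
rewrite /comp => -> /=; rewrite dphiE /mxdot; apply: eq_bigr => i _.
by rewrite big_ord_recl big_ord0 addr0 !mxE mulrC.
Qed.

End Chain.
End Dual.

(** * Mean-value and descent inequalities *)

Section Line.
Variable R : realType.

Lemma is_derive_line p (V : normedModType R) (f : 'cV[R]_p -> V)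
    (y u : 'cV[R]_p) (t : R) :
  differentiable f (y + t *: u) ->
  is_derive t (1 : R) (fun t => f (y + t *: u)) ('d f (y + t *: u) u).
Proof.
move=> df; set z := y + t *: u.
pose phi t := f (y + t *: u).
have quotE : (fun h => h^-1 *: ((phi \o shift t) (h *: 1) - phi t)) =
             (fun h => h^-1 *: ((f \o shift z) (h *: u) - f z)).
  apply/funext => h /=; rewrite /phi /= /z; congr (_ *: (f _ - _)).
  by rewrite scalerDl addrCA [h *: 1]mulr1.
have h1 : derivable phi t 1.
  by rewrite /derivable quotE; exact: (@diff_derivable _ _ _ f z u df).
apply: DeriveDef => //.
by rewrite -(deriveE u df) /derive quotE.
Qed.

Lemma diff_jac p q (f : 'cV[R]_p -> 'cV[R]_q) (x u : 'cV[R]_p) :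
  'd f x u = jac f x *m u.
Proof.
rewrite {1}(matrix_sum_delta u) exchange_big /= big_ord_recl big_ord0 addr0.
rewrite linear_sum /=; apply/matrixP => i j; rewrite (ord1 j) mxE summxE.
by apply: eq_bigr => k _; rewrite linearZ /= !mxE mulrC.
Qed.

Lemma diff_grad p (f : 'cV[R]_p -> R) (x u : 'cV[R]_p) :
  'd f x u = mxdot (grad f x) u.
Proof.
rewrite {1}(matrix_sum_delta u) exchange_big /= big_ord_recl big_ord0 addr0.
rewrite linear_sum /= /mxdot; apply: eq_bigr => k _.
by rewrite linearZ /= big_ord_recl big_ord0 addr0 !mxE mulrC.
Qed.

Lemma diff_mxdot q (a x : 'cV[R]_q) :
  differentiable (mxdot a) x /\ forall h, 'd (mxdot a) x h = mxdot a h.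
Proof.
apply: (@quadratic_diff R q (mxdot a) x a 0) => u.
by rewrite -mxdotBr subrr normr0 mul0r.
Qed.

(** The scalar function to which the mean value theorem applies when the map
is vector-valued. *)
Lemma is_derive_mxdot_line p q (f : 'cV[R]_p -> 'cV[R]_q)
    (a : 'cV[R]_q) (y u : 'cV[R]_p) (t : R) :
  (forall x, differentiable f x) ->
  is_derive t (1 : R) (fun t => mxdot a (f (y + t *: u)))
    (mxdot a (jac f (y + t *: u) *m u)).
Proof.
move=> df; set z := y + t *: u.
have [da daE] := diff_mxdot a (f z).
have dc : differentiable (mxdot a \o f) z by exact: differentiable_comp.
have := is_derive_line dc.
rewrite (diff_comp (df z) da) /=.
by rewrite daE diff_jac.
Qed.

Lemma MVT01 (f df : R -> R) : (forall t : R, is_derive t (1 : R) f (df t)) ->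
  exists2 t, 0 < t < 1 & f 1 - f 0 = df t.
Proof.
move=> fdf; have [|t] := @MVT R f df 0 1 ltr01 (fun t _ => fdf t).
  apply: continuous_subspaceT => t; apply: differentiable_continuous.
  by apply/derivable1_diffP; have [] := fdf t.
by rewrite in_itv /= subr0 mulr1 => t01 ->; exists t.
Qed.

(** Test against the increment [f x - f y] itself and divide by its norm. *)
Lemma jac_bounded_lipschitz p q (f : 'cV[R]_p -> 'cV[R]_q) (M : R)
    (x y : 'cV[R]_p) :
  (forall x, differentiable f x) ->
  (forall t, 0 <= t <= 1 -> frob (jac f (y + t *: (x - y))) <= M) ->
  frob (f x - f y) <= M * frob (x - y).
Proof.
move=> df fM; set u := x - y; set a := f x - f y.
have [t /andP[t0 t1]] := MVT01 (fun t => is_derive_mxdot_line a y u t df).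
rewrite scale1r scale0r addr0 -mxdotBr.
have -> : y + u = x by rewrite addrC subrK.
rewrite -/a -frobE => aE.
have : frob a ^+ 2 <= frob a * (M * frob u).
  rewrite aE; apply: le_trans (mxdot_le _ _) _.
  rewrite ler_wpM2l ?frob_ge0 //; apply: le_trans (frobM _ _) _.
  by rewrite ler_wpM2r ?frob_ge0 // fM // !ltW.
have [->|a_neq0] := eqVneq (frob a) 0; last first.
  by rewrite expr2 ler_pM2l // lt_def a_neq0 frob_ge0.
move=> _; rewrite mulr_ge0 ?frob_ge0 //.
by apply: le_trans (fM 0 _); rewrite ?frob_ge0 // lexx ler01.
Qed.

(** The mean value theorem for [f] along the segment minus the parabola
[t * b + L / 2 * t ^+ 2 * c], which avoids integrating the gradient. *)
Lemma descent p (f : 'cV[R]_p -> R) (L : R) (x y : 'cV[R]_p) :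
  (forall x, differentiable f x) ->
  (forall t, 0 <= t <= 1 ->
    frob (grad f (x + t *: (y - x)) - grad f x) <= L * (t * frob (y - x))) ->
  f y <= f x + mxdot (grad f x) (y - x) + L / 2 * frob (y - x) ^+ 2.
Proof.
move=> df fL; set u := y - x.
have xu : x + u = y by rewrite addrC subrK.
have [A AE] : exists A : R -> R,
    forall t, A t = mxdot (grad f (x + t *: u)) u.
  by exists (fun t => mxdot (grad f (x + t *: u)) u).
have [b bE] : exists b : R, b = mxdot (grad f x) u by exists (mxdot (grad f x) u).
have [c cE] : exists c : R, c = frob u ^+ 2 by exists (frob u ^+ 2).
pose P := (b \*: id + (L / 2 * c) \*: (id ^+ 2)) : R -> R.
have PE t : P t = t * b + L / 2 * t ^+ 2 * c.
  by rewrite /P !fctE /= /GRing.scale /=; ring.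
pose g t := f (x + t *: u) - P t.
have gdg (t : R) : is_derive t (1 : R) g (A t - (b + L * t * c)).
  have := @is_derive_line _ _ f x u t (df _); rewrite diff_grad -AE => h.
  have hp : is_derive t (1 : R) P (b + L * t * c).
    apply: is_derive_eq (is_deriveD (is_deriveZ b (is_derive_id t 1))
      (is_deriveZ (L / 2 * c) (is_deriveX 2 (is_derive_id t 1)))) _.
    by rewrite /GRing.scale /=; field.
  exact: (@is_deriveB _ _ _ _ _ _ _ _ _ h hp).
have [t /andP[t0 t1]] := MVT01 gdg.
have Ab : A t - b <= L * t * c.
  rewrite AE bE cE -mxdotBl.
  apply: le_trans (mxdot_le _ _) _; rewrite expr2 !mulrA.
  by rewrite ler_wpM2r ?frob_ge0 // -mulrA fL // !ltW.
rewrite /g !PE scale1r scale0r addr0 xu -bE -cE => h.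
lra.
Qed.

End Line.

(** * One step of the inexact proximal gradient method *)

(** The proximal inequality provides [3 / 2] units of [theta L D^2] beyond what
the descent inequality consumes.  Young's inequality spends [1 / 5] of a unit on
the inner product and [3 / 10] on the gradient mapping, so one unit is left to
pay for the variance that the move causes in the next estimators. *)
Lemma one_step_arith (R : realType)
    (L theta D E g a c Pp P0 Rp R0 Rh : R) :
  0 < L -> 0 < theta <= 1 -> 0 <= D -> 0 <= E -> 0 <= g ->
  Pp <= P0 + theta * a + L / 2 * (theta ^+ 2 * D ^+ 2) ->
  Rp <= (1 - theta) * R0 + theta * Rh ->
  Rh + L * (3 + theta) / 2 * D ^+ 2 + c <= R0 ->
  g <= L * (3 + theta) / 2 * D + E ->
  a - c <= E * D ->
  Pp + Rp + theta / (16 * L) * g ^+ 2 + theta * L * D ^+ 2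
  <= P0 + R0 + 13 / 8 * (theta / L) * E ^+ 2.
Proof.
move=> L_gt0 theta01 D0 E0 G0 h1 h2 h3 h4 h5.
have [theta_gt0 theta_le1] := andP theta01.
have h6 : g <= 2 * L * D + E.
  apply: le_trans h4 _; rewrite lerD2r ler_wpM2r //.
  by rewrite (mulrC 2 L) -mulrA ler_wpM2l ?(ltW L_gt0) //; lra.
have h7 : g ^+ 2 <= 6 / 5 * (4 * L ^+ 2 * D ^+ 2) + 6 * E ^+ 2.
  apply: (@le_trans _ _ ((2 * L * D + E) ^+ 2)).
    by rewrite ler_sqr ?nnegrE // addr_ge0 // !mulr_ge0 // ltW.
  have := sqr_ge0 (2 * L * D - 5 * E).
  have -> : (2 * L * D - 5 * E) ^+ 2 = 5 * (6 / 5 * (4 * L ^+ 2 * D ^+ 2)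
      + 6 * E ^+ 2 - (2 * L * D + E) ^+ 2) by field.
  by rewrite pmulr_rge0 // subr_ge0.
have h8 : E * D <= 5 / 4 / L * E ^+ 2 + L / 5 * D ^+ 2.
  have := sqr_ge0 (5 * E - 2 * L * D).
  have -> : (5 * E - 2 * L * D) ^+ 2 =
      20 * L * (5 / 4 / L * E ^+ 2 + L / 5 * D ^+ 2 - E * D).
    by field; rewrite gt_eqF.
  by rewrite pmulr_rge0 ?mulr_gt0 // subr_ge0.
have h9 : theta / (16 * L) * g ^+ 2 <=
    3 / 10 * (theta * L * D ^+ 2) + 3 / 8 * (theta / L * E ^+ 2).
  have -> : 3 / 10 * (theta * L * D ^+ 2) + 3 / 8 * (theta / L * E ^+ 2) =
      theta / (16 * L) * (6 / 5 * (4 * L ^+ 2 * D ^+ 2) + 6 * E ^+ 2).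
    by field; rewrite gt_eqF.
  by rewrite ler_wpM2l // divr_ge0 ?(ltW theta_gt0) // mulr_ge0 // ltW.
have h10 : theta * (a - c) <= theta * (5 / 4 / L * E ^+ 2 + L / 5 * D ^+ 2).
  by rewrite ler_wpM2l ?(ltW theta_gt0) // (le_trans h5).
have h11 : theta * (Rh + L * (3 + theta) / 2 * D ^+ 2 + c) <= theta * R0.
  by rewrite ler_wpM2l ?(ltW theta_gt0).
have -> : 13 / 8 * (theta / L) * E ^+ 2 =
  theta * (5 / 4 / L * E ^+ 2) + 3 / 8 * (theta / L * E ^+ 2).
  by field; rewrite gt_eqF.
have {}h10 : theta * a <= theta * c + theta * (5 / 4 / L * E ^+ 2)
    + 1 / 5 * (theta * L * D ^+ 2).
  have -> : 1 / 5 * (theta * L * D ^+ 2) = theta * (L / 5 * D ^+ 2) by field.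
  by move: h10; rewrite mulrBr mulrDr => h10; lra.
have {}h11 : theta * Rh + theta * c + 3 / 2 * (theta * L * D ^+ 2)
    + L / 2 * (theta ^+ 2 * D ^+ 2) <= theta * R0.
  apply: le_trans h11; rewrite le_eqVlt; apply/orP; left; apply/eqP.
  by field.
have {}h2 : Rp <= R0 - theta * R0 + theta * Rh.
  by move: h2; rewrite mulrBl mul1r.
move: h1 h2 h9 h10 h11.
set X := theta / (16 * L) * g ^+ 2; set Y := theta * (5 / 4 / L * E ^+ 2).
set Z := theta / L * E ^+ 2; set V := theta * L * D ^+ 2.
set U := L / 2 * _; set A := theta * a; set C := theta * c.
set S := theta * R0; set Q := theta * Rh.
move: X Y Z V U A C S Q => X Y Z V U A C S Q; lra.
Qed.

Section OneStep.
Variables (R : realType) (p q n : nat) (K : 'M[R]_(q, n)).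
Variables (psi : 'cV[R]_n -> \bar R) (Rg : 'cV[R]_p -> \bar R).
Variable G : 'cV[R]_p -> 'cV[R]_q.
Variables L_F M_F M_psi : R.
Hypothesis psi_proper : proper_efun psi.
Hypothesis psi_lsc : lower_semicontinuous psi.
Hypothesis psi_sconvex : strongly_convex 1 psi.
Hypothesis psi_bounded : forall y, edom psi y -> frob y <= M_psi.
Hypothesis Rg_proper : proper_efun Rg.
Hypothesis Rg_lsc : lower_semicontinuous Rg.
Hypothesis Rg_convex : convex_efun Rg.
Hypothesis G_diff : forall x, differentiable G x.
Hypothesis (L_F_ge0 : 0 <= L_F) (M_F_ge0 : 0 <= M_F).
Hypothesis G_jac_bounded : forall x, edom Rg x -> frob (jac G x) <= M_F.
Hypothesis G_jac_lipschitz : forall x y, edom Rg x -> edom Rg y ->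
  frob (jac G x - jac G y) <= L_F * frob (x - y).

Let nK := specnorm K.
Let ystar := y0star K psi.
Let Phi x := fine (phi0 K psi (G x)).
Let L := constLPhi nK L_F M_F M_psi.

Let nK_ge0 : 0 <= nK. Proof. exact: specnorm_ge0. Qed.

Lemma ystar_bounded u : frob (ystar u) <= M_psi.
Proof.
apply: psi_bounded.
by have [] := y0star_argmax K psi_proper psi_lsc psi_sconvex u.
Qed.

Lemma edom_convex x y t : 0 <= t <= 1 -> edom Rg x -> edom Rg y ->
  edom Rg ((1 - t) *: x + t *: y) /\
  fine (Rg ((1 - t) *: x + t *: y)) <=
    (1 - t) * fine (Rg x) + t * fine (Rg y).
Proof.
move=> t01 dx dy; have s01 : 0 <= 1 - t <= 1 by lra.
have := Rg_convex x y s01; rewrite subKr.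
rewrite (edom_fine Rg_proper dx) (edom_fine Rg_proper dy) -!EFinM -EFinD => h.
have dz : edom Rg ((1 - t) *: x + t *: y) by exact: le_lt_trans h (ltry _).
by split=> //; move: h; rewrite (edom_fine Rg_proper dz) lee_fin.
Qed.

Lemma edom_segment x y t : 0 <= t <= 1 -> edom Rg x -> edom Rg y ->
  edom Rg (x + t *: (y - x)).
Proof.
move=> t01 dx dy; have -> : x + t *: (y - x) = (1 - t) *: x + t *: y.
  by apply/matrixP => i j; rewrite !mxE; ring.
by have [] := edom_convex t01 dx dy.
Qed.

Lemma G_lipschitz x y : edom Rg x -> edom Rg y ->
  frob (G x - G y) <= M_F * frob (x - y).
Proof.
move=> dx dy; apply: jac_bounded_lipschitz => // t t01.
by apply: G_jac_bounded; apply: edom_segment.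
Qed.

Lemma frob_trKM (J : 'M[R]_(q, p)) (y : 'cV[R]_n) :
  frob (J^T *m (K *m y)) <= frob J * (nK * frob y).
Proof.
apply: le_trans (frobM _ _) _; rewrite frob_tr ler_wpM2l ?frob_ge0 //.
exact: frob_mulmx_specnorm.
Qed.

Lemma grad_PhiE x : grad Phi x = (jac G x)^T *m (K *m ystar (G x)).
Proof. exact: grad_phi_comp. Qed.

(** Exchange first [G x] for its estimator inside the Lipschitz map [ystar],
then the Jacobian for its estimator in front of the bounded [ystar u]. *)
Lemma grad_estimator_error x (u : 'cV[R]_q) (J : 'M[R]_(q, p)) : edom Rg x ->
  frob (grad Phi x - J^T *m (K *m ystar u)) <=
    M_F * nK ^+ 2 * frob (G x - u) + nK * M_psi * frob (jac G x - J).
Proof.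
move=> dx; rewrite grad_PhiE.
have -> : (jac G x)^T *m (K *m ystar (G x)) - J^T *m (K *m ystar u) =
    (jac G x)^T *m (K *m (ystar (G x) - ystar u)) +
    (jac G x - J)^T *m (K *m ystar u).
  rewrite !mulmxBr linearB /= mulmxBl; apply/matrixP => i j.
  by rewrite !mxE; ring.
apply: le_trans (frobD _ _) (lerD _ _); apply: le_trans (frob_trKM _ _) _.
  apply: (@le_trans _ _ (M_F * (nK * (nK * frob (G x - u))))).
    apply: ler_pM; rewrite ?frob_ge0 ?mulr_ge0 ?frob_ge0 ?G_jac_bounded //.
    by rewrite ler_wpM2l // y0star_lipschitz.
  by rewrite expr2 !mulrA.
rewrite mulrC ler_wpM2r ?frob_ge0 // ler_wpM2l //.
exact: ystar_bounded.
Qed.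

Lemma grad_Phi_lipschitz x y : edom Rg x -> edom Rg y ->
  frob (grad Phi y - grad Phi x) <= L * frob (y - x).
Proof.
move=> dx dy; rewrite [grad Phi x]grad_PhiE.
apply: le_trans (grad_estimator_error _ _ dy) _.
have h1 : M_F * nK ^+ 2 * frob (G y - G x) <=
    M_F * nK ^+ 2 * (M_F * frob (y - x)).
  by rewrite ler_wpM2l ?mulr_ge0 ?sqr_ge0 // G_lipschitz.
have M_psi_ge0 : 0 <= M_psi.
  exact: le_trans (frob_ge0 _) (ystar_bounded 0).
have h2 : nK * M_psi * frob (jac G y - jac G x) <=
    nK * M_psi * (L_F * frob (y - x)).
  by rewrite ler_wpM2l ?mulr_ge0 ?frob_ge0 // G_jac_lipschitz.
apply: le_trans (lerD h1 h2) _; rewrite /L /constLPhi le_eqVlt; apply/orP; left.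
by apply/eqP; ring.
Qed.

Lemma Phi_descent x y : edom Rg x -> edom Rg y ->
  Phi y <= Phi x + mxdot (grad Phi x) (y - x) + L / 2 * frob (y - x) ^+ 2.
Proof.
move=> dx dy; apply: descent => [z|t t01]; first exact: phi_comp_diff.
apply: le_trans (grad_Phi_lipschitz dx (edom_segment t01 dx dy)) _.
rewrite addrC addKr frobZ ger0_norm //; by case/andP: t01.
Qed.

Section Step.
Variables (theta eta : R) (x v xhat xplus : 'cV[R]_p).
Hypothesis L_gt0 : 0 < L.
Hypothesis theta01 : 0 < theta <= 1.
Hypothesis etaE : eta = 2 / (L * (3 + theta)).
Hypothesis dx : edom Rg x.
Hypothesis xhatE : xhat = prox (fun z => (eta%:E * Rg z)%E) (x - eta *: v).
Hypothesis xplusE : xplus = (1 - theta) *: x + theta *: xhat.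

Let Gmap := eta^-1 *: (x - prox (fun z => (eta%:E * Rg z)%E)
                               (x - eta *: grad Phi x)).

Let theta_gt0 : 0 < theta. Proof. by case/andP: theta01. Qed.

Let theta_01 : 0 <= theta <= 1.
Proof. by rewrite (ltW theta_gt0); case/andP: theta01. Qed.

Let eta_gt0 : 0 < eta.
Proof. by rewrite etaE divr_gt0 // mulr_gt0 // addr_gt0. Qed.

Lemma xhat_dom : edom Rg xhat.
Proof. by rewrite xhatE; exact: prox_scaled_dom. Qed.

Lemma xplus_dom : edom Rg xplus.
Proof. by rewrite xplusE; have [] := edom_convex theta_01 dx xhat_dom. Qed.

(** Nonexpansiveness compares the gradient mapping with the actual move. *)
Lemma grad_map_le : frob Gmap <= eta^-1 * frob (xhat - x) + frob (grad Phi x - v).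
Proof.
rewrite frobZ ger0_norm ?invr_ge0 ?(ltW eta_gt0) //.
rewrite -[X in _ <= _ + X](mulKf (lt0r_neq0 eta_gt0)) -mulrDr.
rewrite ler_wpM2l ?invr_ge0 ?(ltW eta_gt0) //.
have := prox_scaled_nonexpansive eta_gt0 Rg_proper Rg_lsc Rg_convex
  (x - eta *: v) (x - eta *: grad Phi x).
rewrite -xhatE; move: (prox _ (x - eta *: grad Phi x)) => w hw.
have -> : x - w = (x - xhat) + (xhat - w) by rewrite addrA subrK.
apply: le_trans (frobD _ _) _; rewrite (frobBC x xhat) lerD2l.
apply: le_trans hw _.
by rewrite opprB addrC addrA subrK -scalerBr frobZ ger0_norm ?(ltW eta_gt0).
Qed.

Lemma one_step :
  Phi xplus + fine (Rg xplus) + theta / (16 * L) * frob Gmap ^+ 2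
    + theta * L * frob (xhat - x) ^+ 2
  <= Phi x + fine (Rg x) + 13 / 8 * (theta / L) * frob (grad Phi x - v) ^+ 2.
Proof.
have h1 := Phi_descent dx xplus_dom.
have dE : xplus - x = theta *: (xhat - x).
  by rewrite xplusE; apply/matrixP => i j; rewrite !mxE; ring.
rewrite dE mxdotZr frobZ ger0_norm ?(ltW theta_gt0) // exprMn in h1.
have [_ h2] := edom_convex theta_01 dx xhat_dom.
rewrite -xplusE in h2.
have h3 := prox_step_le eta_gt0 Rg_proper Rg_lsc Rg_convex v dx.
rewrite -xhatE in h3.
have h4 := grad_map_le.
have h5 : mxdot (grad Phi x - v) (xhat - x) <=
    frob (grad Phi x - v) * frob (xhat - x) by exact: mxdot_le.
rewrite mxdotBl in h5.
have etaV : eta^-1 = L * (3 + theta) / 2.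
  by rewrite etaE; field; rewrite !gt_eqF // addr_gt0.
rewrite etaV in h3 h4.
have D0 := frob_ge0 (xhat - x); have E0 := frob_ge0 (grad Phi x - v).
have G0 := frob_ge0 Gmap.
exact: one_step_arith L_gt0 theta01 D0 E0 G0 h1 h2 h3 h4 h5.
Qed.

End Step.
End OneStep.

(** * Measurability of random matrices *)

Section MeasurableMatrices.
Context {R : realType}.

(** Matrices carry no sigma-algebra here: a random matrix is measurable when
its entries are. *)
Definition mxmeasurable d (S : measurableType d) m n (X : S -> 'M[R]_(m, n)) :=
  forall i j, measurable_fun setT (fun s => X s i j).

Section Operations.
Context d (S : measurableType d).

Lemma mxmeasurable_cst m n (A : 'M[R]_(m, n)) : mxmeasurable (fun _ : S => A).
Proof. by move=> i j; exact: measurable_cst. Qed.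

Lemma mxmeasurableD m n (X Y : S -> 'M[R]_(m, n)) :
  mxmeasurable X -> mxmeasurable Y -> mxmeasurable (fun s => X s + Y s).
Proof.
move=> mX mY i j; under eq_fun do rewrite mxE.
by apply: measurable_funD.
Qed.

Lemma mxmeasurableZ m n (a : R) (X : S -> 'M[R]_(m, n)) :
  mxmeasurable X -> mxmeasurable (fun s => a *: X s).
Proof.
move=> mX i j; under eq_fun do rewrite mxE.
by apply: measurable_funM => //; exact: measurable_cst.
Qed.

Lemma mxmeasurableB m n (X Y : S -> 'M[R]_(m, n)) :
  mxmeasurable X -> mxmeasurable Y -> mxmeasurable (fun s => X s - Y s).
Proof.
move=> mX mY i j; under eq_fun do rewrite !mxE.
by apply: measurable_funB.
Qed.

Lemma mxmeasurable_sum m n (I : Type) (r : seq I)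
    (X : I -> S -> 'M[R]_(m, n)) :
  (forall k, mxmeasurable (X k)) -> mxmeasurable (fun s => \sum_(k <- r) X k s).
Proof.
move=> mX i j; under eq_fun do rewrite summxE.
by apply: measurable_sum => k; exact: mX.
Qed.

Lemma mxmeasurable_mulmx m n k (X : S -> 'M[R]_(m, n)) (Y : S -> 'M[R]_(n, k)) :
  mxmeasurable X -> mxmeasurable Y -> mxmeasurable (fun s => X s *m Y s).
Proof.
move=> mX mY i j; under eq_fun do rewrite mxE.
by apply: measurable_sum => l; apply: measurable_funM.
Qed.

Lemma mxmeasurable_tr m n (X : S -> 'M[R]_(m, n)) :
  mxmeasurable X -> mxmeasurable (fun s => (X s)^T).
Proof. by move=> mX i j; under eq_fun do rewrite mxE; exact: mX. Qed.

Lemma measurable_sqfrob m n (X : S -> 'M[R]_(m, n)) :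
  mxmeasurable X -> measurable_fun setT (fun s => frob (X s) ^+ 2).
Proof.
move=> mX; under eq_fun do rewrite frobE.
apply: measurable_sum => i; apply: measurable_sum => j.
by apply: measurable_funM.
Qed.

Lemma mxmeasurable_comp d' (S' : measurableType d') m n (f : S' -> S)
    (X : S -> 'M[R]_(m, n)) :
  measurable_fun setT f -> mxmeasurable X -> mxmeasurable (X \o f).
Proof.
by move=> mf mX i j; apply: (measurableT_comp (f := fun s => X s i j)).
Qed.

End Operations.

Section Caratheodory.
Context d (S : measurableType d) (m n : nat).

(** Rounding the entries of [X] down to the grid of mesh [1 / (k + 1)] gives a
random matrix with countably many values. *)
Let cell (k : nat) (X : 'M[R]_(m, n)) : 'M[int]_(m, n) :=
  \matrix_(i, j) Num.floor (k.+1%:R * X i j).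
Let corner (k : nat) (Z : 'M[int]_(m, n)) : 'M[R]_(m, n) :=
  \matrix_(i, j) ((Z i j)%:~R / k.+1%:R).

Let corner_cell (X : 'M[R]_(m, n)) : corner k (cell k X) @[k --> \oo] --> X.
Proof.
apply/cvgrPdist_lt => e e_gt0.
have : \forall k \near \oo, `|0 - @harmonic R k| < e.
  by move/cvgrPdist_lt: (@cvg_harmonic R) => /(_ _ e_gt0).
apply: filterS => k; rewrite sub0r normrN /= ger0_norm // => ke.
apply: le_lt_trans ke.
rewrite [leLHS]/Num.norm /= mx_normrE; apply/bigmax_leP; split=> //= ij _.
rewrite !mxE; set x := X _ _.
have k0 : 0 < k.+1%:R :> R by [].
have -> : x - (Num.floor (k.+1%:R * x))%:~R / k.+1%:R =
    (k.+1%:R * x - (Num.floor (k.+1%:R * x))%:~R) / k.+1%:R.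
  by field; rewrite gt_eqF.
rewrite normrM [X in _ * X]ger0_norm ?invr_ge0 ?ler0n //.
rewrite ler_piMl ?invr_ge0 ?ler0n // ger0_norm.
  by rewrite lerBlDr addrC ltW // -[1]/(1%:~R) -intrD; exact: lt_succ_floor.
by rewrite subr_ge0; exact: floor_le.
Qed.

Let cell_measurable (X : S -> 'M[R]_(m, n)) k Z : mxmeasurable X ->
  measurable [set s | cell k (X s) = Z].
Proof.
move=> mX.
have -> : [set s | cell k (X s) = Z] =
    \bigcap_(ij in [set: 'I_m * 'I_n])
      [set s | (Num.floor (k.+1%:R * X s ij.1 ij.2)) = Z ij.1 ij.2].
  apply/seteqP; split=> s /=; first by move=> <- ij _ /=; rewrite mxE.
  by move=> sZ; apply/matrixP => i j; rewrite mxE; exact: (sZ (i, j)).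
apply: fin_bigcap_measurable => // ij _.
have mf : measurable_fun setT (fun s => k.+1%:R * X s ij.1 ij.2).
  by apply: measurable_funM => //; exact: measurable_cst.
set z := Z _ _.
have -> : [set s | Num.floor (k.+1%:R * X s ij.1 ij.2) = z] =
    (fun s => k.+1%:R * X s ij.1 ij.2) @^-1` `[z%:~R, (z + 1)%:~R[.
  apply/seteqP; split=> s /=; rewrite in_itv /=.
    by move=> <-; rewrite floor_le lt_succ_floor.
  by move=> /andP[h1 h2]; apply/floor_def; rewrite h1 h2.
by rewrite -[X in measurable X]setTI; apply: mf => //; exact: measurable_itv.
Qed.

(** [Phi (X s) s] is the limit of the values of [Phi] at the corners of the cells
of [X s], and these take countably many values. *)
Lemma caratheodory_measurable (Phi : 'M[R]_(m, n) -> S -> R)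
    (X : S -> 'M[R]_(m, n)) :
  (forall s, continuous (Phi ^~ s)) ->
  (forall x, measurable_fun setT (Phi x)) ->
  mxmeasurable X -> measurable_fun setT (fun s => Phi (X s) s).
Proof.
move=> Phic mPhi mX.
apply: (@measurable_fun_cvg _ _ _ _ (fun k s => Phi (corner k (cell k (X s))) s)).
  move=> k _ Y mY; rewrite setTI.
  have -> : (fun s => Phi (corner k (cell k (X s))) s) @^-1` Y =
      \bigcup_(Z in [set: 'M[int]_(m, n)])
        ([set s | cell k (X s) = Z] `&` (Phi (corner k Z) @^-1` Y)).
    apply/seteqP; split=> s /=; first by exists (cell k (X s)).
    by move=> [Z _ [<-]].
  apply: countable_bigcupT_measurable => [|Z]; first exact: countableP.
  apply: measurableI; first exact: cell_measurable.
  by rewrite -[X in measurable X]setTI; exact: mPhi.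
move=> s _; exact: (cvg_comp _ _ (@corner_cell (X s)) (Phic s (X s))).
Qed.

Lemma mxmeasurable_caratheodory k l (Phi : 'M[R]_(m, n) -> S -> 'M[R]_(k, l))
    (X : S -> 'M[R]_(m, n)) :
  (forall s, continuous (Phi ^~ s)) -> (forall x, mxmeasurable (Phi x)) ->
  mxmeasurable X -> mxmeasurable (fun s => Phi (X s) s).
Proof.
move=> Phic mPhi mX i j.
apply: (@caratheodory_measurable (fun x s => Phi x s i j)) => // [s x|x].
  exact: (cvg_comp _ _ (Phic s x) (@coord_continuous R k l i j (Phi x s))).
exact: mPhi.
Qed.

Lemma mxmeasurable_continuous k l (f : 'M[R]_(m, n) -> 'M[R]_(k, l))
    (X : S -> 'M[R]_(m, n)) :
  continuous f -> mxmeasurable X -> mxmeasurable (fun s => f (X s)).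
Proof.
move=> fc; apply: (mxmeasurable_caratheodory (Phi := fun x _ => f x)) => //.
by move=> x; exact: mxmeasurable_cst.
Qed.

End Caratheodory.

(** Jacobians are limits of difference quotients. *)
Lemma mxmeasurable_jac d (S : measurableType d) p q
    (f : 'cV[R]_p -> S -> 'cV[R]_q) (X : S -> 'cV[R]_p) :
  (forall s x, differentiable (f ^~ s) x) -> (forall x, mxmeasurable (f x)) ->
  mxmeasurable X -> mxmeasurable (fun s => jac (f ^~ s) (X s)).
Proof.
move=> df mf mX i j.
have mfX (Y : S -> 'cV[R]_p) : mxmeasurable Y -> mxmeasurable (fun s => f (Y s) s).
  move=> mY; apply: mxmeasurable_caratheodory => // s x.
  exact: differentiable_continuous.
pose e : 'cV[R]_p := delta_mx j 0.
apply: (@measurable_fun_cvg _ _ _ _ (fun k s =>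
  ((harmonic k)^-1 *: (f (harmonic k *: e + X s) s - f (X s) s)) i 0)).
  move=> k; apply: mxmeasurableZ; apply: mxmeasurableB; apply: mfX => //.
  by apply: mxmeasurableD => //; exact: mxmeasurable_cst.
move=> s _; rewrite mxE.
have h := @diff_derivable _ _ _ (f ^~ s) (X s) e (df s (X s)).
rewrite -(deriveE e (df s (X s))).
have cvg0 : @harmonic R k @[k --> \oo] --> 0^'.
  move=> U /cvg_harmonic hU.
  have : \forall k \near \oo, harmonic k != 0 :> R -> U (harmonic k) := hU.
  rewrite /fmap /=; apply: filterS => k; apply.
  by rewrite /harmonic /= invr_eq0 pnatr_eq0.
exact: (cvg_comp _ _ (cvg_comp _ _ cvg0 h)
  (@coord_continuous R q 1 i 0 ('D_e (f ^~ s) (X s)))).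
Qed.

End MeasurableMatrices.

(** * First and second moments of random matrices *)

Section Moments.
Context d (Xi : measurableType d) (R : realType) (Q : probability Xi R).
Local Notation "'Emx' X" := (expect_mx Q X) (at level 10).

Lemma measurable_sqfrobE m n (X : Xi -> 'M[R]_(m, n)) :
  mxmeasurable X -> measurable_fun setT (fun s => (frob (X s) ^+ 2)%:E).
Proof. by move=> mX; apply/measurable_EFinP; exact: measurable_sqfrob. Qed.

Lemma integrable_mx_measurable m n (X : Xi -> 'M[R]_(m, n)) :
  integrable_mx Q X -> mxmeasurable X.
Proof. by move=> iX i j; apply/measurable_EFinP; exact: measurable_int (iX i j). Qed.

Lemma integrable_mx_cst m n (A : 'M[R]_(m, n)) : integrable_mx Q (fun _ => A).
Proof.
by move=> i j; apply: finite_measure_integrable_cst.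
Qed.

Lemma integrable_mxZ m n (a : R) (X : Xi -> 'M[R]_(m, n)) :
  integrable_mx Q X -> integrable_mx Q (fun s => a *: X s).
Proof.
move=> iX i j; under eq_fun do rewrite mxE EFinM.
by apply: integrableZl => //; exact: iX.
Qed.

Lemma integrable_mxB m n (X Y : Xi -> 'M[R]_(m, n)) :
  integrable_mx Q X -> integrable_mx Q Y ->
  integrable_mx Q (fun s => X s - Y s).
Proof.
move=> iX iY i j; under eq_fun do rewrite !mxE EFinB.
by apply: integrableB.
Qed.

Lemma expect_mxE m n (X : Xi -> 'M[R]_(m, n)) i j : integrable_mx Q X ->
  (\int[Q]_s (X s i j)%:E = (expect_mx Q X i j)%:E)%E.
Proof.
move=> iX; rewrite mxE unlock fineK //.
by apply: integrable_fin_num => //; exact: iX.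
Qed.

Lemma expect_mx_cst m n (A : 'M[R]_(m, n)) : Emx (fun _ => A) = A.
Proof. by apply/matrixP => i j; rewrite mxE expectation_cst. Qed.

Lemma expect_mxZ m n (a : R) (X : Xi -> 'M[R]_(m, n)) :
  integrable_mx Q X -> Emx (fun s => a *: X s) = a *: Emx X.
Proof.
move=> iX; apply/matrixP => i j; apply: EFin_inj.
rewrite -expect_mxE; last exact: integrable_mxZ.
under eq_integral do rewrite mxE EFinM.
rewrite integralZl //.
by rewrite expect_mxE // [in RHS]mxE EFinM.
Qed.

Lemma expect_mxB m n (X Y : Xi -> 'M[R]_(m, n)) :
  integrable_mx Q X -> integrable_mx Q Y ->
  Emx (fun s => X s - Y s) = Emx X - Emx Y.
Proof.
move=> iX iY; apply/matrixP => i j; apply: EFin_inj.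
rewrite -expect_mxE; last exact: integrable_mxB.
under eq_integral do rewrite !mxE EFinB.
rewrite integralB //.
by rewrite !expect_mxE // [in RHS]mxE EFinD [X in (_ = _ + X%:E)%E]mxE EFinN.
Qed.

Lemma integral_mxdot m n (A : 'M[R]_(m, n)) (X : Xi -> 'M[R]_(m, n)) :
  integrable_mx Q X -> Q.-integrable setT (fun s => (mxdot A (X s))%:E) /\
  (\int[Q]_s (mxdot A (X s))%:E = (mxdot A (Emx X))%:E)%E.
Proof.
move=> iX.
have iAX i j : Q.-integrable setT (fun s => (A i j * X s i j)%:E).
  by under eq_fun do rewrite EFinM; apply: integrableZl => //; exact: iX.
have iAXi i : Q.-integrable setT (fun s => (\sum_j (A i j * X s i j)%:E)%E).
  by apply: integrable_sum => // j _; exact: iAX.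
have dotE s : ((mxdot A (X s))%:E = \sum_i \sum_j (A i j * X s i j)%:E)%E.
  by rewrite /mxdot -sumEFin; apply: eq_bigr => i _; rewrite sumEFin.
split; first by under eq_fun do rewrite dotE; apply: integrable_sum.
under eq_integral do rewrite dotE.
rewrite integral_sum // /mxdot -sumEFin; apply: eq_bigr => i _.
rewrite integral_sum // -sumEFin; apply: eq_bigr => j _.
under eq_integral do rewrite EFinM.
by rewrite integralZl // expect_mxE // EFinM.
Qed.

(** The cross term integrates to zero. *)
Lemma sqfrob_shift m n (A : 'M[R]_(m, n)) (X : Xi -> 'M[R]_(m, n)) :
  integrable_mx Q X -> Emx X = 0 ->
  (\int[Q]_s (frob (X s) ^+ 2)%:E < +oo)%E ->
  (\int[Q]_s (frob (A + X s) ^+ 2)%:E =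
   (frob A ^+ 2)%:E + \int[Q]_s (frob (X s) ^+ 2)%:E)%E.
Proof.
move=> iX X0 X2; have mX := integrable_mx_measurable iX.
have iX2 : Q.-integrable setT (fun s => (frob (X s) ^+ 2)%:E).
  apply/integrableP; split; first exact: measurable_sqfrobE.
  by under eq_integral do rewrite gee0_abs ?lee_fin ?sqr_ge0 //.
have [iAX AX0] := integral_mxdot (2 *: A) iX.
have sqE s : ((frob (A + X s) ^+ 2)%:E = (frob A ^+ 2)%:E +
    ((mxdot (2 *: A) (X s))%:E + (frob (X s) ^+ 2)%:E))%E.
  by rewrite -!EFinD; congr EFin; rewrite !frobE !mxdotE (mxdotC (X s)); ring.
under eq_integral do rewrite sqE.
rewrite integralD //; last 2 first.
- exact: finite_measure_integrable_cst.
- exact: integrableD.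
rewrite integralD // AX0 X0 mxdot0r add0e integral_cst //=.
by rewrite probability_setT mule1.
Qed.

(** The bias-variance decomposition. *)
Lemma sqfrob_variance m n (X : Xi -> 'M[R]_(m, n)) : integrable_mx Q X ->
  (\int[Q]_s (frob (X s) ^+ 2)%:E < +oo)%E ->
  (\int[Q]_s (frob (X s) ^+ 2)%:E =
   (frob (Emx X) ^+ 2)%:E + \int[Q]_s (frob (X s - Emx X) ^+ 2)%:E)%E.
Proof.
move=> iX X2; have mX := integrable_mx_measurable iX.
have iC : integrable_mx Q (fun s => X s - Emx X).
  by apply: integrable_mxB => //; exact: integrable_mx_cst.
have mC := integrable_mx_measurable iC.
have C2 : (\int[Q]_s (frob (X s - Emx X) ^+ 2)%:E < +oo)%E.
  apply: (@le_lt_trans _ _ (\int[Q]_s (2%:E * (frob (X s) ^+ 2)%:E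
      + (2 * frob (Emx X) ^+ 2)%:E))%E).
    apply: ge0_le_integral => //.
    - by move=> s _; rewrite lee_fin sqr_ge0.
    - exact: measurable_sqfrobE.
    - apply: emeasurable_funD; last exact: measurable_cst.
      by apply: measurable_funeM; exact: measurable_sqfrobE.
    - move=> s _; rewrite -EFinM -EFinD lee_fin.
      have := sqr_ge0 (frob (X s + Emx X)).
      rewrite !frobE !mxdotE (mxdotC (expect_mx Q X)); lra.
  have m2 := measurable_sqfrobE mX.
  have p1 s : [set: Xi] s -> (0 <= (frob (X s) ^+ 2)%:E)%E.
    by move=> _; rewrite lee_fin sqr_ge0.
  have p2 s : [set: Xi] s -> (0 <= 2%:E * (frob (X s) ^+ 2)%:E)%E.
    by move=> _; rewrite -EFinM lee_fin mulr_ge0 ?sqr_ge0.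
  have p3 s : [set: Xi] s -> (0 <= (2 * frob (Emx X) ^+ 2)%:E)%E.
    by move=> _; rewrite lee_fin mulr_ge0 ?sqr_ge0.
  have m3 : measurable_fun setT (fun s => 2%:E * (frob (X s) ^+ 2)%:E)%E.
    exact: measurable_funeM.
  rewrite ge0_integralD // ge0_integralZl //.
  rewrite integral_cst //= probability_setT mule1.
  by rewrite lte_add_pinfty ?ltry // lte_mul_pinfty ?lee_fin // ltey.
have := @sqfrob_shift _ _ (Emx X) _ iC _ C2.
rewrite expect_mxB //; last exact: integrable_mx_cst.
rewrite expect_mx_cst subrr => /(_ erefl) <-.
by apply: eq_integral => s _; rewrite addrC subrK.
Qed.

Lemma sqfrob_centered_le m n (X : Xi -> 'M[R]_(m, n)) : integrable_mx Q X ->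
  (\int[Q]_s (frob (X s - Emx X) ^+ 2)%:E <= \int[Q]_s (frob (X s) ^+ 2)%:E)%E.
Proof.
move=> iX; have [->|X2] := eqVneq (\int[Q]_s (frob (X s) ^+ 2)%:E)%E +oo%E.
  by rewrite leey.
by rewrite [leRHS]sqfrob_variance ?ltey // leeDr // lee_fin sqr_ge0.
Qed.

(** Jensen's inequality for the square, read off from the bias-variance
decomposition. *)
Lemma frob_expect_le m n (X : Xi -> 'M[R]_(m, n)) (a : R) : 0 <= a ->
  integrable_mx Q X -> (\int[Q]_s (frob (X s) ^+ 2)%:E <= (a ^+ 2)%:E)%E ->
  frob (Emx X) <= a.
Proof.
move=> a0 iX Xa; rewrite -ler_sqr ?nnegrE ?frob_ge0 // -lee_fin.
apply: (le_trans _ Xa); rewrite sqfrob_variance //; last first.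
  exact: le_lt_trans Xa (ltry _).
rewrite leeDl //; apply: integral_ge0 => s _; by rewrite lee_fin sqr_ge0.
Qed.

End Moments.

(** * Independence of the draws from the past *)

Section Independence.
Context d (W : measurableType d) (R : realType) (P : probability W R).

Lemma independent_eventsC (G H : set (set W)) :
  independent_events P G H -> independent_events P H G.
Proof. by move=> GH A B HA GB; rewrite setIC GH // muleC. Qed.

Lemma independent_events_sub (G G' H H' : set (set W)) :
  G `<=` G' -> H `<=` H' ->
  independent_events P G' H' -> independent_events P G H.
Proof. by move=> GG HH GH A B /GG ? /HH ?; exact: GH. Qed.

(** The finite measures [A |-> P (A `&` B)] and [A |-> P A * P B] agree on the
pi-system, hence on the sigma-algebra that it generates. *)
Lemma independent_pi_system (G : set (set W)) (B : set W) :
  G `<=` measurable -> setI_closed G -> G setT -> measurable B ->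
  (forall A, G A -> P (A `&` B) = (P A * P B)%E) ->
  forall A, <<s G >> A -> P (A `&` B) = (P A * P B)%E.
Proof.
move=> Gm GI GT mB GB A sA.
have PB0 : 0 <= fine (P B) by rewrite fine_ge0.
pose c : {nonneg R} := NngNum PB0.
have PBE : P B = (fine (P B))%:E by rewrite fineK // fin_num_measure.
have := @g_sigma_algebra_measure_unique _ R _ G Gm (fun _ => setT) (fun _ => GT).
move=> /(_ _ (mrestr P mB) (mscale c P) GI) uniq.
have {uniq} /= := uniq _ _ _ A sA; rewrite /mrestr /mscale /= => ->.
- by rewrite -PBE muleC.
- by apply/seteqP; split=> // x _; exists 0%N.
- by move=> C GC; rewrite /mrestr /mscale /= GB // -PBE muleC.
- move=> _; rewrite /mrestr setTI.
  by rewrite ltey_eq fin_num_measure.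
Qed.

Section Families.
Context d' (Xi : measurableType d').
Implicit Types S : set (W -> Xi).

Definition draw_events S : set (set W) :=
  [set A | exists2 X, S X & exists2 C, measurable C & A = X @^-1` C].

(** [W] with the sigma-algebra of the events decided by the draws in [S]. *)
Definition past S := g_sigma_algebraType (draw_events S).
HB.instance Definition _ S := Measurable.on (past S).

Lemma sigma_of_sub S S' : S `<=` S' -> sigma_of S `<=` sigma_of S'.
Proof.
move=> SS; apply: smallest_sub; first exact: smallest_sigma_algebra.
by move=> A [X /SS SX AX]; apply: sub_sigma_algebra; exists X.
Qed.

Lemma draw_events_measurable S : (forall X, S X -> measurable_fun setT X) ->
  draw_events S `<=` measurable.
Proof.
move=> mS A [X SX [C mC ->]]; rewrite -[X in measurable X]setTI.
by apply: (mS X SX).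
Qed.

Lemma sigma_of_measurable S : (forall X, S X -> measurable_fun setT X) ->
  sigma_of S `<=` measurable.
Proof.
move=> mS; apply: smallest_sub; first exact: sigma_algebra_measurable.
exact: draw_events_measurable.
Qed.

Lemma past_draw_measurable S X : S X ->
  measurable_fun setT (X : past S -> Xi).
Proof.
move=> SX _ C mC; rewrite setTI; apply: sub_sigma_algebra.
by exists X => //; exists C.
Qed.

Lemma past_sub_measurable S S' : S `<=` S' ->
  measurable_fun setT (id : past S' -> past S).
Proof. by move=> SS _ A mA; rewrite setTI; exact: sigma_of_sub mA. Qed.

Lemma past_id_measurable S : (forall X, S X -> measurable_fun setT X) ->
  measurable_fun setT (id : W -> past S).
Proof. by move=> mS _ A mA; rewrite setTI; exact: sigma_of_measurable mA. Qed.

(** The intersections of an event decided by [S1] with one decided by [S2] form a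
pi-system that generates the joint sigma-algebra.  This is what allows a batch
to be absorbed into the past once it has been integrated out. *)
Lemma independent_join S1 S2 S3 :
  (forall X, (S1 `|` S2 `|` S3) X -> measurable_fun setT X) ->
  independent_events P (sigma_of S1) (sigma_of (S2 `|` S3)) ->
  independent_events P (sigma_of S2) (sigma_of S3) ->
  independent_events P (sigma_of (S1 `|` S2)) (sigma_of S3).
Proof.
move=> mS i1 i2 A C sA sC.
have m1 : sigma_of S1 `<=` measurable.
  by apply: sigma_of_measurable => X SX; apply: mS; left; left.
have m2 : sigma_of S2 `<=` measurable.
  by apply: sigma_of_measurable => X SX; apply: mS; left; right.
have m3 : sigma_of S3 `<=` measurable.
  by apply: sigma_of_measurable => X SX; apply: mS; right.
pose G := [set D | exists2 D1, sigma_of S1 D1 &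
                   exists2 D2, sigma_of S2 D2 & D = D1 `&` D2].
have sT S : sigma_of S setT.
  exact: (@measurableT _ (past S)).
have sI S A1 A2 : sigma_of S A1 -> sigma_of S A2 -> sigma_of S (A1 `&` A2).
  exact: (@measurableI _ (past S)).
apply: (@independent_pi_system G) => //.
- by move=> _ [D1 /m1 ? [D2 /m2 ? ->]]; exact: measurableI.
- move=> _ _ [D1 s1 [D2 s2 ->]] [E1 t1 [E2 t2 ->]].
  by exists (D1 `&` E1); [exact: sI|exists (D2 `&` E2);
    [exact: sI|rewrite setIACA]].
- by exists setT; [exact: sT|exists setT; [exact: sT|rewrite setIT]].
- exact: m3.
- move=> _ [D1 s1 [D2 s2 ->]].
  have sC23 : sigma_of (S2 `|` S3) C by apply: sigma_of_sub sC => X; right.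
  have s23 : sigma_of (S2 `|` S3) D2 by apply: sigma_of_sub s2 => X; left.
  rewrite -setIA i1 //; last exact: sI.
  by rewrite (i2 _ _ s2 sC) muleA (i1 _ _ s1 s23).
- move: A sA; apply: smallest_sub; first exact: smallest_sigma_algebra.
  move=> A [X [SX|SX] [D mD AE]]; apply: sub_sigma_algebra.
    exists A; last by exists setT; [exact: sT | rewrite setIT].
    by apply: sub_sigma_algebra; exists X => //; exists D.
  exists setT; first exact: sT.
  exists A; last by rewrite setTI.
  by apply: sub_sigma_algebra; exists X => //; exists D.
Qed.

Section Freezing.
Context d2 (Xi2 : measurableType d2).
Variables (Q : probability Xi2 R) (S : set (W -> Xi)) (Y : W -> Xi2).
Hypothesis mS : forall X, S X -> measurable_fun setT X.
Hypothesis mY : measurable_fun setT Y.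
Hypothesis lawY : forall C, measurable C -> P (Y @^-1` C) = Q C.
Hypothesis indY : independent_events P (sigma_of S) (sigma_of [set Y]).

(** Freezing: by independence the joint law of the past and the draw is a product
measure, so Tonelli's theorem integrates the draw out first. *)
Lemma freezing (g : past S * Xi2 -> \bar R) :
  measurable_fun setT g -> (forall z, (0 <= g z)%E) ->
  (\int[P]_w g ((w : past S), Y w) = \int[P]_w \int[Q]_y g ((w : past S), y))%E.
Proof.
move=> mg g0.
have mid := past_id_measurable mS.
pose idS : {mfun W >-> past S} :=
  HB.pack (id : W -> past S) (isMeasurableFun.Build _ _ _ _ _ mid).
have mJ : measurable_fun setT (fun w : W => ((w : past S), Y w)).
  exact: measurable_fun_pair.
pose PS := distribution P idS.
have prodE A : measurable A -> (PS \x Q)%E A =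
    pushforward P (fun w : W => ((w : past S), Y w)) A.
  apply: (@product_measure_unique _ _ _ _ _ PS Q
    (pushforward P (fun w : W => ((w : past S), Y w)))) => B C mB mC.
  transitivity (P (B `&` Y @^-1` C)); first by [].
  rewrite indY //; first by rewrite lawY.
  by apply: sub_sigma_algebra; exists Y => //; exists C.
transitivity (\int[pushforward P (fun w : W => ((w : past S), Y w))]_z g z)%E.
  by rewrite ge0_integral_pushforward.
transitivity (\int[(PS \x Q)%E]_z g z)%E.
  by apply: eq_measure_integral => A mA _; exact/esym/prodE.
rewrite fubini_tonelli1 //.
have := @measurable_fun_fubini_tonelli_F _ _ _ _ _ Q g mg g0 => mF.
rewrite /fubini_F.
rewrite /PS /distribution ge0_integral_pushforward //.
by move=> w _; apply: integral_ge0.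
Qed.

End Freezing.
End Families.
End Independence.

(** * Variance of mini-batches *)

Section Batches.
Context d (W : measurableType d) (R : realType) (P : probability W R).
Context d' (Xi : measurableType d') (Q : probability Xi R).

(** The rectangles over the other draws form a pi-system. *)
Lemma iid_others b (Y : 'I_b -> W -> Xi) (k : 'I_b) : iid_copies P Q Y ->
  independent_events P (sigma_of [set X | exists2 i, i != k & X = Y i])
    (sigma_of [set Y k]).
Proof.
move=> [mY lawY indY].
have mYi i C : measurable C -> measurable (Y i @^-1` C).
  by move=> mC; rewrite -[X in measurable X]setTI; exact: (mY i).
pose rect (C : 'I_b -> set Xi) := \bigcap_(i in [set: 'I_b]) (Y i @^-1` C i).
have mrect C : (forall i, measurable (C i)) -> measurable (rect C).
  by move=> mC; apply: fin_bigcap_measurable => // i _; exact: mYi.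
pose G := [set A | exists C : 'I_b -> set Xi,
  [/\ forall i, measurable (C i), C k = setT & A = rect C]].
have mG : G `<=` measurable by move=> A [C [mC _ ->]]; exact: mrect.
have GI : setI_closed G.
  move=> A B [C [mC CT ->]] [D [mD DT ->]].
  exists (fun i => C i `&` D i); split => [i||]; first exact: measurableI.
    by rewrite CT DT setIT.
  by rewrite /rect; apply/seteqP; split=> [w [h1 h2] i _|w h];
    [split; [exact: h1|exact: h2]|split=> i _; have [] := h i].
have GT : G setT.
  exists (fun _ => setT); split => //.
  by apply/seteqP; split.
have GE A C : G A -> measurable C -> P (A `&` Y k @^-1` C) =
    (P A * P (Y k @^-1` C))%E.
  move=> [D [mD DT ->]] mC.
  pose D' i := if i == k then C else D i.
  have mD' i : measurable (D' i) by rewrite /D'; case: ifP.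
  have -> : rect D `&` Y k @^-1` C = rect D'.
    apply/seteqP; split=> [w [h1 h2] i _|w h]; rewrite /D' /=.
      by case: eqVneq => [->//|_]; exact: h1.
    split=> [i _|]; last by have := h k I; rewrite /D' /= eqxx.
    by have := h i I; rewrite /D' /=; case: eqVneq => // ->; rewrite DT.
  rewrite /rect !indY // (bigD1 k) //= [in RHS](bigD1 k) //= DT.
  rewrite preimage_setT probability_setT mul1e /D' eqxx muleC; congr (_ * _)%E.
  by apply: eq_bigr => i /negbTE ->.
have sGG : sigma_of [set X | exists2 i, i != k & X = Y i] `<=` <<s G >>.
  apply: smallest_sub; first exact: smallest_sigma_algebra.
  move=> A [X [i ik ->] [C mC ->]]; apply: sub_sigma_algebra.
  exists (fun j => if j == i then C else setT); split => [j||].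
  - by case: ifP.
  - by rewrite eq_sym (negbTE ik).
  - apply/seteqP; split=> [w h j _ /=|w h]; first by case: eqP => // ->.
    by have := h i I; rewrite /= eqxx.
have mk X : [set Y k] X -> measurable_fun setT X by move=> ->.
move=> A B /sGG sA sB.
have mA : measurable A by apply: (smallest_sub (sigma_algebra_measurable _) mG).
have EI : setI_closed (draw_events [set Y k]).
  move=> _ _ [_ -> [C mC ->]] [_ -> [D mD ->]].
  by exists (Y k) => //; exists (C `&` D); [exact: measurableI|].
rewrite setIC muleC.
apply: (@independent_pi_system _ _ _ P (draw_events [set Y k])) => //.
- exact: draw_events_measurable.
- by exists (Y k) => //; exists setT; rewrite ?preimage_setT.
move=> C [_ -> [D mD ->]]; rewrite setIC muleC.
apply: (@independent_pi_system _ _ _ P G) => //; first exact: mYi.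
by move=> E GE'; exact: GE.
Qed.

Section Draw.
Variables (S : set (W -> Xi)) (m n : nat).
Hypothesis mS : forall X, S X -> measurable_fun setT X.

Lemma past_sqfrob_measurable (u : past S -> 'M[R]_(m, n)) : mxmeasurable u ->
  measurable_fun setT (fun w : W => (frob (u w) ^+ 2)%:E).
Proof.
move=> mu; apply: (measurableT_comp (measurable_sqfrobE mu)).
exact: past_id_measurable.
Qed.

Definition second_moment (c : past S -> Xi -> 'M[R]_(m, n)) :=
  (\int[P]_w \int[Q]_y (frob (c w y) ^+ 2)%:E)%E.

(** Because the draw [y] is independent of the past, the conditions on [c w] at
fixed [w] are conditions on the conditional law given the past. *)
Record noise (c : past S -> Xi -> 'M[R]_(m, n)) : Prop := Noise {
  noise_measurable : mxmeasurable (fun z : past S * Xi => c z.1 z.2);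
  noise_integrable : forall w, integrable_mx Q (c w);
  noise_centered : forall w, expect_mx Q (c w) = 0;
  noise_square : forall w, (\int[Q]_y (frob (c w y) ^+ 2)%:E < +oo)%E
}.

Lemma noise_inner_measurable (c : past S -> Xi -> 'M[R]_(m, n)) : noise c ->
  measurable_fun setT (fun w : W => \int[Q]_y (frob (c w y) ^+ 2)%:E)%E.
Proof.
move=> [mc _ _ _].
have mF := @measurable_fun_fubini_tonelli_F _ _ _ _ _ Q
  (fun z : past S * Xi => (frob (c z.1 z.2) ^+ 2)%:E) (measurable_sqfrobE mc).
apply: measurableT_comp (mF _) (past_id_measurable mS) => z.
by rewrite lee_fin sqr_ge0.
Qed.

(** A fresh centered draw is orthogonal to the past: freeze the past and expand
the square around the deterministic shift [u w]. *)
Lemma pythagoras_draw (Y : W -> Xi) (u : past S -> 'M[R]_(m, n))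
    (c : past S -> Xi -> 'M[R]_(m, n)) :
  measurable_fun setT Y -> (forall C, measurable C -> P (Y @^-1` C) = Q C) ->
  independent_events P (sigma_of S) (sigma_of [set Y]) ->
  mxmeasurable u -> noise c ->
  (\int[P]_w (frob (u w + c w (Y w)) ^+ 2)%:E =
   \int[P]_w (frob (u w) ^+ 2)%:E + second_moment c)%E.
Proof.
move=> mY lawY indY mu cn; have [mc ic c0 c2] := cn.
have := @freezing _ _ _ P _ _ _ _ Q S Y mS mY lawY indY
  (fun z => (frob (u z.1 + c z.1 z.2) ^+ 2)%:E).
move=> /= -> //; last 2 first.
- apply: measurable_sqfrobE; apply: mxmeasurableD => //.
  by apply: mxmeasurable_comp mu.
- by move=> z; rewrite lee_fin sqr_ge0.
under eq_integral do rewrite sqfrob_shift //.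
rewrite ge0_integralD //.
- by move=> w _; rewrite lee_fin sqr_ge0.
- exact: past_sqfrob_measurable.
- by move=> w _; apply: integral_ge0 => y _; rewrite lee_fin sqr_ge0.
- exact: noise_inner_measurable.
Qed.

End Draw.

Implicit Types S : set (W -> Xi).

Lemma noise_sub S S' m n (c : past S -> Xi -> 'M[R]_(m, n)) : S `<=` S' ->
  noise c -> noise (c : past S' -> Xi -> 'M[R]_(m, n)).
Proof.
move=> SS [mc ic c0 c2]; split => // i j.
apply: (measurableT_comp (mc i j) (g := fun z : past S' * Xi => ((z.1 : past S), z.2))).
apply: measurable_fun_pair; last exact: measurable_snd.
exact: (measurableT_comp (past_sub_measurable SS) measurable_fst).
Qed.

Lemma past_mxmeasurable_sub S S' m n (u : past S -> 'M[R]_(m, n)) : S `<=` S' ->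
  mxmeasurable u -> mxmeasurable (u : past S' -> 'M[R]_(m, n)).
Proof.
move=> SS mu; apply: (mxmeasurable_comp (f := id : past S' -> past S)) mu.
exact: past_sub_measurable.
Qed.

Lemma past_mxmeasurable_draw S S' m n (c : past S -> Xi -> 'M[R]_(m, n)) Y :
  S `<=` S' -> S' Y -> mxmeasurable (fun z : past S * Xi => c z.1 z.2) ->
  mxmeasurable (fun w : past S' => c w (Y w)).
Proof.
move=> SS SY mc i j.
apply: (measurableT_comp (mc i j) (g := fun w : past S' => ((w : past S), Y w))).
apply: measurable_fun_pair; first exact: past_sub_measurable.
exact: past_draw_measurable.
Qed.

(** Add the draws one by one, moving each into the past once used. *)
Lemma pythagoras_batch S b (Y : 'I_b -> W -> Xi) m n
    (u : past S -> 'M[R]_(m, n)) (c : past S -> Xi -> 'M[R]_(m, n)) :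
  (forall X, S X -> measurable_fun setT X) -> iid_copies P Q Y ->
  independent_events P (sigma_of S) (sigma_of (range Y)) ->
  mxmeasurable u -> noise c ->
  (\int[P]_w (frob (u w + \sum_i c w (Y i w)) ^+ 2)%:E =
   \int[P]_w (frob (u w) ^+ 2)%:E + b%:R%:E * second_moment c)%E.
Proof.
move=> mS Yiid indY mu cn; have [mY lawY _] := Yiid.
have M0 : (0 <= second_moment c)%E.
  by apply: integral_ge0 => w _; apply: integral_ge0 => y _; rewrite lee_fin sqr_ge0.
pose U k (w : W) := u w + \sum_(i < b | (i < k)%N) c w (Y i w).
suff H k : (k <= b)%N -> (\int[P]_w (frob (U k w) ^+ 2)%:E =
    \int[P]_w (frob (u w) ^+ 2)%:E + k%:R%:E * second_moment c)%E.
  rewrite -(H b (leqnn b)); apply: eq_integral => w _; rewrite /U.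
  by congr (frob (_ + _) ^+ 2)%:E; apply: eq_bigl => i; rewrite ltn_ord.
elim: k => [_|k IHk kb].
  rewrite mul0e adde0; apply: eq_integral => w _.
  by rewrite /U big_pred0 ?addr0.
pose i0 := Ordinal kb.
pose S2 := [set X | exists2 i : 'I_b, (i < k)%N & X = Y i].
pose S' := S `|` S2.
have mS' X : S' X -> measurable_fun setT X.
  by move=> [/mS //|[i _ ->]]; exact: mY.
have SS' : S `<=` S' by move=> X; left.
have UE w : U k.+1 w = U k w + c w (Y i0 w).
  rewrite /U (bigD1 i0) //= [c w (Y i0 w) + _]addrC addrA; congr (_ + _ + _).
  apply: eq_bigl => i; rewrite ltnS -val_eqE /= [(i <= k)%N]leq_eqVlt.
  by case: (ltngtP i k).
under eq_integral do rewrite UE.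
have := @pythagoras_draw S' m n mS' (Y i0) (U k) c (mY i0) (lawY i0).
move=> -> //.
- rewrite IHk 1?ltnW // -addeA; congr (_ + _)%E.
  rewrite -natr1 EFinD ge0_muleDl ?lee_fin // mul1e; congr (_ + _)%E.
- apply: independent_join.
  + by move=> X [[/mS//|[i _ ->]]|->]; exact: mY.
  + apply: (independent_events_sub _ _ indY) => //; apply: sigma_of_sub.
    by move=> X [[i _ ->]|->]; [exists i|exists i0].
  + apply: (independent_events_sub _ _ (@iid_others _ _ i0 Yiid)) => //;
      apply: sigma_of_sub.
    move=> X [i ik ->]; exists i => //.
    by rewrite -val_eqE /= neq_ltn ik.
- apply: mxmeasurableD; first exact: past_mxmeasurable_sub mu.
  have [mc _ _ _] := cn.
  have -> : (fun w => \sum_(i < b | (i < k)%N) c w (Y i w)) =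
      (fun w => \sum_(i < b) if (i < k)%N then c w (Y i w) else 0).
    by apply/funext => w; exact: big_mkcond.
  apply: mxmeasurable_sum => i.
  case: (boolP (i < k)%N) => ik; last exact: mxmeasurable_cst.
  by apply: past_mxmeasurable_draw => //; right; exists i.
- exact: noise_sub cn.
Qed.

End Batches.

(** * The hybrid variance-reduced estimator *)

Section Hybrid.
Context d (W : measurableType d) (R : realType) (P : probability W R).
Context d' (Xi : measurableType d') (Q : probability Xi R).
Implicit Types S : set (W -> Xi).

Lemma second_moment_ge0 S m n (c : past S -> Xi -> 'M[R]_(m, n)) :
  (0 <= second_moment P Q c)%E.
Proof.
apply: integral_ge0 => w _; apply: integral_ge0 => y _.
by rewrite lee_fin sqr_ge0.
Qed.

Lemma noiseZ S m n (a : R) (c : past S -> Xi -> 'M[R]_(m, n)) :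
  (forall X, S X -> measurable_fun setT X) ->
  noise Q c -> noise Q (fun w y => a *: c w y) /\
  second_moment P Q (fun w y => a *: c w y) =
  ((a ^+ 2)%:E * second_moment P Q c)%E.
Proof.
move=> mS cn; have [mc ic c0 c2] := cn.
have sqZ w : (\int[Q]_y (frob (a *: c w y) ^+ 2)%:E =
    (a ^+ 2)%:E * \int[Q]_y (frob (c w y) ^+ 2)%:E)%E.
  under eq_integral do rewrite frobZ exprMn real_normK ?num_real // EFinM.
  rewrite ge0_integralZl //.
  - exact: measurable_sqfrobE (integrable_mx_measurable (ic w)).
  - by move=> y _; rewrite lee_fin sqr_ge0.
  - by rewrite lee_fin sqr_ge0.
split.
  split => [|w|w|w].
  - exact: mxmeasurableZ mc.
  - exact: integrable_mxZ.
  - by rewrite expect_mxZ // c0 scaler0.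
  - rewrite sqZ lte_mul_pinfty ?lee_fin ?sqr_ge0 //.
rewrite /second_moment; under eq_integral do rewrite sqZ.
rewrite ge0_integralZl //.
- exact: noise_inner_measurable.
- by move=> w _; apply: integral_ge0 => y _; rewrite lee_fin sqr_ge0.
- by rewrite lee_fin sqr_ge0.
Qed.

Section TwoBatches.
Variables (S : set (W -> Xi)) (b1 b2 : nat).
Variables (Y1 : 'I_b1 -> W -> Xi) (Y2 : 'I_b2 -> W -> Xi).
Hypothesis mS : forall X, S X -> measurable_fun setT X.
Hypothesis iid1 : iid_copies P Q Y1.
Hypothesis iid2 : iid_copies P Q Y2.
Hypothesis ind : independent_events P (sigma_of (range Y1 `|` range Y2))
  (sigma_of S).

Variables (kk : R).
Hypothesis kkP : kk = 1 /\
  independent_events P (sigma_of (range Y1)) (sigma_of (range Y2)) \/ kk = 2.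

Let ind1 : independent_events P (sigma_of S) (sigma_of (range Y1)).
Proof.
apply: independent_eventsC; apply: (independent_events_sub _ _ ind) => //.
by apply: sigma_of_sub => X; left.
Qed.

Let ind2 : independent_events P (sigma_of S) (sigma_of (range Y2)).
Proof.
apply: independent_eventsC; apply: (independent_events_sub _ _ ind) => //.
by apply: sigma_of_sub => X; right.
Qed.

Section Noises.
Variables (m n : nat) (e : past S -> 'M[R]_(m, n)).
Variables (c1 c2 : past S -> Xi -> 'M[R]_(m, n)).
Hypothesis me : mxmeasurable e.
Hypothesis n1 : noise Q c1.
Hypothesis n2 : noise Q c2.

Let sum1 (w : W) := \sum_i c1 w (Y1 i w).
Let sum2 (w : W) := \sum_i c2 w (Y2 i w).

Let moments : \bar R := (b1%:R%:E * second_moment P Q c1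
  + b2%:R%:E * second_moment P Q c2)%E.

(** The second batch is fresh even when the first has joined the past. *)
Lemma two_batches_independent :
  independent_events P (sigma_of (range Y1)) (sigma_of (range Y2)) ->
  (\int[P]_w (frob (e w + sum1 w + sum2 w) ^+ 2)%:E =
   \int[P]_w (frob (e w) ^+ 2)%:E + moments)%E.
Proof.
move=> ind12; pose S' := S `|` range Y1.
have SS' : S `<=` S' by move=> X; left.
have mS' X : S' X -> measurable_fun setT X.
  by move=> [/mS //|[i _ <-]]; exact: iid_measurable iid1 i.
have := @pythagoras_batch _ W R P _ Xi Q S' b2 Y2 m n
  (fun w => e w + sum1 w) c2 mS' iid2.
move=> ->.
- by rewrite (pythagoras_batch mS iid1 ind1 me n1) /moments addeA.
- apply: independent_join => //.
  + move=> X [[/mS //|[i _ <-]]|[i _ <-]]; first exact: iid_measurable iid1 i.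
    exact: iid_measurable iid2 i.
  + exact: independent_eventsC.
- apply: mxmeasurableD; first exact: past_mxmeasurable_sub me.
  apply: mxmeasurable_sum => i; have [mc _ _ _] := n1.
  by apply: past_mxmeasurable_draw => //; right; exists i.
- exact: noise_sub n2.
Qed.

(** For dependent batches, [e + A + C] is the midpoint of [e + 2 A] and
[e + 2 C], each of which involves only one of them. *)
Lemma two_batches_dependent :
  (\int[P]_w (frob (e w + sum1 w + sum2 w) ^+ 2)%:E <=
   \int[P]_w (frob (e w) ^+ 2)%:E + 2%:E * moments)%E.
Proof.
have [n1' M1] := noiseZ 2 mS n1; have [n2' M2] := noiseZ 2 mS n2.
have E1 := pythagoras_batch mS iid1 ind1 me n1'.
have E2 := pythagoras_batch mS iid2 ind2 me n2'.
have msum b (Y : 'I_b -> W -> Xi) (c : past S -> Xi -> 'M[R]_(m, n)) :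
    iid_copies P Q Y -> noise Q c ->
    measurable_fun setT (fun w : W =>
      (frob (e w + \sum_i c w (Y i w)) ^+ 2)%:E).
  move=> iidY [mc _ _ _]; pose S' := S `|` range Y.
  have mS' X : S' X -> measurable_fun setT X.
    by move=> [/mS //|[i _ <-]]; exact: iid_measurable iidY i.
  apply: (past_sqfrob_measurable mS' (u := fun w => e w + \sum_i c w (Y i w))).
  apply: mxmeasurableD; first by apply: past_mxmeasurable_sub me => X; left.
  apply: mxmeasurable_sum => i.
  by apply: past_mxmeasurable_draw => // [X|]; [left|right; exists i].
have m1 := msum _ _ _ iid1 n1'; have m2 := msum _ _ _ iid2 n2'.
have m12 : measurable_fun setT (fun w : W =>
    (frob (e w + sum1 w + sum2 w) ^+ 2)%:E).
  pose S' := S `|` range Y1 `|` range Y2.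
  have mS' X : S' X -> measurable_fun setT X.
    move=> [[/mS //|[i _ <-]]|[i _ <-]]; first exact: iid_measurable iid1 i.
    exact: iid_measurable iid2 i.
  have SS' : S `<=` S' by move=> X; left; left.
  apply: (past_sqfrob_measurable mS' (u := fun w => e w + sum1 w + sum2 w)).
  apply: mxmeasurableD; first apply: mxmeasurableD.
  - exact: past_mxmeasurable_sub me.
  - apply: mxmeasurable_sum => i; have [mc _ _ _] := n1.
    by apply: past_mxmeasurable_draw => //; left; right; exists i.
  - apply: mxmeasurable_sum => i; have [mc _ _ _] := n2.
    by apply: past_mxmeasurable_draw => //; right; exists i.
have p1 w : [set: W] w ->
    (0 <= (frob (e w + \sum_i 2 *: c1 w (Y1 i w)) ^+ 2)%:E)%E.
  by move=> _; rewrite lee_fin sqr_ge0.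
have p2 w : [set: W] w ->
    (0 <= (frob (e w + \sum_i 2 *: c2 w (Y2 i w)) ^+ 2)%:E)%E.
  by move=> _; rewrite lee_fin sqr_ge0.
apply: (@le_trans _ _ (\int[P]_w ((2^-1)%R%:E *
    ((frob (e w + \sum_i 2 *: c1 w (Y1 i w)) ^+ 2)%:E +
     (frob (e w + \sum_i 2 *: c2 w (Y2 i w)) ^+ 2)%:E))%E)%E).
  apply: ge0_le_integral => //.
  - by move=> w _; rewrite lee_fin sqr_ge0.
  - by apply: measurable_funeM; exact: emeasurable_funD.
  - move=> w _; rewrite -EFinD -EFinM lee_fin -!scaler_sumr -/(sum1 w) -/(sum2 w).
    have := sqr_ge0 (frob (sum1 w - sum2 w)).
    rewrite !frobE !mxdotE (mxdotC (sum1 w) (e w)) (mxdotC (sum2 w) (e w)).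
    rewrite (mxdotC (sum2 w) (sum1 w)); lra.
rewrite ge0_integralZl //; last 2 first.
- exact: emeasurable_funD.
- by move=> w _; rewrite adde_ge0 // lee_fin sqr_ge0.
rewrite ge0_integralD // E1 E2 M1 M2 /moments.
move: (second_moment_ge0 c1) (second_moment_ge0 c2).
have : (0 <= \int[P]_w (frob (e w) ^+ 2)%:E)%E.
  by apply: integral_ge0 => w _; rewrite lee_fin sqr_ge0.
move: (second_moment P Q c1) (second_moment P Q c2) (\int[P]_w _)%E => u v s.
rewrite !(muleCA _ (2 ^+ 2)%:E) => s0 u0 v0.
have bu b (z : \bar R) : (0 <= z)%E -> (0 <= b%:R%:E * z)%E.
  by move=> z0; rewrite mule_ge0 // lee_fin ler0n.
move: (bu b1 u u0) (bu b2 v v0).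
move: (b1%:R%:E * u)%E (b2%:R%:E * v)%E => {u v u0 v0 bu} u v u0 v0.
have ooD t : (0 <= t -> +oo + t = +oo :> \bar R)%E by case: t.
have Doo t : (0 <= t -> t + +oo = +oo :> \bar R)%E by case: t.
have two_oo : (2%:E * +oo = +oo :> \bar R)%E by rewrite gt0_muley ?lte_fin.
case: s s0 => [s| |] // s0; last first.
  by rewrite [leRHS]ooD ?leey // mule_ge0 // ?adde_ge0 ?lee_fin.
case: u u0 => [u| |] // u0; last by rewrite [(+oo + v)%E]ooD // two_oo leey.
case: v v0 => [v| |] // v0; last by rewrite [(_ + +oo)%E]Doo // two_oo leey.
by rewrite -!EFinM -!EFinD lee_fin; lra.
Qed.

Lemma two_batches :
  (\int[P]_w (frob (e w + sum1 w + sum2 w) ^+ 2)%:E <=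
   \int[P]_w (frob (e w) ^+ 2)%:E + kk%:E * moments)%E.
Proof.
case: kkP => [[-> ind12]|->]; last exact: two_batches_dependent.
by rewrite two_batches_independent // mul1e.
Qed.

End Noises.
End TwoBatches.
End Hybrid.

Section Recursion.
Context d (W : measurableType d) (R : realType) (P : probability W R).
Context d' (Xi : measurableType d') (Q : probability Xi R).
Variables (p m n : nat) (H : 'cV[R]_p -> Xi -> 'M[R]_(m, n)).
Variable D : set 'cV[R]_p.
Variables (lip sigma : R).

Let Hm x := expect_mx Q (H x).

(** Both the sampled map and its Jacobian satisfy these conditions, with different
constants, so one analysis of the hybrid estimator covers the two estimators of
the algorithm. *)
Record mean_square_regular : Prop := MeanSquareRegular {
  msr_measurable : forall dS (S : measurableType dS) (X : S -> 'cV[R]_p)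
    (Y : S -> Xi), mxmeasurable X -> measurable_fun setT Y ->
    mxmeasurable (fun s => H (X s) (Y s));
  msr_mean_measurable : forall dS (S : measurableType dS) (X : S -> 'cV[R]_p),
    mxmeasurable X -> mxmeasurable (fun s => Hm (X s));
  msr_integrable : forall x, integrable_mx Q (H x);
  msr_lipschitz : forall x y, D x -> D y ->
    (\int[Q]_s (frob (H x s - H y s) ^+ 2)%:E
     <= (lip ^+ 2 * frob (x - y) ^+ 2)%:E)%E;
  msr_variance : forall x, D x ->
    (\int[Q]_s (frob (H x s - Hm x) ^+ 2)%:E <= (sigma ^+ 2)%:E)%E
}.

Hypothesis H_regular : mean_square_regular.

Variable S : set (W -> Xi).
Hypothesis mS : forall X, S X -> measurable_fun setT X.

Lemma past_integral_sqfrob (a : R) k l (u : past S -> 'M[R]_(k, l)) : 0 <= a ->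
  mxmeasurable u ->
  (\int[P]_w (a * frob (u w) ^+ 2)%:E = a%:E * \int[P]_w (frob (u w) ^+ 2)%:E)%E.
Proof.
move=> a0 mu; under eq_integral do rewrite EFinM.
rewrite ge0_integralZl //; first exact: past_sqfrob_measurable.
by move=> w _; rewrite lee_fin sqr_ge0.
Qed.

(** Centering the increments can only lower their second moment. *)
Lemma increment_noise (X0 X1 : past S -> 'cV[R]_p) :
  mxmeasurable X0 -> mxmeasurable X1 ->
  (forall w, D (X0 w)) -> (forall w, D (X1 w)) ->
  let c w y := (H (X1 w) y - H (X0 w) y) - (Hm (X1 w) - Hm (X0 w)) in
  noise Q c /\ (second_moment P Q c <=
    (lip ^+ 2)%:E * \int[P]_w (frob (X1 w - X0 w) ^+ 2)%:E)%E.
Proof.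
move=> m0 m1 D0 D1 c; have [mH mHm iH lipH _] := H_regular.
have iD w : integrable_mx Q (fun y => H (X1 w) y - H (X0 w) y).
  exact: integrable_mxB.
have eD w : expect_mx Q (fun y => H (X1 w) y - H (X0 w) y) =
    Hm (X1 w) - Hm (X0 w) by rewrite expect_mxB.
have c2 w : (\int[Q]_y (frob (c w y) ^+ 2)%:E <=
    (lip ^+ 2 * frob (X1 w - X0 w) ^+ 2)%:E)%E.
  apply: le_trans (lipH _ _ (D1 w) (D0 w)); rewrite /c -eD.
  exact: sqfrob_centered_le.
have cn : noise Q c.
  split => [|w|w|w].
  - apply: mxmeasurableB; apply: mxmeasurableB.
    + by apply: mH; [exact: mxmeasurable_comp m1|exact: measurable_snd].
    + by apply: mH; [exact: mxmeasurable_comp m0|exact: measurable_snd].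
    + by apply: mHm; exact: mxmeasurable_comp m1.
    + by apply: mHm; exact: mxmeasurable_comp m0.
  - by apply: integrable_mxB => //; exact: integrable_mx_cst.
  - by rewrite expect_mxB ?expect_mx_cst ?eD ?subrr //; exact: integrable_mx_cst.
  - exact: le_lt_trans (c2 w) (ltry _).
split => //; rewrite -past_integral_sqfrob ?sqr_ge0 //; last first.
  exact: mxmeasurableB.
apply: ge0_le_integral => //.
- by move=> w _; apply: integral_ge0 => y _; rewrite lee_fin sqr_ge0.
- exact: noise_inner_measurable.
- under eq_fun do rewrite EFinM; apply: measurable_funeM.
  by apply: (past_sqfrob_measurable mS); exact: mxmeasurableB.
Qed.

Lemma sample_noise (X1 : past S -> 'cV[R]_p) :
  mxmeasurable X1 -> (forall w, D (X1 w)) ->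
  let c w y := H (X1 w) y - Hm (X1 w) in
  noise Q c /\ (second_moment P Q c <= (sigma ^+ 2)%:E)%E.
Proof.
move=> m1 D1 c; have [mH mHm iH _ varH] := H_regular.
have cn : noise Q c.
  split => [|w|w|w].
  - apply: mxmeasurableB.
    + by apply: mH; [exact: mxmeasurable_comp m1|exact: measurable_snd].
    + by apply: mHm; exact: mxmeasurable_comp m1.
  - by apply: integrable_mxB => //; exact: integrable_mx_cst.
  - by rewrite expect_mxB ?expect_mx_cst ?subrr //; exact: integrable_mx_cst.
  - exact: le_lt_trans (varH _ (D1 w)) (ltry _).
split => //; apply: (@le_trans _ _ (\int[P]_w (sigma ^+ 2)%:E)%E).
  apply: ge0_le_integral => //.
  - by move=> w _; apply: integral_ge0 => y _; rewrite lee_fin sqr_ge0.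
  - exact: noise_inner_measurable.
  - by move=> w _; exact: varH.
by rewrite integral_cst //= probability_setT mule1.
Qed.

Lemma batch_noise_arith (b1 b2 : nat) (kk beta s1 s2 : R) (A1 A2 I : \bar R) :
  (0 < b1)%N -> (0 < b2)%N -> 0 <= kk -> (0 <= A1)%E -> (0 <= A2)%E ->
  (A1 <= (s1 ^+ 2)%:E * I)%E -> (A2 <= (s2 ^+ 2)%:E)%E ->
  (kk%:E * (b1%:R%:E * (((beta / b1%:R) ^+ 2)%:E * A1)
            + b2%:R%:E * ((((1 - beta) / b2%:R) ^+ 2)%:E * A2))
   <= (kk * beta ^+ 2 * s1 ^+ 2 / b1%:R)%:E * I
      + (kk * (1 - beta) ^+ 2 * s2 ^+ 2 / b2%:R)%:E)%E.
Proof.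
move=> b1_gt0 b2_gt0 kk_ge0 A1_ge0 A2_ge0 A1le A2le.
have b1R : b1%:R != 0 :> R by rewrite pnatr_eq0 -lt0n.
have b2R : b2%:R != 0 :> R by rewrite pnatr_eq0 -lt0n.
have -> : kk * beta ^+ 2 * s1 ^+ 2 / b1%:R =
    kk * (b1%:R * (beta / b1%:R) ^+ 2) * s1 ^+ 2 by field.
have -> : kk * (1 - beta) ^+ 2 * s2 ^+ 2 / b2%:R =
    kk * (b2%:R * ((1 - beta) / b2%:R) ^+ 2) * s2 ^+ 2 by field.
have p1 : 0 <= b1%:R * (beta / b1%:R) ^+ 2 by rewrite mulr_ge0 ?sqr_ge0.
have p2 : 0 <= b2%:R * ((1 - beta) / b2%:R) ^+ 2 by rewrite mulr_ge0 ?sqr_ge0.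
rewrite !(muleA b1%:R%:E) !(muleA b2%:R%:E) -!EFinM.
move: (b1%:R * _) p1 (b2%:R * _) p2 (s1 ^+ 2) (s2 ^+ 2) A1le A2le.
move=> x1 p1 x2 p2 r1 r2 A1le A2le.
rewrite ge0_muleDr ?mule_ge0 ?lee_fin //; apply: leeD.
  rewrite !EFinM -!muleA; apply: lee_wpmul2l; rewrite ?lee_fin //.
  by apply: lee_wpmul2l; rewrite ?lee_fin.
rewrite !EFinM -!muleA; apply: lee_wpmul2l; rewrite ?lee_fin //.
by apply: lee_wpmul2l; rewrite ?lee_fin.
Qed.

(** The new error is [beta] times the old one plus two centered noises: the
increments of the first batch, whose second moment the mean-square Lipschitz
condition ties to the last move, and the fluctuations of the second batch. *)
Lemma hybrid_error b1 b2 (Y1 : 'I_b1 -> W -> Xi) (Y2 : 'I_b2 -> W -> Xi)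
    (kk beta : R) (E0 : past S -> 'M[R]_(m, n)) (X0 X1 : past S -> 'cV[R]_p) :
  (0 < b1)%N -> (0 < b2)%N ->
  iid_copies P Q Y1 -> iid_copies P Q Y2 ->
  independent_events P (sigma_of (range Y1 `|` range Y2)) (sigma_of S) ->
  kk = 1 /\ independent_events P (sigma_of (range Y1)) (sigma_of (range Y2))
  \/ kk = 2 ->
  mxmeasurable E0 -> mxmeasurable X0 -> mxmeasurable X1 ->
  (forall w, D (X0 w)) -> (forall w, D (X1 w)) ->
  (\int[P]_w (frob (beta *: E0 w
      + (beta / b1%:R) *: \sum_i (H (X1 w) (Y1 i w) - H (X0 w) (Y1 i w))
      + ((1 - beta) / b2%:R) *: \sum_i H (X1 w) (Y2 i w) - Hm (X1 w)) ^+ 2)%:E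
   <= (beta ^+ 2)%:E * \int[P]_w (frob (E0 w - Hm (X0 w)) ^+ 2)%:E
      + (kk * beta ^+ 2 * lip ^+ 2 / b1%:R)%:E
        * \int[P]_w (frob (X1 w - X0 w) ^+ 2)%:E
      + (kk * (1 - beta) ^+ 2 * sigma ^+ 2 / b2%:R)%:E)%E.
Proof.
move=> b1_gt0 b2_gt0 iid1 iid2 ind kkP mE m0 m1 D0 D1.
have [mH mHm _ _ _] := H_regular.
have [] := increment_noise m0 m1 D0 D1; set c1 := (c in noise Q c) => n1 M1.
have [] := sample_noise m1 D1; set c2 := (c in noise Q c) => n2 M2.
have [n1' M1'] := noiseZ P (beta / b1%:R) mS n1.
have [n2' M2'] := noiseZ P ((1 - beta) / b2%:R) mS n2.
have b1R : b1%:R != 0 :> R by rewrite pnatr_eq0 -lt0n.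
have b2R : b2%:R != 0 :> R by rewrite pnatr_eq0 -lt0n.
have me : mxmeasurable (fun w : past S => beta *: (E0 w - Hm (X0 w))).
  by apply: mxmeasurableZ; apply: mxmeasurableB => //; exact: mHm.
have := two_batches mS iid1 iid2 ind kkP me n1' n2'.
under eq_integral => w _.
  have -> : beta *: (E0 w - Hm (X0 w))
      + \sum_i (beta / b1%:R) *: c1 w (Y1 i w)
      + \sum_i ((1 - beta) / b2%:R) *: c2 w (Y2 i w) =
    beta *: E0 w
      + (beta / b1%:R) *: \sum_i (H (X1 w) (Y1 i w) - H (X0 w) (Y1 i w))
      + ((1 - beta) / b2%:R) *: \sum_i H (X1 w) (Y2 i w) - Hm (X1 w).
    rewrite -!scaler_sumr.
    have -> : \sum_i c1 w (Y1 i w) =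
        \sum_i (H (X1 w) (Y1 i w) - H (X0 w) (Y1 i w))
        - b1%:R *: (Hm (X1 w) - Hm (X0 w)).
      by rewrite sumrB sumr_const card_ord scaler_nat.
    have -> : \sum_i c2 w (Y2 i w) =
        \sum_i H (X1 w) (Y2 i w) - b2%:R *: Hm (X1 w).
      by rewrite sumrB sumr_const card_ord scaler_nat.
    move: (\sum_i _) (\sum_i _) (E0 w) (Hm (X0 w)) (Hm (X1 w)) => U V e h0 h1.
    by apply/matrixP => i j; rewrite !mxE; field; rewrite b1R b2R.
  over.
move=> h; apply: le_trans h _.
have M1_ge0 : (0 <= second_moment P Q c1)%E by exact: second_moment_ge0.
have M2_ge0 : (0 <= second_moment P Q c2)%E by exact: second_moment_ge0.
have kk_ge0 : 0 <= kk by case: kkP => [[-> _]|->].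
rewrite M1' M2' -[leRHS]addeA; apply: leeD.
  have me0 : mxmeasurable (fun w : past S => E0 w - Hm (X0 w)).
    by apply: mxmeasurableB => //; exact: mHm.
  rewrite -(past_integral_sqfrob (sqr_ge0 beta) me0) le_eqVlt; apply/orP; left.
  apply/eqP; apply: eq_integral => w _.
  by rewrite frobZ exprMn real_normK ?num_real.
exact: (batch_noise_arith beta b1_gt0 b2_gt0 kk_ge0 M1_ge0 M2_ge0 M1 M2).
Qed.

End Recursion.

Section Initial.
Context d (W : measurableType d) (R : realType) (P : probability W R).
Context d' (Xi : measurableType d') (Q : probability Xi R).

Lemma independent_events_trivial (S : set (W -> Xi)) :
  (forall X, S X -> measurable_fun setT X) ->
  independent_events P (sigma_of (set0 : set (W -> Xi))) (sigma_of S).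
Proof.
move=> mS A B sA sB.
apply: (@independent_pi_system _ _ _ P [set setT]) => //.
- by move=> _ ->.
- by move=> _ _ -> ->; rewrite setIT.
- exact: sigma_of_measurable sB.
- by move=> _ ->; rewrite setTI probability_setT mul1e.
move: A sA; apply: smallest_sub; first exact: smallest_sigma_algebra.
by move=> A [X []].
Qed.

(** The initial batch is fresh relative to an empty past. *)
Lemma initial_error p m n (H : 'cV[R]_p -> Xi -> 'M[R]_(m, n)) D lip sigma b
    (Y : 'I_b -> W -> Xi) (x0 : 'cV[R]_p) :
  mean_square_regular Q H D lip sigma -> D x0 -> (0 < b)%N ->
  iid_copies P Q Y ->
  (\int[P]_w (frob (b%:R^-1 *: \sum_i H x0 (Y i w) - expect_mx Q (H x0)) ^+ 2)%:E
   <= (sigma ^+ 2 / b%:R)%:E)%E.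
Proof.
move=> Hreg Dx0 b_gt0 iidY.
have mS X : (set0 : set (W -> Xi)) X -> measurable_fun setT X by [].
have [] := sample_noise P Hreg mS (X1 := fun _ => x0)
  (mxmeasurable_cst _) (fun _ => Dx0).
set c := (c in noise Q c) => cn M.
have [cn' M'] := noiseZ P b%:R^-1 mS cn.
have bR : b%:R != 0 :> R by rewrite pnatr_eq0 -lt0n.
have ind := independent_events_trivial (S := range Y).
have := pythagoras_batch mS iidY (ind _)
  (mxmeasurable_cst (0 : 'M[R]_(m, n))) cn'.
rewrite M'; under eq_integral => w _.
  have -> : 0 + \sum_i b%:R^-1 *: c w (Y i w) =
      b%:R^-1 *: \sum_i H x0 (Y i w) - expect_mx Q (H x0).
    rewrite add0r -scaler_sumr /c sumrB sumr_const card_ord.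
    by rewrite scalerBr -scalerMnr scalerMnl -[b%:R^-1 *+ b]mulr_natr mulVf // scale1r.
  over.
move=> ->; last by move=> X [i _ <-]; exact: iid_measurable iidY i.
under eq_integral do rewrite frob0 expr0n /=.
rewrite integral0 add0e muleA -EFinM.
have -> : sigma ^+ 2 / b%:R = b%:R * b%:R^-1 ^+ 2 * sigma ^+ 2 by field.
rewrite [(_ * sigma ^+ 2)%:E]EFinM; apply: lee_wpmul2l => //.
Qed.

End Initial.

(** * Increments of differentiable functions *)

Section Increments.
Context {R : realType}.
Local Notation mu := (@lebesgue_measure R).

(** Continuous induction: the supremum of the points reached from [0]
without losing height is [1]. *)
Lemma locally_increasing_le (Z : R -> R) :
  (forall t, 0 <= t <= 1 -> exists2 e, 0 < e & forall y, 0 <= y <= 1 ->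
    `|y - t| < e -> (t <= y -> Z t <= Z y) /\ (y <= t -> Z y <= Z t)) ->
  Z 0 <= Z 1.
Proof.
move=> Zloc; pose A := [set t | 0 <= t <= 1 /\ Z 0 <= Z t].
have A0 : A 0 by split; rewrite ?lexx ?ler01.
have Aub : ubound A 1 by move=> t [/andP[_ ->]].
have Asup : has_sup A by split; [exists 0 | exists 1].
pose s := sup A.
have s01 : 0 <= s <= 1.
  by rewrite (sup_upper_bound Asup A0) /=; apply: ge_sup => //; exists 0.
have [e e_gt0 He] := Zloc s s01.
have As : Z 0 <= Z s.
  have [t At ts] := sup_adherent e_gt0 Asup.
  have tles : t <= s by exact: (sup_upper_bound Asup).
  have tse : `|t - s| < e.
    by rewrite distrC ger0_norm ?subr_ge0 //; move: ts; rewrite -/s; lra.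
  have [_ /(_ tles)] := He t At.1 tse.
  exact: le_trans At.2.
have [s1|s1] := eqVneq s 1; first by rewrite -s1.
pose y := Num.min 1 (s + e / 2).
have sy : s < y by rewrite lt_min; case/andP: s01 => _ ?; rewrite lt_def eq_sym s1; lra.
have y1 : y <= 1 by rewrite ge_min lexx.
have ye : y <= s + e / 2 by rewrite ge_min lexx orbT.
have y01 : 0 <= y <= 1 by rewrite y1 andbT; case/andP: s01; lra.
have yse : `|y - s| < e by rewrite gtr0_norm ?subr_gt0 //; lra.
have [/(_ (ltW sy)) Zsy _] := He y y01 yse.
have : y <= s by apply: (sup_upper_bound Asup); split => //; apply: le_trans Zsy.
by rewrite leNgt sy.
Qed.

Lemma derivative_expansion (phi : R -> R) (t dphi e : R) : 0 < e ->
  is_derive t (1 : R) phi dphi -> exists2 r, 0 < r & forall y, `|y - t| < r ->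
    `|phi y - phi t - dphi * (y - t)| <= e * `|y - t|.
Proof.
move=> e_gt0 [dphi_ex dphiE]; rewrite -dphiE => {dphi dphiE}.
move/cvgrPdist_lt: dphi_ex => /(_ e e_gt0).
rewrite -/('D_1 phi t) => /nbhs_ballP [r /= r_gt0 hr].
exists r => // y yr.
have [->|yt] := eqVneq y t.
  by rewrite !subrr mulr0 subr0 !normr0 mulr0.
have yt0 : y - t != 0 by rewrite subr_eq0.
have := hr (y - t); rewrite -ball_normE /ball_ /= sub0r normrN => /(_ yr yt0).
rewrite [_ *: 1]mulr1 subrK /GRing.scale /= => h.
have -> : phi y - phi t - 'D_1 phi t * (y - t) =
    - (('D_1 phi t - (y - t)^-1 * (phi y - phi t)) * (y - t)) by field.
by rewrite normrN normrM ler_wpM2r // ltW.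
Qed.

Section Cover.
Variables (h : R -> R) (eps : R).
Hypothesis mh : measurable_fun setT h.
Hypothesis h_ge0 : forall t, 0 <= h t.
Hypothesis eps_gt0 : 0 < eps.

Let E k := `[0, 1]%classic `&` [set t | k.+1%:R * eps <= h t].

Let mE k : measurable (E k).
Proof.
apply: measurableI; first exact: measurable_itv.
have -> : [set t | k.+1%:R * eps <= h t] = h @^-1` `[k.+1%:R * eps, +oo[.
  by apply/seteqP; split=> t /=; rewrite in_itv /= andbT.
by rewrite -[X in measurable X]setTI; apply: mh => //; exact: measurable_itv.
Qed.

Let level_sum : (eps%:E * \sum_(0 <= k <oo) mu (E k) <=
  \int[mu]_(t in `[0%R, 1%R]) (h t)%:E)%E.
Proof.
have m1E k : measurable_fun (`[0, 1]%classic : set R) (fun t : R => (\1_(E k) t)%:E : \bar R).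
  by apply/measurable_EFinP; exact: measurable_indic.
have mS1 : measurable_fun (`[0, 1]%classic : set R)
    (fun t : R => (\sum_(0 <= k <oo) (\1_(E k) t)%:E)%E : \bar R).
  have p k (t : R) : (`[0, 1]%classic : set R) t -> predT k -> (0 <= (\1_(E k) t)%:E :> \bar R)%E.
    by move=> _ _; rewrite lee_fin.
  exact: (ge0_emeasurable_sum p (fun k _ => m1E k)).
have -> : (\sum_(0 <= k <oo) mu (E k) =
    \int[mu]_(t in `[0%R, 1%R]) (\sum_(0 <= k <oo) (\1_(E k) t)%:E))%E.
  rewrite integral_nneseries //.
  apply: eq_eseriesr => k _; rewrite integral_indic //=; last exact: mE.
  by congr (mu _); rewrite setIidl // => t [].
rewrite -ge0_integralZl //; last 2 first.
- by move=> t _; apply: nneseries_ge0 => k _ _; rewrite lee_fin.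
- by rewrite lee_fin ltW.
apply: ge0_le_integral => //.
- move=> t _; apply: mule_ge0; first by rewrite lee_fin ltW.
  by apply: nneseries_ge0 => k _ _; rewrite lee_fin.
- exact: measurable_funeM.
- by apply/measurable_EFinP; exact: measurable_funTS.
move=> t t01; rewrite -lee_pdivlMl //.
apply: lime_le.
  by apply: is_cvg_nneseries => k _ _; rewrite lee_fin.
apply: nearW => N; rewrite sumEFin -EFinM lee_fin.
have count : \sum_(0 <= k < N) \1_(E k) t <= eps^-1 * h t :> R.
  elim: N => [|N IHN]; first by rewrite big_geq // mulr_ge0 // invr_ge0 ltW.
  have [EN|EN] := pselect (E N t); last first.
    by rewrite big_nat_recr //= indicE memNset // addr0.
  apply: (@le_trans _ _ (\sum_(0 <= k < N.+1) 1)).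
    by apply: ler_sum => k _; rewrite indicE lern1 leq_b1.
  rewrite sumr_const_nat subn0 -ler_pdivrMl ?invr_gt0 // invrK mulrC.
  exact: EN.2.
exact: count.
Qed.

(** A measure that dominates [h] locally at every point of [0, 1], with total
mass close to the integral of [h]: open neighbourhoods of the superlevel sets,
summed over the levels. *)
Lemma dominating_measure : (\int[mu]_(t in `[0%R, 1%R]) (h t)%:E < +oo)%E ->
  exists2 nu : {measure set (measurableTypeR R) -> \bar R},
    (nu `[0%R, 1%R]%classic <= \int[mu]_(t in `[0%R, 1%R]) (h t)%:E + eps%:E)%E &
    forall t, 0 <= t <= 1 -> exists2 r, 0 < r & forall a b, a <= b ->
      `|a - t| < r -> `|b - t| < r ->
      (((h t - eps) * (b - a))%:E <= nu `]a, b]%classic)%E.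
Proof.
move=> hoo.
have muE k : (mu (E k) < +oo)%E.
  apply: (@le_lt_trans _ _ (mu `[0%R, 1%R]%classic)).
    apply: le_measure => [||t []//]; rewrite inE; first exact: mE.
    exact: measurable_itv.
  by rewrite lebesgue_measure_itv /= lte01 ltry.
have /choice [U HU] : forall k : nat, exists U : set R,
    [/\ open U, E k `<=` U & (mu (U `\` E k) < (1 / (2 ^ k.+1)%:R)%:E)%E].
  move=> k; apply: lebesgue_regularity_outer; [exact: mE|exact: muE|].
  by rewrite divr_gt0.
have mU k : measurable (U k) by apply: open_measurable; have [] := HU k.
have mUE k : measurable (U k `\` E k) by apply: measurableD; [exact: mU|exact: mE].
pose e : {nonneg R} := NngNum (ltW eps_gt0).
pose nu : {measure set (measurableTypeR R) -> \bar R} :=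
  mscale e (mseries (fun k => mrestr mu (mU k)) 0).
have nuE A : nu A = (eps%:E * \sum_(0 <= k <oo) mu (A `&` U k))%E by [].
exists nu.
  rewrite nuE.
  apply: (@le_trans _ _ (eps%:E * (\sum_(0 <= k <oo) mu (E k) + 1%:E))%E).
    rewrite lee_wpmul2l ?lee_fin ?(ltW eps_gt0) //.
    apply: le_trans (epsilon_trick predT (fun k => measure_ge0 mu (E k)) ler01).
    apply: lee_nneseries => // k _.
    have [_ EU /ltW ltUE] := HU k.
    apply: le_trans (leeD (lexx _) ltUE).
    rewrite -measureU //; last 2 first.
    - exact: mUE.
    - by rewrite setDIK.
    apply: le_measure; rewrite ?inE.
    + by apply: measurableI; [exact: measurable_itv|exact: mU].
    + by apply: measurableU; [exact: mE|exact: mUE].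
    + by move=> t [_ Ut]; have [|] := pselect (E k t); [left|right].
    exact: mE.
  rewrite ge0_muleDr ?nneseries_ge0 // mule1.
  by apply: leeD => //; exact: level_sum.
move=> t t01; pose m := Num.truncn (h t / eps).
have h0 : 0 <= h t / eps by rewrite divr_ge0 // ltW.
have /andP[m_le lt_m] : m%:R <= h t / eps < m.+1%:R by exact: truncn_itv.
rewrite ler_pdivlMr // in m_le; rewrite ltr_pdivrMr // in lt_m.
have [r r_gt0 rU] : exists2 r, 0 < r & forall k, (k < m)%N -> ball t r `<=` U k.
  have Ut k : (k < m)%N -> nbhs t (U k).
    move=> km; have [oU EU _] := HU k; apply: open_nbhs_nbhs; split => //.
    apply: EU; split => /=; first by rewrite in_itv.
    by apply: le_trans m_le; rewrite ler_wpM2r ?(ltW eps_gt0) // ler_nat.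
  elim: {m_le lt_m} m Ut => [|m IHm] Ut; first by exists 1.
  have [k km|r r_gt0 rU] := IHm; first by apply: Ut; rewrite ltnS ltnW.
  have [r' /= r'_gt0 r'U] := (nbhs_ballP _ _).1 (Ut m (ltnSn m)).
  exists (Num.min r r'); first by rewrite lt_min r_gt0.
  move=> k; rewrite ltnS leq_eqVlt => /predU1P[->|km].
    by apply: subset_trans r'U; apply: le_ball; rewrite ge_min lexx orbT.
  by apply: subset_trans (rU k km); apply: le_ball; rewrite ge_min lexx.
exists r => // a b ab ar br.
rewrite nuE.
have ballI : `]a, b]%classic `<=` ball t r.
  move=> y /=; rewrite in_itv /= => /andP[ay yb].
  rewrite -ball_normE /ball_ /= ltr_norml.
  move: ar br; rewrite !ltr_norml => /andP[a1 a2] /andP[b1 b2].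
  by apply/andP; split; lra.
have muI k : (k < m)%N -> mu (`]a, b] `&` U k) = (b - a)%:E.
  move=> km; rewrite setIidl; last exact: subset_trans ballI (rU k km).
  rewrite lebesgue_measure_itv /= lte_fin; case: ltP => // ba.
  by have -> : a = b; [apply/eqP; rewrite eq_le ab ba | rewrite subrr].
have ge0 k : (0 <= mu (`]a, b] `&` U k))%E by exact: measure_ge0.
apply: (@le_trans _ _ (eps%:E * \sum_(0 <= k < m) mu (`]a, b] `&` U k))%E); last first.
  by rewrite lee_wpmul2l ?lee_fin ?(ltW eps_gt0) //; exact: nneseries_lim_ge.
rewrite big_nat (eq_bigr (fun _ => (b - a)%:E)); last first.
  by move=> k /andP[_ km]; exact: muI.
rewrite -big_nat sumEFin -EFinM lee_fin sumr_const_nat subn0 -mulr_natl mulrA.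
rewrite ler_wpM2r ?subr_ge0 // mulrC lerBlDr.
by move: lt_m; rewrite -natr1 mulrDl mul1r => /ltW.
Qed.

End Cover.
(** Replaces the fundamental theorem of calculus, since an everywhere existing
derivative need not be continuous nor integrable: [h] is dominated locally by a
measure, so the accumulated mass minus [phi], corrected by a small linear term,
is locally increasing. *)
Lemma increment_le_integral (phi dphi h : R -> R) :
  (forall t : R, is_derive t (1 : R) phi (dphi t)) ->
  (forall t, 0 <= t <= 1 -> dphi t <= h t) ->
  measurable_fun setT h -> (forall t, 0 <= h t) ->
  ((phi 1 - phi 0)%:E <= \int[mu]_(t in `[0%R, 1%R]) (h t)%:E)%E.
Proof.
move=> phi_diff dphi_h mh h0.
have [->|hoo] := eqVneq (\int[mu]_(t in `[0%R, 1%R]) (h t)%:E)%E +oo%E.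
  by rewrite leey.
rewrite -ltey in hoo; apply/lee_addgt0Pr => e4 e4_gt0.
pose e := e4 / 4; have e_gt0 : 0 < e by rewrite divr_gt0.
have [nu nu1 nuh] := dominating_measure mh h0 e_gt0 hoo.
have nufin t : t <= 1 -> (nu `]0%R, t]%classic <= nu `[0%R, 1%R]%classic)%E.
  move=> t1; apply: le_measure; rewrite ?inE; try exact: measurable_itv.
  move=> y /=; rewrite !in_itv /= => /andP[y0 yt].
  by rewrite (ltW y0) (le_trans yt).
have nuoo : (nu `[0%R, 1%R]%classic < +oo)%E.
  by apply: le_lt_trans nu1 _; rewrite lte_add_pinfty // ltry.
have nuE t : t <= 1 -> nu `]0%R, t]%classic = (fine (nu `]0%R, t]%classic))%:E.
  move=> t1; rewrite fineK // ge0_fin_numE ?measure_ge0 //.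
  exact: le_lt_trans (nufin t t1) nuoo.
pose N t := fine (nu `]0%R, t]%classic).
have Nstep c t y : 0 <= t -> t <= y -> y <= 1 ->
    (c%:E <= nu `]t, y]%classic)%E -> N t + c <= N y.
  move=> t0 ty y1 cnu; rewrite -lee_fin EFinD /N -!nuE //; last exact: le_trans y1.
  have -> : `]0, y]%classic = `]0, t]%classic `|` `]t, y]%classic :> set R.
    apply/seteqP; split=> z /=; rewrite !in_itv /=.
      by move=> /andP[-> ->]; case: (leP z t) => zt; [left|right].
    move=> [/andP[-> zt]|/andP[tz ->]]; first exact: le_trans ty.
    by rewrite andbT; exact: le_lt_trans tz.
  rewrite measureU; try exact: measurable_itv; first exact: leeD.
  apply/seteqP; split=> z //= [] /=; rewrite !in_itv /=.
  by move=> /andP[_ zt] /andP[tz _]; move: (lt_le_trans tz zt); rewrite ltxx.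
pose Z t := N t + 2 * e * t - phi t.
have : Z 0 <= Z 1.
  apply: locally_increasing_le => t t01.
  have [r1 r1_gt0 H1] := nuh t t01.
  have [r2 r2_gt0 H2] := derivative_expansion e_gt0 (phi_diff t).
  exists (Num.min r1 r2); first by rewrite lt_min r1_gt0.
  move=> y y01; rewrite lt_min => /andP[yr1 yr2].
  have := H2 y yr2; have := dphi_h t t01.
  have tr1 : `|t - t| < r1 by rewrite subrr normr0.
  have [t0 t1] := andP t01; have [y0 y1] := andP y01.
  move=> dh exps; split => ty.
    have := Nstep _ t y t0 ty y1 (H1 t y ty tr1 yr1).
    have yt0 : 0 <= y - t by rewrite subr_ge0.
    move: exps; rewrite (ger0_norm yt0) ler_norml => /andP[_ exps].
    have : dphi t * (y - t) <= h t * (y - t) by rewrite ler_wpM2r ?subr_ge0.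
    by rewrite /Z; move: (N t) (N y) => *; lra.
  have := Nstep _ y t y0 ty t1 (H1 y t ty yr1 tr1).
  have yt0 : y - t <= 0 by rewrite subr_le0.
  move: exps; rewrite (ler0_norm yt0) ler_norml => /andP[exps _].
  have : dphi t * (t - y) <= h t * (t - y) by rewrite ler_wpM2r ?subr_ge0.
  by rewrite /Z; move: (N t) (N y) => *; lra.
have N0 : N 0 = 0 by rewrite /N set_itvoc0 measure0.
rewrite /Z N0 => ZZ.
have : ((N 1)%:E <= \int[mu]_(t in `[0%R, 1%R]) (h t)%:E + e%:E)%E.
  by rewrite /N -nuE //; apply: le_trans nu1; exact: nufin.
have e4E : e4 = 4 * e by rewrite /e; field.
move: hoo; have : (0 <= \int[mu]_(t in `[0%R, 1%R]) (h t)%:E)%E.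
  by apply: integral_ge0 => t _; rewrite lee_fin.
case: (\int[mu]_(t in _) _)%E => [I| |] // _ _.
by rewrite -!EFinD !lee_fin e4E; lra.
Qed.

(** Testing against the increment itself, and absorbing half of its square,
gives the square of the increment without a square root of an integral. *)
Lemma sq_increment_le p q (f : 'cV[R]_p -> 'cV[R]_q) (x y : 'cV[R]_p) :
  (forall x, differentiable f x) ->
  measurable_fun setT (fun t : R => frob (jac f (y + t *: (x - y))) ^+ 2) ->
  ((frob (f x - f y) ^+ 2)%:E <= \int[mu]_(t in `[0%R, 1%R])
    (frob (x - y) ^+ 2 * frob (jac f (y + t *: (x - y))) ^+ 2)%:E)%E.
Proof.
move=> df; have [u uE] : exists u, u = x - y by exists (x - y).
have [a aE] : exists a, a = f x - f y by exists (f x - f y).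
rewrite -uE -aE; have xE : x = y + u by rewrite uE addrC subrK.
have [J JE] : exists J : R -> R, forall t, J t = frob (jac f (y + t *: u)).
  by exists (fun t => frob (jac f (y + t *: u))).
under eq_fun do rewrite -JE; under eq_integral do rewrite -JE.
move=> mJ.
pose h t := 2^-1 * frob a ^+ 2 + 2^-1 * (frob u ^+ 2 * J t ^+ 2).
have mJ' : measurable_fun setT (fun t => frob u ^+ 2 * J t ^+ 2).
  by apply: measurable_funM => //; exact: measurable_cst.
have mh : measurable_fun setT h.
  apply: measurable_funD; first exact: measurable_cst.
  by apply: measurable_funM => //; exact: measurable_cst.
have J0 t : 0 <= frob u ^+ 2 * J t ^+ 2 by rewrite mulr_ge0 ?sqr_ge0.
have h0 t : 0 <= h t.
  by rewrite addr_ge0 // mulr_ge0 // sqr_ge0.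
have dh t : 0 <= t <= 1 -> mxdot a (jac f (y + t *: u) *m u) <= h t.
  move=> _; apply: le_trans (mxdot_le _ _) _.
  apply: (@le_trans _ _ (frob a * (J t * frob u))).
    by rewrite ler_wpM2l ?frob_ge0 // JE frobM.
  have := sqr_ge0 (frob a - J t * frob u); rewrite /h.
  have -> : (frob a - J t * frob u) ^+ 2 = 2 * (2^-1 * frob a ^+ 2 +
    2^-1 * (frob u ^+ 2 * J t ^+ 2) - frob a * (J t * frob u)) by field.
  by rewrite pmulr_rge0 // subr_ge0.
have := increment_le_integral (fun t => is_derive_mxdot_line a y u t df)
  dh mh h0.
rewrite scale1r scale0r addr0 -mxdotBr -xE -aE -frobE.
under [X in (_ <= X)%E]eq_integral do rewrite EFinD.
have m1 : measurable_fun (`[0, 1]%classic : set R) (fun t : R => (frob u ^+ 2 * J t ^+ 2)%:E).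
  by apply/measurable_EFinP; exact: measurable_funTS.
have p1 (t : R) : `[0, 1]%classic t -> (0 <= (2^-1 * frob a ^+ 2)%:E)%E.
  by move=> _; rewrite lee_fin mulr_ge0 ?sqr_ge0.
have p2 (t : R) : `[0, 1]%classic t -> (0 <= (frob u ^+ 2 * J t ^+ 2)%:E)%E.
  by move=> _; rewrite lee_fin.
have p3 (t : R) : `[0, 1]%classic t ->
    (0 <= (2^-1 * (frob u ^+ 2 * J t ^+ 2))%:E)%E.
  by move=> _; rewrite lee_fin mulr_ge0.
have m2 : measurable_fun (`[0, 1]%classic : set R)
    (fun t : R => (2^-1 * (frob u ^+ 2 * J t ^+ 2))%:E).
  apply/measurable_EFinP; apply: measurable_funM; first exact: measurable_cst.
  exact: measurable_funTS.
rewrite ge0_integralD //.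
rewrite integral_cst //= lebesgue_measure_itv /= lte01 oppr0 adde0 mule1.
under [X in (_ <= _ + X)%E]eq_integral do rewrite EFinM.
rewrite ge0_integralZl ?lee_fin //.
case: (\int[mu]_(t in _) _)%E => [I| |].
- by rewrite -EFinM -EFinD !lee_fin; lra.
- by move=> _; rewrite leey.
- by rewrite gt0_muleNy ?lte_fin // addeNy leeNy_eq.
Qed.

End Increments.

(** * Mean-square Lipschitz continuity of the sampled map *)

Section MeanSquareLipschitz.
Context d (Xi : measurableType d) (R : realType) (Q : probability Xi R).
Variables (p q : nat) (F : 'cV[R]_p -> Xi -> 'cV[R]_q).
Hypothesis F_integrable : forall x, integrable_mx Q (F x).
Hypothesis F_diff : forall s x, differentiable (F ^~ s) x.
Local Notation mu := (@lebesgue_measure R).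

Lemma F_joint_measurable dS (S : measurableType dS) (X : S -> 'cV[R]_p)
    (Y : S -> Xi) : mxmeasurable X -> measurable_fun setT Y ->
  mxmeasurable (fun s => F (X s) (Y s)).
Proof.
move=> mX mY.
apply: (mxmeasurable_caratheodory (Phi := fun x s => F x (Y s))) => //.
  by move=> s x; exact: (differentiable_continuous (F_diff (Y s) x)).
move=> x; exact: mxmeasurable_comp mY (integrable_mx_measurable (F_integrable x)).
Qed.

Lemma Fjac_joint_measurable dS (S : measurableType dS) (X : S -> 'cV[R]_p)
    (Y : S -> Xi) : mxmeasurable X -> measurable_fun setT Y ->
  mxmeasurable (fun s => Fjac F (X s) (Y s)).
Proof.
move=> mX mY; apply: (mxmeasurable_jac (f := fun x s => F x (Y s))) => //.
move=> x; exact: mxmeasurable_comp mY (integrable_mx_measurable (F_integrable x)).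
Qed.

(** Integrate the bound on the squared increment along the segment and
exchange the integrals. *)
Lemma mean_square_lipschitz (M : R) (x y : 'cV[R]_p) :
  (forall t, 0 <= t <= 1 ->
    (\int[Q]_s (frob (Fjac F (y + t *: (x - y)) s) ^+ 2)%:E <= (M ^+ 2)%:E)%E) ->
  (\int[Q]_s (frob (F x s - F y s) ^+ 2)%:E
   <= (M ^+ 2 * frob (x - y) ^+ 2)%:E)%E.
Proof.
move=> FM; pose u := x - y.
pose g (z : measurableTypeR R * Xi) : \bar R :=
  (\1_(`[0, 1]%classic : set R) z.1 *
   (frob u ^+ 2 * frob (Fjac F (y + z.1 *: u) z.2) ^+ 2))%:E.
have mline dS (S : measurableType dS) (X : S -> R) : measurable_fun setT X ->
    mxmeasurable (fun s => y + X s *: u).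
  move=> mX; apply: mxmeasurableD; first exact: mxmeasurable_cst.
  move=> i j; under eq_fun do rewrite mxE.
  by apply: measurable_funM => //; exact: measurable_cst.
have mg : measurable_fun setT g.
  apply/measurable_EFinP; apply: measurable_funM.
    have m01 := @measurable_indic _ (measurableTypeR R) R setT
      (`[0, 1]%classic : set R) (measurable_itv _).
    exact: (measurableT_comp m01
      (measurable_fst : measurable_fun setT (@fst (measurableTypeR R) Xi))).
  apply: measurable_funM; first exact: measurable_cst.
  apply: measurable_sqfrob; apply: Fjac_joint_measurable => //.
  exact: mline.
have g0 z : (0 <= g z)%E.
  by rewrite /g lee_fin indicE !mulr_ge0 ?frob_ge0 ?ler0n.
apply: (@le_trans _ _ (\int[Q]_s \int[mu]_t g (t, s))%E).
  apply: ge0_le_integral => //.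
  - by move=> s _; rewrite lee_fin sqr_ge0.
  - apply: measurable_sqfrobE; apply: mxmeasurableB;
      exact: integrable_mx_measurable.
  - exact: (measurable_fun_fubini_tonelli_G (m1 := mu) g mg g0).
  - move=> s _.
    have mJ : measurable_fun setT (fun t : R =>
        frob (jac (F ^~ s) (y + t *: (x - y))) ^+ 2).
      apply: measurable_sqfrob; apply: (Fjac_joint_measurable (Y := cst s)) => //.
      exact: mline.
    apply: le_trans (@sq_increment_le _ _ _ (F ^~ s) x y (F_diff s) mJ) _.
    rewrite integral_mkcond le_eqVlt; apply/orP; left; apply/eqP.
    apply: eq_integral => t _; rewrite patchE /g /= indicE.
    by case: ifPn => tI; rewrite ?mul1r ?mul0r.
rewrite -(fubini_tonelli g mg g0).
apply: (@le_trans _ _ (\int[mu]_(t in `[0%R, 1%R])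
    (M ^+ 2 * frob u ^+ 2)%:E)%E).
  rewrite [leRHS]integral_mkcond; apply: ge0_le_integral => //.
  - by move=> t _; apply: integral_ge0 => s _.
  - exact: (measurable_fun_fubini_tonelli_F (m2 := Q) g mg g0).
  - by apply/(measurable_restrictT _ _).1.
  - move=> t _; rewrite patchE /g /= indicE.
    case: ifPn => tI; last first.
      by under eq_integral do rewrite mul0r; rewrite integral0.
    under eq_integral do rewrite mul1r EFinM.
    rewrite ge0_integralZl //; last 3 first.
    + apply: measurable_sqfrobE.
      apply: (@Fjac_joint_measurable _ _ (cst (y + t *: u)) id).
        exact: mxmeasurable_cst.
      exact: measurable_id.
    + by move=> s _; rewrite lee_fin sqr_ge0.
    + by rewrite lee_fin sqr_ge0.
    rewrite [leRHS]EFinM [leRHS]muleC.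
    apply: lee_wpmul2l; first by rewrite lee_fin sqr_ge0.
    by apply: FM; move: tI; rewrite inE /= in_itv.
by rewrite integral_cst //= lebesgue_measure_itv /= lte01 oppr0 adde0 mule1.
Qed.

End MeanSquareLipschitz.

(** * Step sizes and the rate *)

Section Rate.
Variable R : realType.

Definition cbrt (t : nat) : R := t.+2%:R `^ (1 / 3).

Lemma cbrt_gt0 t : 0 < cbrt t.
Proof. by rewrite powR_gt0. Qed.

Lemma cbrt3 t : cbrt t ^+ 3 = t.+2%:R.
Proof.
rewrite -powR_mulrn ?(ltW (cbrt_gt0 t)) // -powRrM.
by have -> : 1 / 3 * 3%:R = 1 :> R; [field|rewrite powRr1].
Qed.

Lemma cbrt2 t : t.+2%:R `^ (2 / 3) = cbrt t ^+ 2.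
Proof.
rewrite -powR_mulrn ?(ltW (cbrt_gt0 t)) // -powRrM.
by congr (_ `^ _); field.
Qed.

Lemma cbrtS3 t : cbrt t.+1 ^+ 3 = cbrt t ^+ 3 + 1.
Proof. by rewrite !cbrt3 -[in LHS]natr1. Qed.

Lemma cbrtS_le t : cbrt t <= cbrt t.+1.
Proof.
rewrite -(@ler_pXn2r _ 3) ?nnegrE ?(ltW (cbrt_gt0 _)) // cbrtS3; lra.
Qed.

Lemma cbrt_cube_ge2 t : 2 <= cbrt t ^+ 3.
Proof. by rewrite cbrt3 ler_nat. Qed.

(** Concavity of the cube root. *)
Lemma cbrtS_concave t : cbrt t.+1 <= cbrt t + (3 * cbrt t ^+ 2)^-1.
Proof.
have z0 := cbrt_gt0 t; set z := cbrt t in z0 *.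
have c0 : 0 < (3 * z ^+ 2)^-1 by rewrite invr_gt0 mulr_gt0 ?exprn_gt0.
rewrite -(@ler_pXn2r _ 3) ?nnegrE ?(ltW (cbrt_gt0 _)) //; last first.
  by rewrite addr_ge0 ?ltW.
rewrite cbrtS3 -/z; set c := (3 * z ^+ 2)^-1 in c0 *.
have zc : 3 * z ^+ 2 * c = 1 by rewrite /c; field; rewrite gt_eqF.
have -> : (z + c) ^+ 3 = z ^+ 3 + 3 * z ^+ 2 * c + (3 * z * c ^+ 2 + c ^+ 3).
  by ring.
by rewrite zc lerDl addr_ge0 ?exprn_ge0 ?mulr_ge0 ?sqr_ge0 // ltW.
Qed.

(** The weight [z = cbrt t] grows by at most [1 / (3 * z ^+ 2)], while the
contraction takes about [2 / z] off it; the surplus [9 / 8 / z] absorbs the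
errors of the descent inequality. *)
Lemma weight_decrease t : cbrt t.+1 * (1 - 1 / cbrt t ^+ 2) ^+ 2
  <= cbrt t - 9 / 8 / cbrt t.
Proof.
have z0 := cbrt_gt0 t; have z3 := cbrt_cube_ge2 t.
have zS := cbrtS_concave t.
set z := cbrt t in z0 z3 zS *; set w := cbrt t.+1 in zS *.
apply: le_trans (ler_wpM2r (sqr_ge0 _) zS) _.
pose y := z^-1; have y0 : 0 < y by rewrite invr_gt0.
have zy : z * y = 1 by rewrite mulfV // gt_eqF.
have y3 : y ^+ 3 <= 2^-1.
  have y3z : z ^+ 3 * y ^+ 3 = 1 by rewrite -exprMn zy expr1n.
  have y3_gt0 : 0 < y ^+ 3 by rewrite exprn_gt0.
  have : 2 * y ^+ 3 <= z ^+ 3 * y ^+ 3 by rewrite ler_wpM2r // ltW.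
  lra.
have y1 : y <= 4 / 5.
  rewrite leNgt; apply/negP => y1.
  have : (4 / 5) ^+ 3 < y ^+ 3 by rewrite ltr_pXn2r ?nnegrE //; lra.
  by have -> : (4 / 5) ^+ 3 = 64 / 125 :> R; [field|lra].
rewrite -subr_ge0.
have -> : z - 9 / 8 / z - (z + (3 * z ^+ 2)^-1) * (1 - 1 / z ^+ 2) ^+ 2 =
    y * (7 / 8 - y ^+ 2 - y / 3 + (y ^+ 3) * (2 - y ^+ 2) / 3).
  by rewrite /y; field; rewrite gt_eqF.
apply: mulr_ge0; first exact: ltW.
have y2 : y ^+ 2 <= 16 / 25 by nra.
have rest_ge0 : 0 <= y ^+ 3 * (2 - y ^+ 2) / 3.
  by rewrite divr_ge0 // mulr_ge0 ?exprn_ge0 ?(ltW y0) //; lra.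
have [y34|y34] := leP y (3 / 4).
  have : y ^+ 2 <= 9 / 16 by nra.
  lra.
have y3' : 27 / 64 <= y ^+ 3.
  have -> : 27 / 64 = (3 / 4) ^+ 3 :> R by field.
  by rewrite ler_pXn2r ?nnegrE ?(ltW y0) ?(ltW y34) //; lra.
have : 27 / 64 * (34 / 25) / 3 <= y ^+ 3 * (2 - y ^+ 2) / 3.
  by rewrite ler_wpM2r ?invr_ge0 // ler_pM //; lra.
lra.
Qed.

Lemma weight_ratio t : cbrt t.+1 * (1 - 1 / cbrt t ^+ 2) ^+ 2 <= cbrt t.
Proof.
apply: le_trans (weight_decrease t) _; rewrite gerBl.
by rewrite !divr_ge0 // ltW // cbrt_gt0.
Qed.

Lemma noise_weight t : cbrt t.+1 / cbrt t ^+ 4 <= 2 / t.+2%:R.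
Proof.
have z0 := cbrt_gt0 t.
have h : cbrt t.+1 <= 2 * cbrt t.
  rewrite -(@ler_pXn2r _ 3) ?nnegrE ?(ltW (cbrt_gt0 _)) //; last first.
    by rewrite mulr_ge0 // ltW.
  by rewrite cbrtS3 exprMn; have := cbrt_cube_ge2 t; lra.
have -> : 2 / t.+2%:R = 2 * cbrt t / cbrt t ^+ 4.
  by rewrite -(cbrt3 t); field; rewrite gt_eqF.
by rewrite ler_wpM2r // invr_ge0 exprn_ge0 // ltW.
Qed.

Lemma step_sum T : 3 / 2 * (cbrt T.+1 ^+ 2 - cbrt 0 ^+ 2) <=
  \sum_(0 <= t < T.+1) (cbrt t)^-1.
Proof.
have step t : 3 / 2 * (cbrt t.+1 ^+ 2 - cbrt t ^+ 2) <= (cbrt t)^-1.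
  have z0 := cbrt_gt0 t; have w0 := cbrt_gt0 t.+1; have zw := cbrtS_le t.
  have w3 := cbrtS3 t; set z := cbrt t in z0 zw w3 *.
  set w := cbrt t.+1 in w0 zw w3 *.
  have s0 : 0 < z * (w ^+ 2 + w * z + z ^+ 2).
    by rewrite mulr_gt0 // !addr_gt0 ?exprn_gt0 ?mulr_gt0.
  rewrite -subr_ge0 -(pmulr_rge0 _ s0).
  have zV : z * z^-1 = 1 by rewrite mulfV // gt_eqF.
  have -> : z * (w ^+ 2 + w * z + z ^+ 2) *
      (z^-1 - 3 / 2 * (w ^+ 2 - z ^+ 2)) =
    (w ^+ 2 + w * z + z ^+ 2) * (z * z^-1)
      - 3 / 2 * z * (w + z) * (w ^+ 3 - z ^+ 3).
    by field; rewrite gt_eqF.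
  rewrite zV w3.
  have -> : (w ^+ 2 + w * z + z ^+ 2) * 1
      - 3 / 2 * z * (w + z) * (z ^+ 3 + 1 - z ^+ 3) =
    2^-1 * ((2 * w + z) * (w - z)) by field.
  by rewrite !mulr_ge0 ?subr_ge0 ?addr_ge0 ?mulr_ge0 // ltW.
elim: T => [|T IHT]; first by rewrite big_nat1; exact: step.
rewrite big_nat_recr //=; apply: le_trans (lerD IHT (step T.+1)); lra.
Qed.

Lemma harmonic_sum T : \sum_(0 <= t < T) t.+2%:R^-1 <= ln T.+1%:R :> R.
Proof.
elim: T => [|T IHT]; first by rewrite big_geq // ln1.
rewrite big_nat_recr //=; apply: le_trans (lerD IHT (lexx _)) _.
rewrite addrC -lerBrDr.
have T1 : 0 < T.+1%:R :> R by []. have T2 : 0 < T.+2%:R :> R by [].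
rewrite -ln_div ?posrE //.
pose r : R := T.+1%:R / T.+2%:R; have r_gt0 : 0 < r by rewrite divr_gt0.
have h : ln r <= r - 1.
  have := @le_ln1Dx R (r - 1); rewrite (addrC 1) subrK; apply.
  by rewrite ltrBrDl subrr.
rewrite (_ : T.+2%:R / T.+1%:R = r^-1); last by rewrite invf_div.
rewrite lnV ?posrE //.
have -> : T.+2%:R^-1 = 1 - r.
  rewrite /r -[X in X - _](mulfV (lt0r_neq0 T2)) -mulrBl -natrB //.
  by rewrite subSnn mul1r.
lra.
Qed.

(** The real-number skeleton of the analysis: [g], [d], [e] are the expected
squares of the gradient mapping, of the move and of the estimation error.  The
descent inequality and the error recursion are added with the weights
[13 / 9 * (rB / P) * cbrt t], chosen so that the errors and the moves cancel. *)
Section Recursion.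
Variables (L P Q B hb D0 : R) (T : nat) (g d e : nat -> R).
Let rB := Num.sqrt B.
Let theta t := L * rB / (P * cbrt t).
Let beta t := 1 - 1 / cbrt t ^+ 2.
Hypotheses (L_gt0 : 0 < L) (P_gt0 : 0 < P) (Q_ge0 : 0 <= Q).
Hypotheses (B_gt0 : 0 < B) (hb_gt0 : 0 < hb) (D0_ge0 : 0 <= D0).
Hypothesis d_ge0 : forall t, 0 <= d t.
Hypothesis e_ge0 : forall t, 0 <= e t.
Hypothesis descent_sum :
  \sum_(0 <= t < T.+1) (theta t / (16 * L) * g t + theta t * L * d t)
  <= D0 + \sum_(0 <= t < T.+1) 13 / 8 * (theta t / L) * e t.
Hypothesis error_rec : forall t, (t < T)%N ->
  e t.+1 <= beta t ^+ 2 * e t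
    + beta t ^+ 2 * (9 * P ^+ 2 / (13 * B)) * theta t ^+ 2 * d t
    + (1 - beta t) ^+ 2 * (9 * Q / (13 * B)).
Hypothesis error_init : e 0 <= 9 * Q / (13 * hb).

Variable c : R.
Hypothesis cE : c = rB / P.

Let rB_gt0 : 0 < rB. Proof. by rewrite sqrtr_gt0. Qed.
Let rB2 : rB ^+ 2 = B. Proof. by rewrite sqr_sqrtr // ltW. Qed.
Let c_gt0 : 0 < c. Proof. by rewrite cE divr_gt0. Qed.

Let weighted_step t : (t < T)%N ->
  13 / 9 * c * cbrt t.+1 * e t.+1 + 13 / 8 * (theta t / L) * e t <=
  13 / 9 * c * cbrt t * e t + theta t * L * d t
    + c * (Q / B) * (cbrt t.+1 / cbrt t ^+ 4).
Proof.
move=> tT; have z0 := cbrt_gt0 t; have w0 := cbrt_gt0 t.+1.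
have h1 := weight_decrease t; have h2 := weight_ratio t.
have h3 := error_rec tT; have e0 := e_ge0 t; have d0 := d_ge0 t.
have th : theta t = L * c / cbrt t.
  by rewrite /theta cE; field; rewrite !gt_eqF.
have cw_ge0 : 0 <= 13 / 9 * c * cbrt t.+1.
  by rewrite !mulr_ge0 // ltW.
have {}h3 := ler_wpM2l cw_ge0 h3.
rewrite -/(beta t) in h1 h2.
set z := cbrt t in z0 h1 h2 th *; set w := cbrt t.+1 in w0 h1 h2 cw_ge0 h3 *.
have b1 : 1 - beta t = 1 / z ^+ 2 by rewrite /beta opprB addrC subrK.
rewrite b1 in h3; move: h1 h2 h3; move: (beta t ^+ 2) => b h1 h2 h3.
have k1 : 13 / 9 * c * w * (b * e t) + 13 / 8 * (theta t / L) * e t <=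
    13 / 9 * c * z * e t.
  have -> : 13 / 9 * c * w * (b * e t) + 13 / 8 * (theta t / L) * e t =
      13 / 9 * c * e t * (w * b + 9 / 8 / z).
    by rewrite th; field; rewrite !gt_eqF.
  have -> : 13 / 9 * c * z * e t = 13 / 9 * c * e t * z by ring.
  by rewrite ler_wpM2l ?mulr_ge0 ?(ltW c_gt0) //; lra.
have k2 : 13 / 9 * c * w * (b * (9 * P ^+ 2 / (13 * B)) * theta t ^+ 2 * d t)
    <= theta t * L * d t.
  have -> : 13 / 9 * c * w * (b * (9 * P ^+ 2 / (13 * B)) * theta t ^+ 2 * d t) =
      L ^+ 2 * c * d t / z ^+ 2 * (w * b).
    rewrite th cE -rB2; field; rewrite !gt_eqF //.
  have -> : theta t * L * d t = L ^+ 2 * c * d t / z ^+ 2 * z.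
    by rewrite th; field; rewrite gt_eqF.
  rewrite ler_wpM2l // divr_ge0 ?sqr_ge0 // !mulr_ge0 ?sqr_ge0 // ?ltW //.
have k3 : 13 / 9 * c * w * ((1 / z ^+ 2) ^+ 2 * (9 * Q / (13 * B))) =
    c * (Q / B) * (w / z ^+ 4).
  by field; rewrite !gt_eqF.
by move: h3; rewrite !mulrDr k3; lra.
Qed.

Let weighted_sum s : (s <= T)%N ->
  13 / 9 * c * cbrt s * e s + \sum_(0 <= t < s) 13 / 8 * (theta t / L) * e t <=
  13 / 9 * c * cbrt 0 * e 0 + \sum_(0 <= t < s) theta t * L * d t
    + \sum_(0 <= t < s) c * (Q / B) * (cbrt t.+1 / cbrt t ^+ 4).
Proof.
elim: s => [_|s IHs sT]; first by rewrite !big_geq // !addr0.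
have := weighted_step sT; have := IHs (ltnW sT).
by rewrite !big_nat_recr //=; lra.
Qed.

Let last_weight : 13 / 8 * (theta T / L) * e T <= 13 / 9 * c * cbrt T * e T.
Proof.
have z0 := cbrt_gt0 T.
have h : 9 / 8 / cbrt T <= cbrt T.
  rewrite -subr_ge0; apply: le_trans (weight_decrease T).
  by rewrite mulr_ge0 ?sqr_ge0 // ltW // cbrt_gt0.
have -> : 13 / 8 * (theta T / L) * e T = 13 / 9 * c * e T * (9 / 8 / cbrt T).
  by rewrite /theta cE; field; rewrite !gt_eqF.
have -> : 13 / 9 * c * cbrt T * e T = 13 / 9 * c * e T * cbrt T by ring.
by rewrite ler_wpM2l // !mulr_ge0 // ltW.
Qed.

Let noise_sum : \sum_(0 <= t < T) c * (Q / B) * (cbrt t.+1 / cbrt t ^+ 4) <=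
  c * (Q / B) * (2 * (1 + ln T.+1%:R)).
Proof.
have k_ge0 : 0 <= c * (Q / B).
  by rewrite mulr_ge0 ?(ltW c_gt0) // divr_ge0 // ltW.
rewrite -mulr_sumr ler_wpM2l //.
apply: (@le_trans _ _ (\sum_(0 <= t < T) 2 * t.+2%:R^-1)).
  by apply: ler_sum => t _; exact: noise_weight.
by rewrite -mulr_sumr ler_wpM2l // (le_trans (harmonic_sum T)) // lerDr.
Qed.

Lemma weighted_rate : \sum_(0 <= t < T.+1) theta t * g t <=
  16 * L * (D0 + c * Q * (cbrt 0 / hb + 2 * (1 + ln T.+1%:R) / B)).
Proof.
have h1 := weighted_sum (leqnn T); have h2 := last_weight; have h3 := noise_sum.
have h4 : 13 / 9 * c * cbrt 0 * e 0 <= c * Q * (cbrt 0 / hb).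
  have -> : c * Q * (cbrt 0 / hb) = 13 / 9 * c * cbrt 0 * (9 * Q / (13 * hb)).
    by field; rewrite gt_eqF.
  by rewrite ler_wpM2l // !mulr_ge0 // ltW // cbrt_gt0.
move: descent_sum; rewrite big_split /= big_nat_recr //=.
rewrite [\sum_(0 <= t < T.+1) _ * L * _]big_nat_recr //=.
rewrite [\sum_(0 <= t < T.+1) 13 / 8 * _ * _]big_nat_recr //= => h5.
have dT : 0 <= theta T * L * d T.
  have th_gt0 : 0 < theta T by rewrite divr_gt0 // mulr_gt0 // cbrt_gt0.
  by rewrite mulr_ge0 // mulr_ge0 ?(ltW th_gt0) ?(ltW L_gt0).
have -> : \sum_(0 <= t < T.+1) theta t * g t =
    16 * L * (\sum_(0 <= t < T) theta t / (16 * L) * g t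
      + theta T / (16 * L) * g T).
  rewrite -big_nat_recr //= mulr_sumr; apply: eq_bigr => t _.
  by field; rewrite gt_eqF.
rewrite ler_wpM2l ?mulr_ge0 ?(ltW L_gt0) // mulrDr.
have -> : c * Q * (2 * (1 + ln T.+1%:R) / B) =
  c * (Q / B) * (2 * (1 + ln T.+1%:R)) by field; rewrite gt_eqF.
lra.
Qed.

Lemma step_size_sum : L * c * (3 / 2 * (cbrt T.+1 ^+ 2 - cbrt 0 ^+ 2)) <=
  \sum_(0 <= t < T.+1) theta t.
Proof.
have -> : \sum_(0 <= t < T.+1) theta t = L * c * \sum_(0 <= t < T.+1) (cbrt t)^-1.
  rewrite mulr_sumr; apply: eq_bigr => t _; rewrite /theta cE.
  by field; rewrite !gt_eqF // cbrt_gt0.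
by rewrite ler_wpM2l ?step_sum // mulr_ge0 // ltW.
Qed.

Lemma cbrt_gap_gt0 : 0 < cbrt T.+1 ^+ 2 - cbrt 0 ^+ 2.
Proof.
rewrite subr_gt0 ltr_sqr ?nnegrE ?(ltW (cbrt_gt0 _)) //.
by rewrite -(@ltr_pXn2r _ 3) ?nnegrE ?(ltW (cbrt_gt0 _)) // !cbrt3 ltr_nat.
Qed.

Lemma average_rate (Delta := cbrt T.+1 ^+ 2 - cbrt 0 ^+ 2) :
  (\sum_(0 <= t < T.+1) theta t * g t) / (\sum_(0 <= t < T.+1) theta t) <=
  32 * P / (3 * rB * Delta) * D0
    + 32 * Q / (3 * Delta) * (cbrt 0 / hb + 2 * (1 + ln T.+1%:R) / B).
Proof.
have Dgt0 : 0 < Delta := cbrt_gap_gt0.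
have h1 := weighted_rate; have h2 := step_size_sum; rewrite -/Delta in h2.
have s_gt0 : 0 < L * c * (3 / 2 * Delta) by rewrite !mulr_gt0.
have S_gt0 := lt_le_trans s_gt0 h2.
rewrite ler_pdivrMr //; apply: le_trans h1 _.
set X := cbrt 0 / hb + _.
have X_ge0 : 0 <= X.
  rewrite addr_ge0 // divr_ge0 ?(ltW (cbrt_gt0 _)) ?(ltW hb_gt0) ?(ltW B_gt0) //.
  by rewrite mulr_ge0 // addr_ge0 // ln_ge0 // ler1n.
have -> : 16 * L * (D0 + c * Q * X) =
    (32 * P / (3 * rB * Delta) * D0 + 32 * Q / (3 * Delta) * X)
    * (L * c * (3 / 2 * Delta)).
  by rewrite cE; field; rewrite !gt_eqF.
rewrite ler_wpM2l // addr_ge0 // mulr_ge0 // divr_ge0 // !mulr_ge0 // ltW //.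
Qed.

End Recursion.
End Rate.

(** * Consequences of the standing assumptions *)

Section Setting.
Context d (Xi : measurableType d) (R : realType) (Q : probability Xi R).
Variables (p q n : nat) (F : 'cV[R]_p -> Xi -> 'cV[R]_q) (K : 'M[R]_(q, n)).
Variables (psi : 'cV[R]_n -> \bar R) (Rg : 'cV[R]_p -> \bar R).
Hypothesis psi_proper : proper_efun psi.
Hypothesis psi_lsc : lower_semicontinuous psi.
Hypothesis psi_sconvex : strongly_convex 1 psi.
Hypothesis Rg_proper : proper_efun Rg.
Hypothesis Rg_convex : convex_efun Rg.
Hypothesis F_integrable : forall x, integrable_mx Q (F x).
Hypothesis F_diff : forall s x, differentiable (F ^~ s) x.
Hypothesis J_integrable : forall x, integrable_mx Q (Fjac F x).
Hypothesis Fmean_diff : forall x, differentiable (Fmean Q F) x.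
Hypothesis Fmean_jac : forall x, jac (Fmean Q F) x = expect_mx Q (Fjac F x).

Lemma edom_Psi0 : edom (Psi0 Q F K psi Rg) = edom Rg.
Proof.
apply/seteqP; split => x; rewrite /edom /= /Psi0 phi0E //;
  by case: (Rg x) => [r| |] //=; rewrite ?ltry.
Qed.

Lemma Psi0E x : edom Rg x ->
  Psi0 Q F K psi Rg x = (Phi0 Q F K psi x + fine (Rg x))%:E.
Proof. by move=> dx; rewrite /Psi0 /Phi0 phi0E // (edom_fine Rg_proper dx). Qed.

Variables (L_F M_F sigma_F sigma_J : R).
Hypotheses (L_F_ge0 : 0 <= L_F) (M_F_ge0 : 0 <= M_F).
Hypothesis F_smooth : forall x y, edom Rg x -> edom Rg y ->
  (\int[Q]_s (frob (Fjac F x s - Fjac F y s) ^+ 2)%:E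
   <= (L_F ^+ 2 * frob (x - y) ^+ 2)%:E)%E.
Hypothesis F_variance : forall x, edom Rg x ->
  (\int[Q]_s (frob (F x s - Fmean Q F x) ^+ 2)%:E <= (sigma_F ^+ 2)%:E)%E.
Hypothesis J_variance : forall x, edom Rg x ->
  (\int[Q]_s (frob (Fjac F x s - jac (Fmean Q F) x) ^+ 2)%:E
   <= (sigma_J ^+ 2)%:E)%E.
Hypothesis J_bounded : forall x, edom Rg x ->
  (\int[Q]_s (frob (Fjac F x s) ^+ 2)%:E <= (M_F ^+ 2)%:E)%E.

Lemma jac_mean_bounded x : edom Rg x -> frob (jac (Fmean Q F) x) <= M_F.
Proof. by move=> dx; rewrite Fmean_jac; apply: frob_expect_le => //; exact: J_bounded. Qed.

Lemma jac_mean_lipschitz x y : edom Rg x -> edom Rg y ->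
  frob (jac (Fmean Q F) x - jac (Fmean Q F) y) <= L_F * frob (x - y).
Proof.
move=> dx dy; rewrite !Fmean_jac -expect_mxB //; apply: frob_expect_le.
- by rewrite mulr_ge0 ?frob_ge0.
- exact: integrable_mxB.
- by rewrite exprMn; exact: F_smooth.
Qed.

Lemma F_regular : mean_square_regular Q F (edom Rg) M_F sigma_F.
Proof.
split.
- by move=> *; exact: F_joint_measurable.
- move=> dS S X mX; apply: (mxmeasurable_continuous (f := Fmean Q F)) => // x.
  exact: differentiable_continuous.
- exact: F_integrable.
- move=> x y dx dy; apply: (mean_square_lipschitz F_integrable F_diff) => t t01.
  by apply: J_bounded; exact: (edom_segment Rg_proper Rg_convex t01 dy dx).
- exact: F_variance.
Qed.

Lemma Fjac_regular : mean_square_regular Q (Fjac F) (edom Rg) L_F sigma_J.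
Proof.
split => //.
- by move=> *; exact: Fjac_joint_measurable.
- move=> dS S X mX; under eq_fun do rewrite -Fmean_jac.
  apply: (mxmeasurable_jac (f := fun x _ => Fmean Q F x)) => //.
  by move=> x; exact: mxmeasurable_cst.
- by move=> x dx; rewrite -Fmean_jac; exact: J_variance.
Qed.

End Setting.

(** * Averaging over the random output index *)

Section RandomIndex.
Context d (W : measurableType d) (R : realType) (P : probability W R).

(** The integral of a nonnegative function is the supremum over the simple
functions below it, hence monotone on arbitrary functions.  The iterates selected
by the random index are known to be measurable only for the indices that carry
its law. *)
Lemma ge0_integral_monotone (f g : W -> \bar R) : (forall w, (0 <= f w)%E) ->
  (forall w, (f w <= g w)%E) -> (\int[P]_w f w <= \int[P]_w g w)%E.
Proof.
move=> f0 fg; rewrite !ge0_integralTE // => [|w]; last exact: le_trans (fg w).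
apply: le_ereal_sup => _ [h hf <-]; exists h => // w.
exact: le_trans (hf w) (fg w).
Qed.

Lemma integral_weighted_sum (a : nat -> R) (f : nat -> W -> R) N :
  (forall t, (t < N)%N -> 0 <= a t) ->
  (forall t, (t < N)%N -> measurable_fun setT (f t)) ->
  (forall t w, 0 <= f t w) ->
  (\int[P]_w (\sum_(0 <= t < N) a t * f t w)%:E =
   \sum_(0 <= t < N) (a t)%:E * \int[P]_w (f t w)%:E)%E.
Proof.
elim: N => [|N IHN] a0 mf f0.
  by under eq_integral do rewrite big_geq //; rewrite integral0 big_geq.
have a0' t : (t < N)%N -> 0 <= a t by move=> tN; apply: a0; exact: ltnW.
have mf' t : (t < N)%N -> measurable_fun setT (f t).
  by move=> tN; apply: mf; exact: ltnW.
have msum : measurable_fun setT (fun w => \sum_(0 <= t < N) a t * f t w).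
  under eq_fun do rewrite big_mkord; apply: measurable_sum => t.
  by apply: measurable_funM => //; exact: mf'.
have mN : measurable_fun setT (f N) by exact: mf.
have aN : 0 <= a N by exact: a0.
rewrite big_nat_recr //= -IHN //.
under eq_integral do rewrite big_nat_recr //= EFinD.
rewrite ge0_integralD //=; last 4 first.
- by move=> w _; rewrite lee_fin big_nat sumr_ge0 // => t /andP[_ tN]; rewrite mulr_ge0 ?a0'.
- exact/measurable_EFinP.
- by move=> w _; rewrite lee_fin mulr_ge0.
- by apply/measurable_EFinP; exact: measurable_funM.
congr (_ + _)%E; under eq_integral do rewrite EFinM.
by rewrite ge0_integralZl //; [exact/measurable_EFinP|move=> w _; rewrite lee_fin].
Qed.

Context d' (Xi : measurableType d').
Variables (S : set (W -> Xi)) (tau : {mfun W >-> nat}) (N : nat).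
Hypothesis mS : forall X, S X -> measurable_fun setT X.
Hypothesis tau_indep :
  independent_events P (sigma_of S) (sigma_of [set (tau : W -> nat)]).
Variable pr : nat -> R.
Hypothesis tau_law : forall t, (t < N)%N -> P (tau @^-1` [set t]) = (pr t)%:E.
Hypothesis pr_sum : \sum_(0 <= t < N) pr t = 1.

Let mtau (A : set nat) : measurable (tau @^-1` A).
Proof. by rewrite -[X in measurable X]setTI; exact: measurable_funPT. Qed.

Lemma random_index_le_prob k : (k <= N)%N ->
  P (tau @^-1` [set t | (t < k)%N]) = (\sum_(0 <= t < k) pr t)%:E.
Proof.
elim: k => [_|k IHk kN].
  rewrite big_geq //; have -> : tau @^-1` [set t | (t < 0)%N] = set0.
    by apply/seteqP; split => w.
  exact: measure0.
have -> : tau @^-1` [set t | (t < k.+1)%N] =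
    tau @^-1` [set t | (t < k)%N] `|` tau @^-1` [set k].
  apply/seteqP; split => w /=; last by case=> [/leqW|->].
  by rewrite ltnS leq_eqVlt => /orP[/eqP|]; [right|left].
rewrite big_nat_recr //= EFinD -(IHk (ltnW kN)) -(tau_law kN).
apply: measureU => //.
by apply/seteqP; split => w //= [] /[swap] ->; rewrite ltnn.
Qed.

Lemma random_index_null : P (tau @^-1` [set t | (N <= t)%N]) = 0.
Proof.
have -> : tau @^-1` [set t | (N <= t)%N] = ~` (tau @^-1` [set t | (t < N)%N]).
  by apply/seteqP; split => w /=; rewrite (leqNgt N); move/negP.
by rewrite probability_setC // random_index_le_prob // pr_sum subee.
Qed.

Variable g : nat -> past S -> R.
Hypothesis mg : forall t, (t < N)%N -> measurable_fun setT (g t).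
Hypothesis g_ge0 : forall t w, 0 <= g t w.

(** The index plays the role of a fresh draw: freeze the run. *)
Lemma random_index_slice t : (t < N)%N ->
  (\int[P]_w (\1_(tau @^-1` [set t]) w * g t w)%:E
   = (pr t)%:E * \int[P]_w (g t w)%:E)%E.
Proof.
move=> tN.
pose h (z : past S * nat) : \bar R := (\1_[set t] z.2 * g t z.1)%:E.
have mh : measurable_fun setT h.
  apply/measurable_EFinP; apply: measurable_funM.
    apply: (measurableT_comp (f := (\1_[set t] : nat -> R))) => //.
  by apply: (measurableT_comp (mg tN)); exact: measurable_fst.
have h0 z : (0 <= h z)%E by rewrite lee_fin mulr_ge0.
have lawt : distribution P tau [set t] = (pr t)%:E := tau_law tN.
have mtau' : measurable_fun setT (tau : W -> nat) by [].
have := freezing (P := P) (Q := distribution P tau) mS mtau' (fun _ _ => erefl)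
  tau_indep mh h0.
have -> : (\int[P]_w h (w, tau w) =
    \int[P]_w (\1_(tau @^-1` [set t]) w * g t w)%:E)%E.
  by apply: eq_integral => w _; rewrite /h /= !indicE.
move=> ->; under eq_integral => w _.
  rewrite /h /=; under eq_integral do rewrite EFinM.
  rewrite ge0_integralZr //=; last by rewrite lee_fin.
  rewrite integral_indic // setIT [X in (X * _)%E](_ : _ = (pr t)%:E) //.
  over.
have mgW : measurable_fun setT (fun w : W => g t w).
  by apply: (measurableT_comp (mg tN)); exact: past_id_measurable.
rewrite ge0_integralZl //=; last 3 first.
- by move/measurable_EFinP: mgW.
- by move=> w _; rewrite lee_fin.
- by rewrite -tau_law.
Qed.

Lemma random_index_integral :
  (\int[P]_w (g (tau w) w)%:E <=
   \sum_(0 <= t < N) (pr t)%:E * \int[P]_w (g t w)%:E)%E.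
Proof.
pose M := tau @^-1` [set t | (N <= t)%N].
pose s w := \sum_(0 <= t < N) 1 * (\1_(tau @^-1` [set t]) w * g t w).
have mgt t : (t < N)%N ->
    measurable_fun setT (fun w : W => \1_(tau @^-1` [set t]) w * g t w).
  move=> tN; apply: measurable_funM; first exact: measurable_indic.
  by apply: (measurableT_comp (mg tN)); exact: past_id_measurable.
have s_ge0 w : 0 <= s w.
  by rewrite sumr_ge0 // => t _; rewrite mul1r mulr_ge0.
have ms : measurable_fun setT s.
  rewrite /s; under eq_fun do rewrite big_mkord.
  by apply: measurable_sum => t; apply: measurable_funM => //; exact: mgt.
have mM : measurable_fun setT (fun w => (\1_M w)%:E : \bar R).
  by apply/measurable_EFinP; apply: measurable_indic; exact: mtau.
(* beyond [N] the integrand is only dominated by [+oo], on a null event *)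
pose H w := ((s w)%:E + +oo * (\1_M w)%:E)%E.
have gH w : ((g (tau w) w)%:E <= H w)%E.
  rewrite /H indicE; have [tN|Nt] := ltnP (tau w) N.
    rewrite memNset /M /=; last by rewrite leqNgt tN.
    rewrite mule0 adde0 lee_fin /s (bigD1_seq (tau w)) ?iota_uniq //=; last first.
      by rewrite mem_index_iota tN.
    rewrite mul1r indicE mem_set // mul1r lerDl sumr_ge0 // => t _.
    by rewrite mul1r mulr_ge0.
  by rewrite mem_set // mulr1n mule1 addey // leey.
apply: le_trans (ge0_integral_monotone _ gH) _ => [w|]; first by rewrite lee_fin.
rewrite ge0_integralD //=; last 3 first.
- by move=> w _; rewrite lee_fin.
- exact/measurable_EFinP.
- exact: measurable_funeM.
rewrite ge0_integralZl //.
rewrite integral_indic //; last exact: mtau.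
rewrite setIT [X in (+oo * X)%E]random_index_null mule0 adde0.
rewrite integral_weighted_sum //; last by move=> t w; rewrite mulr_ge0.
rewrite le_eqVlt; apply/orP; left; apply/eqP.
apply: eq_big_nat => t /andP[_ tN].
by rewrite mul1e random_index_slice.
Qed.

End RandomIndex.

(** * The estimators along a run of the algorithm *)

Lemma mxmeasurable_eq d (S : measurableType d) (R : realType) m n
    (X Y : S -> 'M[R]_(m, n)) :
  (forall s, X s = Y s) -> mxmeasurable Y -> mxmeasurable X.
Proof. by move=> XY; have -> : X = Y by apply/funext. Qed.

Section Run.
Context d (Xi : measurableType d) (R : realType) (Q : probability Xi R).
Context d' (W : measurableType d') (P : probability W R).
Variables (p q n : nat) (F : 'cV[R]_p -> Xi -> 'cV[R]_q) (K : 'M[R]_(q, n)).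
Variables (psi : 'cV[R]_n -> \bar R) (Rg : 'cV[R]_p -> \bar R).
Hypothesis psi_proper : proper_efun psi.
Hypothesis psi_lsc : lower_semicontinuous psi.
Hypothesis psi_sconvex : strongly_convex 1 psi.
Hypothesis Rg_proper : proper_efun Rg.
Hypothesis Rg_lsc : lower_semicontinuous Rg.
Hypothesis Rg_convex : convex_efun Rg.
Variables (L_F M_F M_psi sigma_F sigma_J : R).
Hypothesis F_reg : mean_square_regular Q F (edom Rg) M_F sigma_F.
Hypothesis J_reg : mean_square_regular Q (Fjac F) (edom Rg) L_F sigma_J.

Variables (b0 hb0 b1 hb1 b2 hb2 : nat).
Hypotheses (b0_gt0 : (0 < b0)%N) (hb0_gt0 : (0 < hb0)%N).
Hypotheses (b1_gt0 : (0 < b1)%N) (hb1_gt0 : (0 < hb1)%N).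
Hypotheses (b2_gt0 : (0 < b2)%N) (hb2_gt0 : (0 < hb2)%N).
Variables (B : minibatches W Xi b0 hb0 b1 hb1 b2 hb2) (T : nat).
Hypothesis B_sampling : sampling P Q B T.
Variables (beta theta eta : nat -> R) (x0 : 'cV[R]_p).
Hypothesis x0_dom : edom Rg x0.
Variables (Ft : nat -> W -> 'cV[R]_q) (Jt : nat -> W -> 'M[R]_(q, p)).
Variables (v xhat x : nat -> W -> 'cV[R]_p).
Hypothesis run : hybrid_run F K psi Rg B beta beta theta eta x0 T Ft Jt v xhat x.
Hypothesis theta01 : forall t, (t <= T)%N -> 0 < theta t <= 1.
Hypothesis eta_gt0 : forall t, (t <= T)%N -> 0 < eta t.

Lemma draws_measurable t X : (t <= T)%N -> draws B t X -> measurable_fun setT X.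
Proof.
have [s0 sh0 s1 sh1 s2 sh2 _] := B_sampling.
case: t => [_|t tT] /=.
  by case=> [] [i _ <-]; [exact: iid_measurable s0 i|exact: iid_measurable sh0 i].
case=> [[[|]|]|] [i _ <-].
- exact: iid_measurable (s1 t.+1 tT) i.
- exact: iid_measurable (sh1 t.+1 tT) i.
- exact: iid_measurable (s2 t.+1 tT) i.
- exact: iid_measurable (sh2 t.+1 tT) i.
Qed.

Definition history t : set (W -> Xi) :=
  \bigcup_(s in [set s | (s < t)%N]) draws B s.

Lemma history_measurable t X : (t <= T.+1)%N -> history t X ->
  measurable_fun setT X.
Proof.
move=> tT [s st dX]; apply: (draws_measurable (t := s)) => //.
by rewrite -ltnS; exact: leq_trans tT.
Qed.

Lemma historyS t : history t `<=` history t.+1.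
Proof. by move=> X [s st dX]; exists s => //; exact: leqW. Qed.

Lemma history_draws t X : draws B t X -> history t.+1 X.
Proof. by move=> dX; exists t => /=. Qed.

Lemma draws_history t : (t < T)%N ->
  independent_events P (sigma_of (draws B t.+1)) (sigma_of (history t.+1)).
Proof. by move=> tT; apply: (sampling_past B_sampling). Qed.

Let step_iterate t : (t <= T)%N ->
  mxmeasurable (x t : past (history t) -> 'cV[R]_p) ->
  (forall w, edom Rg (x t w)) ->
  mxmeasurable (Ft t : past (history t.+1) -> 'cV[R]_q) ->
  mxmeasurable (Jt t : past (history t.+1) -> 'M[R]_(q, p)) ->
  [/\ mxmeasurable (xhat t.+1 : past (history t.+1) -> 'cV[R]_p),
      mxmeasurable (x t.+1 : past (history t.+1) -> 'cV[R]_p)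
    & forall w, edom Rg (x t.+1 w)].
Proof.
move=> tT mx dx mF mJ.
have mxS := past_mxmeasurable_sub (@historyS t) mx.
have mxh : mxmeasurable (xhat t.+1 : past (history t.+1) -> 'cV[R]_p).
  apply: mxmeasurable_eq => [w|]; first exact: (run_xhat run w tT).
  apply: mxmeasurable_continuous.
    by apply: prox_scaled_continuous => //; exact: eta_gt0.
  apply: mxmeasurableB => //; apply: mxmeasurableZ.
  apply: mxmeasurable_eq => [w|]; first exact: (run_v run w tT).
  apply: mxmeasurable_mulmx; first exact: mxmeasurable_tr.
  apply: mxmeasurable_mulmx; first exact: mxmeasurable_cst.
  by apply: mxmeasurable_continuous => //; exact: y0star_continuous.
split => //.
  apply: mxmeasurable_eq => [w|]; first exact: (run_x run w tT).
  by apply: mxmeasurableD; exact: mxmeasurableZ.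
move=> w; rewrite (run_x run) //.
have th : 0 <= theta t <= 1 by have /andP[/ltW -> ->] := theta01 tT.
have [] // := edom_convex Rg_proper Rg_convex th (dx w) (_ : edom Rg (xhat t.+1 w)).
by rewrite (run_xhat run) //; apply: prox_scaled_dom => //; exact: eta_gt0.
Qed.

Lemma run_adapted t : (t <= T)%N ->
  [/\ mxmeasurable (x t : past (history t) -> 'cV[R]_p),
      forall w, edom Rg (x t w),
      mxmeasurable (Ft t : past (history t.+1) -> 'cV[R]_q)
    & mxmeasurable (Jt t : past (history t.+1) -> 'M[R]_(q, p))].
Proof.
have [mF _ _ _ _] := F_reg; have [mJ _ _ _ _] := J_reg.
elim: t => [_|t IHt tT].
  have mdraw Y : draws B 0 Y -> measurable_fun setT (Y : past (history 1) -> Xi).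
    by move=> dY; apply: past_draw_measurable; exact: history_draws.
  split.
  - apply: mxmeasurable_eq => [w|]; first exact: (run_x0 run w).
    exact: mxmeasurable_cst.
  - by move=> w; rewrite (run_x0 run).
  - apply: mxmeasurable_eq => [w|]; first exact: (run_F0 run w).
    apply: mxmeasurableZ.
    apply: mxmeasurable_sum => i; apply: mF; first exact: mxmeasurable_cst.
    by apply: mdraw; left; exists i.
  - apply: mxmeasurable_eq => [w|]; first exact: (run_J0 run w).
    apply: mxmeasurableZ.
    apply: mxmeasurable_sum => i; apply: mJ; first exact: mxmeasurable_cst.
    by apply: mdraw; right; exists i.
have [mx dx mFt mJt] := IHt (ltnW tT).
have [_ mxS dxS] := step_iterate (ltnW tT) mx dx mFt mJt.
have mx2 := past_mxmeasurable_sub (@historyS t.+1)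
  (past_mxmeasurable_sub (@historyS t) mx).
have mxS2 := past_mxmeasurable_sub (@historyS t.+1) mxS.
have mdraw Y : draws B t.+1 Y ->
    measurable_fun setT (Y : past (history t.+2) -> Xi).
  by move=> dY; apply: past_draw_measurable; exact: history_draws.
split => //.
- apply: mxmeasurable_eq => [w|]; first exact: (run_F run w tT).
  apply: mxmeasurableD; first apply: mxmeasurableD; apply: mxmeasurableZ.
  + exact: past_mxmeasurable_sub (@historyS t.+1) mFt.
  + apply: mxmeasurable_sum => i; apply: mxmeasurableB; apply: mF => //;
      by apply: mdraw; left; left; left; exists i.
  + apply: mxmeasurable_sum => i; apply: mF => //.
    by apply: mdraw; left; right; exists i.
- apply: mxmeasurable_eq => [w|]; first exact: (run_J run w tT).
  apply: mxmeasurableD; first apply: mxmeasurableD; apply: mxmeasurableZ.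
  + exact: past_mxmeasurable_sub (@historyS t.+1) mJt.
  + apply: mxmeasurable_sum => i; apply: mxmeasurableB; apply: mJ => //;
      by apply: mdraw; left; left; right; exists i.
  + apply: mxmeasurable_sum => i; apply: mJ => //.
    by apply: mdraw; right; exists i.
Qed.

Lemma run_adapted_next t : (t <= T)%N ->
  [/\ mxmeasurable (xhat t.+1 : past (history t.+1) -> 'cV[R]_p),
      mxmeasurable (x t.+1 : past (history t.+1) -> 'cV[R]_p)
    & forall w, edom Rg (x t.+1 w)].
Proof. by move=> tT; have [] := run_adapted tT; exact: step_iterate. Qed.

Definition error_F t : \bar R :=
  (\int[P]_w (frob (Ft t w - Fmean Q F (x t w)) ^+ 2)%:E)%E.

Definition error_J t : \bar R :=
  (\int[P]_w (frob (Jt t w - expect_mx Q (Fjac F (x t w))) ^+ 2)%:E)%E.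

Definition move_size t : \bar R :=
  (\int[P]_w (frob (xhat t.+1 w - x t w) ^+ 2)%:E)%E.

Lemma error_F_init : (error_F 0 <= (sigma_F ^+ 2 / b0%:R)%:E)%E.
Proof.
have [s0 _ _ _ _ _ _] := B_sampling.
have := initial_error F_reg x0_dom b0_gt0 s0.
rewrite /error_F => /(le_trans _); apply; apply: ge0_integral_monotone => w.
  by rewrite lee_fin sqr_ge0.
by rewrite (run_F0 run) (run_x0 run).
Qed.

Lemma error_J_init : (error_J 0 <= (sigma_J ^+ 2 / hb0%:R)%:E)%E.
Proof.
have [_ s0 _ _ _ _ _] := B_sampling.
have := initial_error J_reg x0_dom hb0_gt0 s0.
rewrite /error_J => /(le_trans _); apply; apply: ge0_integral_monotone => w.
  by rewrite lee_fin sqr_ge0.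
by rewrite (run_J0 run) (run_x0 run).
Qed.

Lemma move_scaled t : (t <= T)%N ->
  (\int[P]_w (frob (x t.+1 w - x t w) ^+ 2)%:E
   = (theta t ^+ 2)%:E * move_size t)%E.
Proof.
move=> tT; have [mx _ _ _] := run_adapted tT.
have [mxh _ _] := run_adapted_next tT.
have mS : forall X, history t.+1 X -> measurable_fun setT X.
  by move=> X; exact: history_measurable.
rewrite -(past_integral_sqfrob P mS (sqr_ge0 (theta t))); last first.
  by apply: mxmeasurableB => //; exact: past_mxmeasurable_sub (@historyS t) mx.
apply: eq_integral => w _; rewrite (run_x run) //.
have -> : (1 - theta t) *: x t w + theta t *: xhat t.+1 w - x t w =
    theta t *: (xhat t.+1 w - x t w).
  by apply/matrixP => i j; rewrite !mxE; ring.
by rewrite frobZ exprMn real_normK ?num_real.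
Qed.

Variables kF kJ : R.
Hypothesis kFP : forall t : nat, (1 <= t <= T)%N ->
  kF = 1 /\ independent_events P (sigma_of (range (B1 B t))) (sigma_of (range (B2 B t)))
  \/ kF = 2.
Hypothesis kJP : forall t : nat, (1 <= t <= T)%N ->
  kJ = 1 /\ independent_events P (sigma_of (range (hB1 B t))) (sigma_of (range (hB2 B t)))
  \/ kJ = 2.

Lemma error_F_step t : (t < T)%N ->
  (error_F t.+1 <= (beta t ^+ 2)%:E * error_F t
    + (kF * beta t ^+ 2 * M_F ^+ 2 / b1%:R)%:E
      * ((theta t ^+ 2)%:E * move_size t)
    + (kF * (1 - beta t) ^+ 2 * sigma_F ^+ 2 / b2%:R)%:E)%E.
Proof.
move=> tT; have [mx dx mFt _] := run_adapted (ltnW tT).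
have [_ mxS dxS] := run_adapted_next (ltnW tT).
have mS : forall X, history t.+1 X -> measurable_fun setT X.
  by move=> X; apply: history_measurable; exact: ltnW.
have [_ _ s1 _ s2 _ _] := B_sampling.
rewrite -(move_scaled (ltnW tT)) /error_F.
have ind : independent_events P
    (sigma_of (range (B1 B t.+1) `|` range (B2 B t.+1)))
    (sigma_of (history t.+1)).
  apply: (independent_events_sub _ (@subset_refl _ _) (draws_history tT)).
  by apply: sigma_of_sub => X [] [i _ <-]; [left; left; left|left; right]; exists i.
have mx' := past_mxmeasurable_sub (@historyS t) mx.
apply: le_trans (hybrid_error F_reg mS (beta t) b1_gt0 b2_gt0
  (s1 t.+1 tT) (s2 t.+1 tT) ind (@kFP t.+1 tT) mFt mx' mxS dx dxS).
apply: ge0_integral_monotone => w; first by rewrite lee_fin sqr_ge0.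
by rewrite (run_F run w tT).
Qed.

Lemma error_J_step t : (t < T)%N ->
  (error_J t.+1 <= (beta t ^+ 2)%:E * error_J t
    + (kJ * beta t ^+ 2 * L_F ^+ 2 / hb1%:R)%:E
      * ((theta t ^+ 2)%:E * move_size t)
    + (kJ * (1 - beta t) ^+ 2 * sigma_J ^+ 2 / hb2%:R)%:E)%E.
Proof.
move=> tT; have [mx dx _ mJt] := run_adapted (ltnW tT).
have [_ mxS dxS] := run_adapted_next (ltnW tT).
have mS : forall X, history t.+1 X -> measurable_fun setT X.
  by move=> X; apply: history_measurable; exact: ltnW.
have [_ _ _ s1 _ s2 _] := B_sampling.
rewrite -(move_scaled (ltnW tT)) /error_J.
have ind : independent_events P
    (sigma_of (range (hB1 B t.+1) `|` range (hB2 B t.+1)))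
    (sigma_of (history t.+1)).
  apply: (independent_events_sub _ (@subset_refl _ _) (draws_history tT)).
  by apply: sigma_of_sub => X [] [i _ <-]; [left; left; right|right]; exists i.
have mx' := past_mxmeasurable_sub (@historyS t) mx.
apply: le_trans (hybrid_error J_reg mS (beta t) hb1_gt0 hb2_gt0
  (s1 t.+1 tT) (s2 t.+1 tT) ind (@kJP t.+1 tT) mJt mx' mxS dx dxS).
apply: ge0_integral_monotone => w; first by rewrite lee_fin sqr_ge0.
by rewrite (run_J run w tT).
Qed.

End Run.

(** * Finiteness of the moments *)

Section ExtendedRecursion.
Variables (R : realType) (L cP Q B hb D0 : R) (T : nat).
Let theta t := L * Num.sqrt B / (cP * cbrt R t).
Let beta t : R := 1 - 1 / cbrt R t ^+ 2.
Hypotheses (L_gt0 : 0 < L) (cP_gt0 : 0 < cP) (Q_ge0 : 0 <= Q).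
Hypotheses (B_gt0 : 0 < B) (hb_gt0 : 0 < hb) (D0_ge0 : 0 <= D0).
Variables (g d e : nat -> \bar R).
Hypotheses (g_ge0 : forall t, (0 <= g t)%E) (d_ge0 : forall t, (0 <= d t)%E).
Hypothesis e_ge0 : forall t, (0 <= e t)%E.
Hypothesis descent_sum : forall N, (N <= T.+1)%N ->
  (\sum_(0 <= t < N) ((theta t / (16 * L))%:E * g t + (theta t * L)%:E * d t)
   <= D0%:E + \sum_(0 <= t < N) (13 / 8 * (theta t / L))%:E * e t)%E.
Hypothesis error_rec : forall t, (t < T)%N ->
  (e t.+1 <= (beta t ^+ 2)%:E * e t
    + (beta t ^+ 2 * (9 * cP ^+ 2 / (13 * B)))%:E * ((theta t ^+ 2)%:E * d t)
    + ((1 - beta t) ^+ 2 * (9 * Q / (13 * B)))%:E)%E.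
Hypothesis error_init : (e 0 <= (9 * Q / (13 * hb))%:E)%E.

Let theta_gt0 t : 0 < theta t.
Proof. by rewrite divr_gt0 // mulr_gt0 // ?cbrt_gt0 // sqrtr_gt0. Qed.

Let g_weight_gt0 t : 0 < theta t / (16 * L).
Proof. by rewrite divr_gt0 // mulr_gt0. Qed.

Let d_weight_gt0 t : 0 < theta t * L.
Proof. by rewrite mulr_gt0. Qed.

Let g_term_ge0 t : (0 <= (theta t / (16 * L))%:E * g t)%E.
Proof. by apply: mule_ge0 => //; rewrite lee_fin ltW. Qed.

Let d_term_ge0 t : (0 <= (theta t * L)%:E * d t)%E.
Proof. by apply: mule_ge0 => //; rewrite lee_fin ltW. Qed.

(** The descent inequality makes the move finite once the errors are, and the
error recursion makes the next error finite once the move is. *)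
Lemma moments_finite t : (t <= T)%N ->
  [/\ e t \is a fin_num, d t \is a fin_num & g t \is a fin_num].
Proof.
have dg_fin N : (N <= T)%N -> (forall s, (s <= N)%N -> e s \is a fin_num) ->
    d N \is a fin_num /\ g N \is a fin_num.
  move=> NT efin; have := descent_sum (N := N.+1) NT.
  rewrite big_nat_recr //= => h.
  have eS : (\sum_(0 <= t < N.+1) (13 / 8 * (theta t / L))%:E * e t)%E
      \is a fin_num.
    rewrite big_nat; apply/sum_fin_numP => s _ sN.
    by rewrite fin_numM // efin.
  have dN : (((theta N / (16 * L))%:E * g N + (theta N * L)%:E * d N) < +oo)%E.
    apply: le_lt_trans (le_trans _ h) _; last by rewrite ltey_eq fin_numD eS.
    rewrite leeDr // big_nat sume_ge0 // => s _.
    exact: adde_ge0.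
  have pos (a : R) (y : \bar R) : 0 < a -> (0 <= y)%E -> (a%:E * y < +oo)%E ->
      y \is a fin_num.
    by move=> a0; case: y => [y| |] //; rewrite gt0_muley ?lte_fin.
  split; [apply: (pos (theta N * L))|apply: (pos (theta N / (16 * L)))] => //.
  - by apply: le_lt_trans dN; exact: leeDr.
  - by apply: le_lt_trans dN; exact: leeDl.
suff efin : forall N, (N <= T)%N -> forall s, (s <= N)%N -> e s \is a fin_num.
  by move=> tT; have [] := dg_fin t tT (efin t tT); split => //; exact: (efin t).
elim=> [_ s|N IHN NT s].
  rewrite leqn0 => /eqP ->; rewrite ge0_fin_numE //.
  exact: le_lt_trans error_init (ltry _).
rewrite leq_eqVlt => /orP[/eqP ->|]; last by rewrite ltnS; apply: IHN; exact: ltnW.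
have efin := IHN (ltnW NT); have [dfin _] := dg_fin N (ltnW NT) efin.
rewrite ge0_fin_numE //; apply: le_lt_trans (error_rec NT) _.
by rewrite ltey_eq !fin_numD !fin_numM // efin.
Qed.

Lemma extended_average_rate (Delta := cbrt R T.+1 ^+ 2 - cbrt R 0 ^+ 2) :
  (\sum_(0 <= t < T.+1) (theta t / \sum_(0 <= s < T.+1) theta s)%:E * g t <=
   (32 * cP / (3 * Num.sqrt B * Delta) * D0
    + 32 * Q / (3 * Delta) * (cbrt R 0 / hb + 2 * (1 + ln T.+1%:R) / B))%:E)%E.
Proof.
have fg t : (t <= T)%N -> g t = (fine (g t))%:E.
  by move=> tT; have [_ _ /fineK] := moments_finite tT.
have fd t : (t <= T)%N -> d t = (fine (d t))%:E.
  by move=> tT; have [_ /fineK] := moments_finite tT.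
have fe t : (t <= T)%N -> e t = (fine (e t))%:E.
  by move=> tT; have [/fineK] := moments_finite tT.
have h := @average_rate R L cP Q B hb D0 T (fine \o g) (fine \o d) (fine \o e)
  L_gt0 cP_gt0 Q_ge0 B_gt0 hb_gt0 D0_ge0 _ _ _ _ _ _ erefl.
apply: le_trans (_ : _ <= (\sum_(0 <= t < T.+1)
    theta t * (fine (g t)) / \sum_(0 <= s < T.+1) theta s)%:E)%E _.
  rewrite -sumEFin le_eqVlt; apply/orP; left; apply/eqP.
  apply: eq_big_nat => t /andP[_ tT].
  by rewrite [in LHS]fg // -EFinM mulrAC.
rewrite lee_fin -mulr_suml; apply: h => [t|t|||].
- by rewrite /= fine_ge0.
- by rewrite /= fine_ge0.
- rewrite -lee_fin EFinD -!sumEFin.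
  apply: le_trans (_ : _ <= _)%E (le_trans (descent_sum (leqnn _)) _).
    rewrite le_eqVlt; apply/orP; left; apply/eqP.
    by apply: eq_big_nat => t /andP[_ tT]; rewrite /= fg // fd.
  rewrite leeD2l // le_eqVlt; apply/orP; left; apply/eqP.
  by apply: eq_big_nat => t /andP[_ tT]; rewrite fe.
- move=> t tT; rewrite -lee_fin /= -fe // -/(beta t) -/(theta t).
  rewrite !EFinD; apply: le_trans (error_rec tT) _.
  rewrite (fe t (ltnW tT)) (fd t (ltnW tT)) -!EFinM !mulrA //.
- by rewrite -lee_fin /= -fe.
Qed.

End ExtendedRecursion.

(** * Convergence of the algorithm *)

Section Telescope.
Variables (R : realType) (p q n : nat) (K : 'M[R]_(q, n)).
Variables (psi : 'cV[R]_n -> \bar R) (Rg : 'cV[R]_p -> \bar R).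
Variables (G : 'cV[R]_p -> 'cV[R]_q) (L_F M_F M_psi : R).
Hypothesis psi_proper : proper_efun psi.
Hypothesis psi_lsc : lower_semicontinuous psi.
Hypothesis psi_sconvex : strongly_convex 1 psi.
Hypothesis psi_bounded : forall y, edom psi y -> frob y <= M_psi.
Hypothesis Rg_proper : proper_efun Rg.
Hypothesis Rg_lsc : lower_semicontinuous Rg.
Hypothesis Rg_convex : convex_efun Rg.
Hypothesis G_diff : forall x, differentiable G x.
Hypothesis M_F_ge0 : 0 <= M_F.
Hypothesis G_jac_bounded : forall x, edom Rg x -> frob (jac G x) <= M_F.
Hypothesis G_jac_lipschitz : forall x y, edom Rg x -> edom Rg y ->
  frob (jac G x - jac G y) <= L_F * frob (x - y).

Variable L : R.
Hypothesis LE : L = constLPhi (specnorm K) L_F M_F M_psi.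
Hypothesis L_gt0 : 0 < L.
Variables (T : nat) (theta eta : nat -> R) (x v xhat : nat -> 'cV[R]_p).
Hypothesis theta01 : forall t, (t <= T)%N -> 0 < theta t <= 1.
Hypothesis etaE : forall t, eta t = 2 / (L * (3 + theta t)).
Hypothesis x0_dom : edom Rg (x 0).
Hypothesis xhatE : forall t, (t <= T)%N ->
  xhat t.+1 = prox (fun z => ((eta t)%:E * Rg z)%E) (x t - eta t *: v t).
Hypothesis xE : forall t, (t <= T)%N ->
  x t.+1 = (1 - theta t) *: x t + theta t *: xhat t.+1.

Let Phi z : R := fine (phi0 K psi (G z)).
Let obj z := Phi z + fine (Rg z).
Let gmap t := (eta t)^-1 *: (x t - prox (fun z => ((eta t)%:E * Rg z)%E)
                                        (x t - eta t *: grad Phi (x t))).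

(** The one-step inequality is summed along each path before any expectation is
taken, so the values of the objective along the run are never integrated. *)
Lemma telescoped_descent N : (N <= T.+1)%N ->
  edom Rg (x N) /\
  obj (x N) + \sum_(0 <= t < N) (theta t / (16 * L) * frob (gmap t) ^+ 2
      + theta t * L * frob (xhat t.+1 - x t) ^+ 2)
  <= obj (x 0) + \sum_(0 <= t < N)
       13 / 8 * (theta t / L) * frob (grad Phi (x t) - v t) ^+ 2.
Proof.
elim: N => [_|N IHN NT]; first by rewrite !big_geq.
have [dN hN] := IHN (ltnW NT).
have L_gt0' : 0 < constLPhi (specnorm K) L_F M_F M_psi by rewrite -LE.
have etaE' : eta N = 2 / (constLPhi (specnorm K) L_F M_F M_psi * (3 + theta N)).
  by rewrite -LE etaE.
have dS := xplus_dom Rg_proper Rg_lsc Rg_convex L_gt0' (theta01 NT) etaE' dN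
  (xhatE NT) (xE NT).
have := one_step psi_proper psi_lsc psi_sconvex psi_bounded Rg_proper Rg_lsc
  Rg_convex G_diff M_F_ge0 G_jac_bounded G_jac_lipschitz L_gt0' (theta01 NT)
  etaE' dN (xhatE NT) (xE NT).
rewrite -LE => hS; split => //; move: hN hS; rewrite !big_nat_recr //=.
rewrite /obj /Phi /gmap; lra.
Qed.

End Telescope.

Lemma sqr_add_le2 (R : realType) (a b c : R) : 0 <= a -> a <= b + c ->
  a ^+ 2 <= 2 * b ^+ 2 + 2 * c ^+ 2.
Proof.
move=> a0 abc; apply: (@le_trans _ _ ((b + c) ^+ 2)).
  by rewrite ler_sqr ?nnegrE // (le_trans a0).
have := sqr_ge0 (b - c); rewrite sqrrB sqrrD; lra.
Qed.

(** Both estimators contract at the same rate, so any nonnegative combination of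
their errors obeys a recursion of the same form. *)
Lemma weighted_recursion (R : realType) (a1 a2 r c1 c2 s1 s2 : R)
    (f f' j j' y : \bar R) :
  0 <= a1 -> 0 <= a2 -> 0 <= r -> 0 <= c1 -> 0 <= c2 -> 0 <= s1 -> 0 <= s2 ->
  (0 <= f)%E -> (0 <= j)%E -> (0 <= y)%E ->
  (f' <= r%:E * f + c1%:E * y + s1%:E)%E ->
  (j' <= r%:E * j + c2%:E * y + s2%:E)%E ->
  (a1%:E * f' + a2%:E * j' <=
   r%:E * (a1%:E * f + a2%:E * j) + (a1 * c1 + a2 * c2)%:E * y
   + (a1 * s1 + a2 * s2)%:E)%E.
Proof.
move=> a1_ge0 a2_ge0 r_ge0 c1_ge0 c2_ge0 s1_ge0 s2_ge0 f_ge0 j_ge0 y_ge0 hf hj.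
have dist (a c s : R) (g : \bar R) : 0 <= a -> 0 <= c -> 0 <= s -> (0 <= g)%E ->
    (a%:E * (r%:E * g + c%:E * y + s%:E) =
     r%:E * (a%:E * g) + (a * c)%:E * y + (a * s)%:E)%E.
  move=> a_ge0 c_ge0 s_ge0 g_ge0.
  by rewrite !ge0_muleDr ?adde_ge0 ?mule_ge0 ?lee_fin // muleCA !muleA -!EFinM.
apply: le_trans (leeD (lee_wpmul2l _ hf) (lee_wpmul2l _ hj)) _;
  rewrite ?lee_fin //.
rewrite !dist // [(a1 * c1 + _)%:E]EFinD [(a1 * s1 + _)%:E]EFinD.
rewrite [(r%:E * (_ + _))%E]ge0_muleDr ?mule_ge0 ?lee_fin //.
rewrite ge0_muleDl ?lee_fin ?mulr_ge0 //.
by rewrite addeACA; apply: leeD => //; rewrite addeACA.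
Qed.

Section Constants.
Variables (R : realType) (c0 nK kF kJ L_F M_F M_psi sigma_F sigma_J : R).
Hypotheses (c0_gt0 : 0 < c0) (nK_ge0 : 0 <= nK) (kF_ge1 : 1 <= kF).
Hypotheses (kJ_ge1 : 1 <= kJ) (L_F_ge0 : 0 <= L_F) (M_F_ge0 : 0 <= M_F).
Hypothesis M_psi_ge0 : 0 <= M_psi.

Let kF_ge0 : 0 <= kF. Proof. exact: le_trans kF_ge1. Qed.
Let kJ_ge0 : 0 <= kJ. Proof. exact: le_trans kJ_ge1. Qed.

Lemma constP_ge0 : 0 <= constP c0 nK kF kJ L_F M_F M_psi.
Proof. by rewrite !mulr_ge0 ?invr_ge0 ?mulr_ge0 ?sqrtr_ge0. Qed.

Lemma constP_sqr : constP c0 nK kF kJ L_F M_F M_psi ^+ 2 =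
  26 * nK ^+ 2 / (9 * c0) *
  (kF * M_F ^+ 4 * nK ^+ 2 + c0 * kJ * L_F ^+ 2 * M_psi ^+ 2).
Proof.
have s_ge0 : 0 <= kF * M_F ^+ 4 * nK ^+ 2 + c0 * kJ * L_F ^+ 2 * M_psi ^+ 2.
  by rewrite addr_ge0 // !mulr_ge0 ?exprn_ge0 // ltW.
rewrite /constP exprMn sqr_sqrtr //; congr (_ * _).
rewrite !exprMn sqr_sqrtr // exprVn exprMn sqr_sqrtr ?ltW //.
by field; rewrite gt_eqF.
Qed.

Lemma constQ_ge0 : 0 <= constQ c0 nK kF kJ M_F M_psi sigma_F sigma_J.
Proof.
have c0_ge0 := ltW c0_gt0.
apply: mulr_ge0.
  by rewrite mulr_ge0 ?sqr_ge0 // divr_ge0 // mulr_ge0.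
by apply: addr_ge0; do ?[by [] | exact: sqr_ge0 | apply: mulr_ge0].
Qed.

(** The weights [2 M_F^2 |K|^4] and [2 |K|^2 M_psi^2] are those of the squared
gradient error bound; they turn the sampling constants of the two estimators
into multiples of [P^2] and [Q]. *)
Lemma constP_weights r b : 0 < b ->
  2 * M_F ^+ 2 * nK ^+ 4 * (kF * r * M_F ^+ 2 / (c0 * b))
    + 2 * nK ^+ 2 * M_psi ^+ 2 * (kJ * r * L_F ^+ 2 / b) =
  r * (9 * constP c0 nK kF kJ L_F M_F M_psi ^+ 2 / (13 * b)).
Proof. by move=> b_gt0; rewrite constP_sqr; field; rewrite !gt_eqF. Qed.

Lemma constQ_weights r b : 0 < b ->
  2 * M_F ^+ 2 * nK ^+ 4 * (kF * r * sigma_F ^+ 2 / (c0 * b))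
    + 2 * nK ^+ 2 * M_psi ^+ 2 * (kJ * r * sigma_J ^+ 2 / b) =
  r * (9 * constQ c0 nK kF kJ M_F M_psi sigma_F sigma_J / (13 * b)).
Proof. by move=> b_gt0; rewrite /constQ; field; rewrite !gt_eqF. Qed.

Lemma constQ_weights_init b : 0 < b ->
  2 * M_F ^+ 2 * nK ^+ 4 * (sigma_F ^+ 2 / (c0 * b))
    + 2 * nK ^+ 2 * M_psi ^+ 2 * (sigma_J ^+ 2 / b) <=
  9 * constQ c0 nK kF kJ M_F M_psi sigma_F sigma_J / (13 * b).
Proof.
move=> b_gt0; have := constQ_weights 1 b_gt0; rewrite mul1r => <-.
have k (a s c : R) : 0 <= a -> 0 <= s -> 1 <= c -> a * s <= a * (c * s).
  by move=> a0 s0 c1; rewrite ler_wpM2l // ler_peMl.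
rewrite !mulr1 -!(mulrA kF) -!(mulrA kJ); apply: lerD; apply: k => //.
- by rewrite !mulr_ge0 // exprn_ge0.
- by rewrite divr_ge0 ?sqr_ge0 // mulr_ge0 // ltW.
- by rewrite !mulr_ge0 // exprn_ge0.
- by rewrite divr_ge0 ?sqr_ge0 // ltW.
Qed.

End Constants.

Section Convergence.
Context d (Xi : measurableType d) (R : realType) (Q : probability Xi R).
Context d' (W : measurableType d') (P : probability W R).
Variables (p q n : nat) (F : 'cV[R]_p -> Xi -> 'cV[R]_q) (K : 'M[R]_(q, n)).
Variables (psi : 'cV[R]_n -> \bar R) (Rg : 'cV[R]_p -> \bar R).
Variables (L_F M_F M_psi sigma_F sigma_J c0 kF kJ : R).
Hypothesis psi_proper : proper_efun psi.
Hypothesis psi_lsc : lower_semicontinuous psi.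
Hypothesis psi_sconvex : strongly_convex 1 psi.
Hypothesis psi_bounded : forall y, edom psi y -> frob y <= M_psi.
Hypothesis Rg_proper : proper_efun Rg.
Hypothesis Rg_lsc : lower_semicontinuous Rg.
Hypothesis Rg_convex : convex_efun Rg.
Hypotheses (L_F_ge0 : 0 <= L_F) (M_F_ge0 : 0 <= M_F) (M_psi_ge0 : 0 <= M_psi).
Hypotheses (c0_gt0 : 0 < c0) (kF_ge1 : 1 <= kF) (kJ_ge1 : 1 <= kJ).
Hypothesis F_reg : mean_square_regular Q F (edom Rg) M_F sigma_F.
Hypothesis J_reg : mean_square_regular Q (Fjac F) (edom Rg) L_F sigma_J.
Local Notation G := (Fmean Q F).
Hypothesis G_diff : forall x, differentiable G x.
Hypothesis G_jac : forall x, jac G x = expect_mx Q (Fjac F x).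
Hypothesis G_jac_bounded : forall x, edom Rg x -> frob (jac G x) <= M_F.
Hypothesis G_jac_lipschitz : forall x y, edom Rg x -> edom Rg y ->
  frob (jac G x - jac G y) <= L_F * frob (x - y).

Variables (b0 hb0 b1 b2 b : nat).
Hypotheses (b_gt0 : (0 < b)%N) (hb0_gt0 : (0 < hb0)%N).
Hypothesis b0E : b0%:R = c0 * hb0%:R.
Hypotheses (b1E : b1%:R = c0 * b%:R) (b2E : b2%:R = c0 * b%:R).
Variables (B : minibatches W Xi b0 hb0 b1 b b2 b) (T : nat).
Hypothesis B_sampling : sampling P Q B T.
Hypothesis kFP : forall t : nat, (1 <= t <= T)%N ->
  kF = 1 /\ independent_events P (sigma_of (range (B1 B t))) (sigma_of (range (B2 B t)))
  \/ kF = 2.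
Hypothesis kJP : forall t : nat, (1 <= t <= T)%N ->
  kJ = 1 /\ independent_events P (sigma_of (range (hB1 B t))) (sigma_of (range (hB2 B t)))
  \/ kJ = 2.

Variables (L cP cQ : R).
Hypothesis LE : L = constLPhi (specnorm K) L_F M_F M_psi.
Hypothesis cPE : cP = constP c0 (specnorm K) kF kJ L_F M_F M_psi.
Hypothesis cQE : cQ = constQ c0 (specnorm K) kF kJ M_F M_psi sigma_F sigma_J.
Hypotheses (L_gt0 : 0 < L) (cP_gt0 : 0 < cP).
Variables (beta theta eta : nat -> R) (x0 : 'cV[R]_p).
Hypothesis betaE : forall t, beta t = 1 - 1 / cbrt R t ^+ 2.
Hypothesis thetaE : forall t, theta t = L * Num.sqrt b%:R / (cP * cbrt R t).
Hypothesis etaE : forall t, eta t = 2 / (L * (3 + theta t)).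
Hypothesis theta01 : forall t, (t <= T)%N -> 0 < theta t <= 1.
Hypothesis x0_dom : edom Rg x0.
Variables (Ft : nat -> W -> 'cV[R]_q) (Jt : nat -> W -> 'M[R]_(q, p)).
Variables (v xhat x : nat -> W -> 'cV[R]_p).
Hypothesis run : hybrid_run F K psi Rg B beta beta theta eta x0 T Ft Jt v xhat x.
Variable Dstar : R.
Hypothesis Dstar_le : forall y, edom Rg y -> Dstar <= Phi0 Q F K psi y + fine (Rg y).

Let natr_gt0 m (c : R) : 0 < c -> m%:R = c -> (0 < m)%N.
Proof. by move=> c0' mc; rewrite -(ltr_nat R) mc. Qed.

Let bR : 0 < b%:R :> R. Proof. by rewrite ltr0n. Qed.
Let hb0R : 0 < hb0%:R :> R. Proof. by rewrite ltr0n. Qed.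
Let b0_gt0 : (0 < b0)%N. Proof. by apply: natr_gt0 b0E; rewrite mulr_gt0. Qed.
Let b1_gt0 : (0 < b1)%N. Proof. by apply: natr_gt0 b1E; rewrite mulr_gt0. Qed.
Let b2_gt0 : (0 < b2)%N. Proof. by apply: natr_gt0 b2E; rewrite mulr_gt0. Qed.

Let eta_gt0 t : (t <= T)%N -> 0 < eta t.
Proof.
move=> tT; rewrite etaE divr_gt0 // mulr_gt0 // addr_gt0 //.
by have /andP[] := theta01 tT.
Qed.

Let adapted t (tT : (t <= T)%N) := run_adapted psi_proper psi_lsc psi_sconvex
  Rg_proper Rg_lsc Rg_convex F_reg J_reg x0_dom run theta01 eta_gt0 tT.
Let adapted_next t (tT : (t <= T)%N) := run_adapted_next psi_proper psi_lsc
  psi_sconvex Rg_proper Rg_lsc Rg_convex F_reg J_reg x0_dom run theta01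
  eta_gt0 tT.

Let past_measurable t k l (X : past (history B t) -> 'M[R]_(k, l)) :
  (t <= T.+1)%N -> mxmeasurable X ->
  measurable_fun setT (fun w : W => frob (X w) ^+ 2).
Proof.
move=> tT mX; apply/measurable_EFinP; apply: past_sqfrob_measurable mX.
by move=> Y; apply: (history_measurable B_sampling tT).
Qed.

Local Notation gmap t w := (grad_map Q F K psi Rg (eta t) (x t w)).

Lemma grad_map_adapted t : (t <= T)%N ->
  mxmeasurable (fun w : past (history B t) => gmap t w).
Proof.
move=> tT; have [mx _ _ _] := adapted tT.
apply: mxmeasurableZ; apply: mxmeasurableB => //.
apply: mxmeasurable_continuous.
  by apply: prox_scaled_continuous => //; exact: eta_gt0.
apply: mxmeasurableB => //; apply: mxmeasurableZ.
apply: mxmeasurable_eq => [w|].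
  exact: (grad_PhiE K psi_proper psi_lsc psi_sconvex G_diff (x t w)).
apply: mxmeasurable_mulmx.
  apply: mxmeasurable_tr; under eq_fun do rewrite G_jac.
  by have [_ mJ _ _ _] := J_reg; exact: mJ.
apply: mxmeasurable_mulmx; first exact: mxmeasurable_cst.
apply: mxmeasurable_continuous.
  by apply: y0star_continuous.
by have [_ mF _ _ _] := F_reg; exact: mF.
Qed.

Let nK := specnorm K.
Let a1 : R := 2 * M_F ^+ 2 * nK ^+ 4.
Let a2 : R := 2 * nK ^+ 2 * M_psi ^+ 2.

Let a1_ge0 : 0 <= a1.
Proof.
have nK_ge0 : 0 <= nK := specnorm_ge0 K.
by apply: mulr_ge0; [rewrite mulr_ge0 ?sqr_ge0|exact: exprn_ge0].
Qed.

Let a2_ge0 : 0 <= a2.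
Proof. by apply: mulr_ge0; [rewrite mulr_ge0 ?sqr_ge0|exact: sqr_ge0]. Qed.

Let sqerr_F t w : R := frob (Ft t w - G (x t w)) ^+ 2.
Let sqerr_J t w : R := frob (Jt t w - expect_mx Q (Fjac F (x t w))) ^+ 2.
Let sqerr t w : R := a1 * sqerr_F t w + a2 * sqerr_J t w.

Lemma gradient_sqerr_le t w : (t <= T)%N ->
  frob (grad (Phi0 Q F K psi) (x t w) - v t w) ^+ 2 <= sqerr t w.
Proof.
move=> tT; have [_ dx _ _] := adapted tT.
have := grad_estimator_error K psi_proper psi_lsc psi_sconvex psi_bounded G_diff
  G_jac_bounded (Ft t w) (Jt t w) (dx w).
move/(sqr_add_le2 (frob_ge0 _)); rewrite (run_v run w tT) => /le_trans; apply.
rewrite (frobBC (G _)) (frobBC (jac _ _)) G_jac.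
rewrite /sqerr /sqerr_F /sqerr_J /a1 /a2 -/nK.
move: (frob (Ft t w - _)) (frob (Jt t w - _)) => f j.
by rewrite le_eqVlt; apply/orP; left; apply/eqP; ring.
Qed.

Let mean_sqerr t : \bar R :=
  (a1%:E * error_F Q P F Ft x t + a2%:E * error_J Q P F Jt x t)%E.

Let sqerr_F_measurable t : (t <= T)%N -> measurable_fun setT (sqerr_F t).
Proof.
move=> tT; have [mx _ mF _] := adapted tT; have [_ mG _ _ _] := F_reg.
apply: (past_measurable (t := t.+1)) => //; apply: mxmeasurableB => //.
by apply: mG; exact: past_mxmeasurable_sub (@historyS _ _ _ _ _ _ _ _ _ _ B t) mx.
Qed.

Let sqerr_J_measurable t : (t <= T)%N -> measurable_fun setT (sqerr_J t).
Proof.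
move=> tT; have [mx _ _ mJ] := adapted tT; have [_ mG _ _ _] := J_reg.
apply: (past_measurable (t := t.+1)) => //; apply: mxmeasurableB => //.
by apply: mG; exact: past_mxmeasurable_sub (@historyS _ _ _ _ _ _ _ _ _ _ B t) mx.
Qed.

Let sqerr_measurable t : (t <= T)%N -> measurable_fun setT (sqerr t).
Proof.
move=> tT; apply: measurable_funD; apply: measurable_funM => //.
  exact: sqerr_F_measurable.
exact: sqerr_J_measurable.
Qed.

Let sqerr_ge0 t w : 0 <= sqerr t w.
Proof. by rewrite addr_ge0 // mulr_ge0 // sqr_ge0. Qed.

Let integral_sqerr t : (t <= T)%N ->
  (\int[P]_w (sqerr t w)%:E = mean_sqerr t)%E.
Proof.
move=> tT; have mF := sqerr_F_measurable tT; have mJ := sqerr_J_measurable tT.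
have Z (a : R) (f : W -> R) : 0 <= a -> measurable_fun setT f ->
    (forall w, 0 <= f w) ->
    (\int[P]_w (a * f w)%:E = a%:E * \int[P]_w (f w)%:E)%E.
  move=> a_ge0 mf f_ge0; under eq_integral do rewrite EFinM.
  by rewrite ge0_integralZl //; [exact/measurable_EFinP|move=> w _; rewrite lee_fin].
under eq_integral do rewrite EFinD; rewrite ge0_integralD //=.
- rewrite !Z // => w; exact: sqr_ge0.
- by move=> w _; rewrite lee_fin mulr_ge0 // sqr_ge0.
- by apply/measurable_EFinP; exact: measurable_funM.
- by move=> w _; rewrite lee_fin mulr_ge0 // sqr_ge0.
- by apply/measurable_EFinP; exact: measurable_funM.
Qed.

Let D0 : R := Phi0 Q F K psi x0 + fine (Rg x0) - Dstar.
Let sqgrad t w : R := frob (gmap t w) ^+ 2.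
Let sqmove t w : R := frob (xhat t.+1 w - x t w) ^+ 2.

Lemma run_descent N w : (N <= T.+1)%N ->
  \sum_(0 <= t < N) theta t / (16 * L) * sqgrad t w
    + \sum_(0 <= t < N) theta t * L * sqmove t w
  <= D0 + \sum_(0 <= t < N) 13 / 8 * (theta t / L) * sqerr t w.
Proof.
move=> NT; have x0w : x 0%N w = x0 := run_x0 run w.
have x0w_dom : edom Rg (x 0%N w) by rewrite x0w.
have [dN] := telescoped_descent (x := x ^~ w) (v := v ^~ w) (xhat := xhat ^~ w)
  psi_proper psi_lsc psi_sconvex psi_bounded Rg_proper Rg_lsc Rg_convex G_diff
  M_F_ge0 G_jac_bounded G_jac_lipschitz LE L_gt0 theta01 etaE x0w_dom
  (fun t tT => run_xhat run w tT) (fun t tT => run_x run w tT) NT.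
rewrite big_split /= x0w; have := Dstar_le dN; rewrite /D0 /Phi0.
have hs : \sum_(0 <= t < N) 13 / 8 * (theta t / L)
      * frob (grad (Phi0 Q F K psi) (x t w) - v t w) ^+ 2
    <= \sum_(0 <= t < N) 13 / 8 * (theta t / L) * sqerr t w.
  apply: ler_sum_nat => t /andP[_ tN].
  have tT : (t <= T)%N by rewrite -ltnS; exact: leq_trans NT.
  apply: ler_wpM2l (gradient_sqerr_le w tT).
  have /andP[th _] := theta01 tT.
  by rewrite mulr_ge0 // divr_ge0 // ltW.
move=> h1 h2; have {}h2 := le_trans h2 (lerD (lexx _) hs); move: h1 h2.
rewrite /sqgrad /sqmove /grad_map /Phi0.
set S1 := \sum_(0 <= t < N) _; set S2 := \sum_(0 <= t < N) _.
set S3 := \sum_(0 <= t < N) _; move: S1 S2 S3 => S1 S2 S3; lra.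
Qed.

Let sqgrad_measurable t : (t <= T)%N -> measurable_fun setT (sqgrad t).
Proof.
move=> tT; apply: (past_measurable (t := t)); first exact: leqW.
exact: grad_map_adapted.
Qed.

Let sqmove_measurable t : (t <= T)%N -> measurable_fun setT (sqmove t).
Proof.
move=> tT; have [mx _ _ _] := adapted tT; have [mxh _ _] := adapted_next tT.
apply: (past_measurable (t := t.+1)) => //; apply: mxmeasurableB => //.
exact: past_mxmeasurable_sub (@historyS _ _ _ _ _ _ _ _ _ _ B t) mx.
Qed.

Let mean_sqgrad t : \bar R := (\int[P]_w (sqgrad t w)%:E)%E.

Let D0_ge0 : 0 <= D0.
Proof. by rewrite subr_ge0 Dstar_le. Qed.

Lemma expected_descent N : (N <= T.+1)%N ->
  (\sum_(0 <= t < N) ((theta t / (16 * L))%:E * mean_sqgrad t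
     + (theta t * L)%:E * move_size P xhat x t)
   <= D0%:E + \sum_(0 <= t < N) (13 / 8 * (theta t / L))%:E * mean_sqerr t)%E.
Proof.
move=> NT; have tNT t : (t < N)%N -> (t <= T)%N.
  by move=> tN; rewrite -ltnS; exact: leq_trans NT.
have th t : (t < N)%N -> 0 <= theta t.
  by move=> /tNT tT; have /andP[/ltW] := theta01 tT.
have L_ge0 := ltW L_gt0.
have c1 t : (t < N)%N -> 0 <= theta t / (16 * L).
  by move=> /th h; rewrite divr_ge0 // mulr_ge0.
have c2 t : (t < N)%N -> 0 <= theta t * L by move=> /th h; rewrite mulr_ge0.
have c3 t : (t < N)%N -> 0 <= 13 / 8 * (theta t / L).
  by move=> /th h; rewrite mulr_ge0 // divr_ge0.
have wsum (c : nat -> R) (f : nat -> W -> R) :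
    (forall t, (t < N)%N -> 0 <= c t) -> (forall t w, 0 <= f t w) ->
    (forall t, (t <= T)%N -> measurable_fun setT (f t)) ->
    [/\ forall w, 0 <= \sum_(0 <= t < N) c t * f t w,
        measurable_fun setT (fun w => \sum_(0 <= t < N) c t * f t w)
      & (\int[P]_w (\sum_(0 <= t < N) c t * f t w)%:E =
         \sum_(0 <= t < N) (c t)%:E * \int[P]_w (f t w)%:E)%E].
  move=> c_ge0 f_ge0 mf; split.
  - move=> w; rewrite big_nat sumr_ge0 // => t /andP[_ tN].
    by rewrite mulr_ge0 // c_ge0.
  - under eq_fun do rewrite big_mkord.
    apply: measurable_sum => t; apply: measurable_funM => //.
    by apply: mf; exact: tNT.
  - by apply: integral_weighted_sum => // t tN; apply: mf; exact: tNT.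
have [g_ge0 mg gE] := wsum _ sqgrad c1 (fun t w => sqr_ge0 _) sqgrad_measurable.
have [m_ge0 mm mE] := wsum _ sqmove c2 (fun t w => sqr_ge0 _) sqmove_measurable.
have [e_ge0 me eE] := wsum _ sqerr c3 sqerr_ge0 sqerr_measurable.
have h : (\int[P]_w (\sum_(0 <= t < N) theta t / (16 * L) * sqgrad t w
      + \sum_(0 <= t < N) theta t * L * sqmove t w)%:E
    <= \int[P]_w (D0 + \sum_(0 <= t < N) 13 / 8 * (theta t / L) * sqerr t w)%:E)%E.
  apply: ge0_integral_monotone => w; rewrite lee_fin.
    exact: addr_ge0.
  exact: run_descent.
have split_int (f1 f2 : W -> R) : (forall w, 0 <= f1 w) -> (forall w, 0 <= f2 w) ->
    measurable_fun setT f1 -> measurable_fun setT f2 ->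
    (\int[P]_w (f1 w + f2 w)%:E =
     \int[P]_w (f1 w)%:E + \int[P]_w (f2 w)%:E)%E.
  move=> f1_ge0 f2_ge0 mf1 mf2; under eq_integral do rewrite EFinD.
  have ef1 : measurable_fun setT (fun w => (f1 w)%:E) by exact/measurable_EFinP.
  have ef2 : measurable_fun setT (fun w => (f2 w)%:E) by exact/measurable_EFinP.
  by rewrite ge0_integralD // => w _; rewrite lee_fin.
rewrite (split_int _ _ g_ge0 m_ge0 mg mm) gE mE in h.
rewrite (split_int (fun _ => D0) _ (fun _ => D0_ge0) e_ge0 (measurable_cst _) me)
  eE integral_cst //= probability_setT mule1 in h.
rewrite big_split /=; apply: le_trans h _; apply: leeD => //.
rewrite le_eqVlt; apply/orP; left; apply/eqP.
by apply: eq_big_nat => t /andP[_ tN]; rewrite integral_sqerr // tNT.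
Qed.

Lemma mean_sqerr_rec t : (t < T)%N ->
  (mean_sqerr t.+1 <= (beta t ^+ 2)%:E * mean_sqerr t
    + (beta t ^+ 2 * (9 * cP ^+ 2 / (13 * b%:R)))%:E
      * ((theta t ^+ 2)%:E * move_size P xhat x t)
    + ((1 - beta t) ^+ 2 * (9 * cQ / (13 * b%:R)))%:E)%E.
Proof.
move=> tT.
have hF := error_F_step psi_proper psi_lsc psi_sconvex Rg_proper Rg_lsc Rg_convex
  F_reg J_reg b1_gt0 b2_gt0 B_sampling x0_dom run theta01 eta_gt0 kFP tT.
have hJ := error_J_step psi_proper psi_lsc psi_sconvex Rg_proper Rg_lsc Rg_convex
  F_reg J_reg b_gt0 b_gt0 B_sampling x0_dom run theta01 eta_gt0 kJP tT.
have int_ge0 (f : W -> R) : (0 <= \int[P]_w (f w ^+ 2)%:E)%E.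
  by apply: integral_ge0 => w _; rewrite lee_fin sqr_ge0.
have kF_ge0 : 0 <= kF := le_trans ler01 kF_ge1.
have kJ_ge0 : 0 <= kJ := le_trans ler01 kJ_ge1.
have k_ge0 (k r s : R) m : 0 <= k -> 0 <= k * r ^+ 2 * s ^+ 2 / m%:R.
  by move=> k0; rewrite divr_ge0 // mulr_ge0 ?sqr_ge0 // mulr_ge0 ?sqr_ge0.
have M_ge0 : (0 <= (theta t ^+ 2)%:E * move_size P xhat x t)%E.
  by apply: mule_ge0; [rewrite lee_fin sqr_ge0|exact: int_ge0].
have := weighted_recursion a1_ge0 a2_ge0 (sqr_ge0 (beta t))
  (k_ge0 _ _ _ _ kF_ge0) (k_ge0 _ _ _ _ kJ_ge0) (k_ge0 _ _ _ _ kF_ge0)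
  (k_ge0 _ _ _ _ kJ_ge0) (int_ge0 _) (int_ge0 _) M_ge0 hF hJ.
have nK_ge0 : 0 <= nK := specnorm_ge0 K.
rewrite b1E b2E cPE cQE -/nK.
rewrite -(constP_weights c0_gt0 nK_ge0 kF_ge1 kJ_ge1 L_F_ge0 M_F_ge0 M_psi_ge0
  (beta t ^+ 2) bR).
by rewrite -(constQ_weights nK kF kJ M_F M_psi sigma_F sigma_J c0_gt0
  ((1 - beta t) ^+ 2) bR).
Qed.

Lemma mean_sqerr_init :
  (mean_sqerr 0 <= (9 * cQ / (13 * hb0%:R))%:E)%E.
Proof.
have hF := error_F_init F_reg b0_gt0 B_sampling x0_dom run.
have hJ := error_J_init J_reg hb0_gt0 B_sampling x0_dom run.
apply: le_trans (leeD (lee_wpmul2l _ hF) (lee_wpmul2l _ hJ)) _.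
- by rewrite lee_fin.
- by rewrite lee_fin.
rewrite -!EFinM -EFinD lee_fin b0E cQE.
exact: (constQ_weights_init _ _ c0_gt0 (specnorm_ge0 K)).
Qed.

Lemma mean_gradient_rate (Delta := cbrt R T.+1 ^+ 2 - cbrt R 0 ^+ 2) :
  (\sum_(0 <= t < T.+1) (theta t / \sum_(0 <= s < T.+1) theta s)%:E
     * mean_sqgrad t <=
   (32 * cP / (3 * Num.sqrt b%:R * Delta) * D0
    + 32 * cQ / (3 * Delta)
      * (cbrt R 0 / hb0%:R + 2 * (1 + ln T.+1%:R) / b%:R))%:E)%E.
Proof.
have thE : theta = (fun t => L * Num.sqrt b%:R / (cP * cbrt R t)).
  by apply/funext => t; exact: thetaE.
have beE : beta = (fun t => 1 - 1 / cbrt R t ^+ 2).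
  by apply/funext => t; exact: betaE.
have cQ_ge0 : 0 <= cQ by rewrite cQE constQ_ge0.
have int_ge0 (f : W -> R) : (0 <= \int[P]_w (f w ^+ 2)%:E)%E.
  by apply: integral_ge0 => w _; rewrite lee_fin sqr_ge0.
have e_ge0 t : (0 <= mean_sqerr t)%E.
  by apply: adde_ge0; apply: mule_ge0; rewrite ?lee_fin //; exact: int_ge0.
have := expected_descent; have := mean_sqerr_rec; rewrite thE beE => hrec hdesc.
exact: (extended_average_rate L_gt0 cP_gt0 cQ_ge0 bR hb0R D0_ge0
  (fun t => int_ge0 _) (fun t => int_ge0 _) e_ge0 hdesc hrec mean_sqerr_init).
Qed.

Variable tau : {mfun W >-> nat}.
Hypothesis tau_law : forall t, (t <= T)%N ->
  P (tau @^-1` [set t]) = (theta t / \sum_(0 <= s < T.+1) theta s)%:E.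
Hypothesis tau_indep : independent_events P (sigma_of [set (tau : W -> nat)])
  (sigma_of (history B T.+1)).

Lemma random_gradient_rate (Delta := cbrt R T.+1 ^+ 2 - cbrt R 0 ^+ 2) :
  (\int[P]_w (frob (gmap (tau w) w) ^+ 2)%:E <=
   (32 * cP / (3 * Num.sqrt b%:R * Delta) * D0
    + 32 * cQ / (3 * Delta)
      * (cbrt R 0 / hb0%:R + 2 * (1 + ln T.+1%:R) / b%:R))%:E)%E.
Proof.
apply: le_trans mean_gradient_rate.
have th_gt0 : 0 < \sum_(0 <= s < T.+1) theta s.
  have th0 := theta01 (leq0n T); rewrite big_nat_recl //=.
  rewrite ltr_pwDl //; first by case/andP: th0.
  rewrite big_nat sumr_ge0 // => t /andP[_ tT].
  by have /andP[/ltW] := theta01 tT.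
have mS X : history B T.+1 X -> measurable_fun setT X.
  exact: (history_measurable B_sampling).
have pr_sum : \sum_(0 <= t < T.+1) theta t / \sum_(0 <= s < T.+1) theta s = 1.
  by rewrite -mulr_suml mulfV // gt_eqF.
pose g t (w : past (history B T.+1)) : R := frob (gmap t w) ^+ 2.
have mg t : (t < T.+1)%N -> measurable_fun setT (g t).
  move=> tT; apply: measurable_sqfrob.
  apply: past_mxmeasurable_sub (grad_map_adapted tT).
  by move=> X [s st dX]; exists s => //; exact: leq_trans st (leqW tT).
pose pr t := theta t / \sum_(0 <= s < T.+1) theta s.
have lawN t : (t < T.+1)%N -> P (tau @^-1` [set t]) = (pr t)%:E := @tau_law t.
exact: (random_index_integral mS (independent_eventsC tau_indep) lawN pr_sum
  mg (fun t w => sqr_ge0 _)).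
Qed.

End Convergence.

Lemma kappa_cases d (W : measurableType d) d' (Xi : measurableType d')
    (R : realType) (P : probability W R) (c1 c2 : nat)
    (X : nat -> 'I_c1 -> W -> Xi) (Y : nat -> 'I_c2 -> W -> Xi) (T : nat) :
  1 <= kappa_of P X Y T /\
  forall t : nat, (1 <= t <= T)%N ->
    kappa_of P X Y T = 1 /\
      independent_events P (sigma_of (range (X t))) (sigma_of (range (Y t)))
    \/ kappa_of P X Y T = 2.
Proof.
rewrite /kappa_of; case: asboolP => [ind|_]; split => //.
- by move=> t tT; left; split => //; exact: ind.
- by rewrite ler1n.
- by move=> t tT; right.
Qed.

Theorem theorem3p2 (R : realType) (p q n : nat)
    (d : measure_display) (Xi : measurableType d) (Pxi : probability Xi R)
    (F : 'cV[R]_p -> Xi -> 'cV[R]_q) (K : 'M[R]_(q, n))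
    (psi : 'cV[R]_n -> \bar R) (Rg : 'cV[R]_p -> \bar R)
    (hpsi_proper : proper_efun psi) (hpsi_closed : lower_semicontinuous psi)
    (hpsi_convex : convex_efun psi)
    (hRg_proper : proper_efun Rg) (hRg_closed : lower_semicontinuous Rg)
    (hRg_convex : convex_efun Rg)
    (hF_integrable : forall x, integrable_mx Pxi (F x))
    (hF_diff : forall (s : Xi) (x : 'cV[R]_p), differentiable (F ^~ s) x)
    (hJ_integrable : forall x, integrable_mx Pxi (Fjac F x))
    (hFmean_diff : forall x : 'cV[R]_p, differentiable (Fmean Pxi F) x)
    (hFmean_jac : forall x, jac (Fmean Pxi F) x = expect_mx Pxi (Fjac F x))
    (hPsi0star : (-oo < Psi0star Pxi F K psi Rg)%E)
    (L_F sigma_F sigma_J M_F M_psi : R)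
    (hL_F : 0 < L_F) (hsigma_F : 0 < sigma_F) (hsigma_J : 0 < sigma_J)
    (hM_F : 0 < M_F) (hM_psi : 0 < M_psi)
    (hsmooth : forall x y,
      edom (Psi0 Pxi F K psi Rg) x -> edom (Psi0 Pxi F K psi Rg) y ->
      ('E_Pxi[fun s => (frob (Fjac F x s - Fjac F y s) ^+ 2)%R]
        <= (L_F ^+ 2 * frob (x - y) ^+ 2)%:E)%E)
    (hvarF : forall x, edom (Psi0 Pxi F K psi Rg) x ->
      ('E_Pxi[fun s => (frob (F x s - Fmean Pxi F x) ^+ 2)%R]
        <= (sigma_F ^+ 2)%:E)%E)
    (hvarJ : forall x, edom (Psi0 Pxi F K psi Rg) x ->
      ('E_Pxi[fun s => (frob (Fjac F x s - jac (Fmean Pxi F) x) ^+ 2)%R]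
        <= (sigma_J ^+ 2)%:E)%E)
    (hboundJ : forall x, edom (Psi0 Pxi F K psi Rg) x ->
      ('E_Pxi[fun s => (frob (Fjac F x s) ^+ 2)%R] <= (M_F ^+ 2)%:E)%E)
    (hbound_psi :
      (ereal_sup [set (frob y)%:E | y in edom psi] <= M_psi%:E)%E)
    (hpsi_strong : strongly_convex 1 psi)
    (* the batches, drawn on a probability space (W, P) *)
    (T : nat) (c0 : R) (hc0 : 0 < c0)
    (b b0 hb0 b1 hb1 b2 hb2 : nat) (hb : (0 < b)%N) (hhb0 : (0 < hb0)%N)
    (hb0E : b0%:R = c0 * hb0%:R)
    (hhb1E : hb1 = b) (hhb2E : hb2 = b)
    (hb1E : b1%:R = c0 * b%:R) (hb2E : b2%:R = c0 * b%:R)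
    (d' : measure_display) (W : measurableType d') (P : probability W R)
    (B : minibatches W Xi b0 hb0 b1 hb1 b2 hb2)
    (hB : sampling P Pxi B T)
    (kappa hkappa cP cQ L_Phi : R)
    (hkappaE : kappa = kappa_of P (B1 B) (B2 B) T)
    (hhkappaE : hkappa = kappa_of P (hB1 B) (hB2 B) T)
    (hcP : cP = constP c0 (specnorm K) kappa hkappa L_F M_F M_psi)
    (hcQ : cQ =
      constQ c0 (specnorm K) kappa hkappa M_F M_psi sigma_F sigma_J)
    (hL_Phi : L_Phi = constLPhi (specnorm K) L_F M_F M_psi)
    (beta theta eta : nat -> R)
    (hbeta : forall t, beta t = 1 - 1 / t.+2%:R `^ (2 / 3))
    (htheta : forall t,
      theta t = L_Phi * Num.sqrt b%:R / (cP * t.+2%:R `^ (1 / 3)))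
    (heta : forall t, eta t = 2 / (L_Phi * (3 + theta t)))
    (htheta01 : forall t, (t <= T)%N -> 0 < theta t <= 1)
    (x0 : 'cV[R]_p) (hx0 : edom (Psi0 Pxi F K psi Rg) x0)
    (Ft : nat -> W -> 'cV[R]_q) (Jt : nat -> W -> 'M[R]_(q, p))
    (v xhat x : nat -> W -> 'cV[R]_p)
    (hrun : hybrid_run F K psi Rg B beta beta theta eta x0 T Ft Jt v xhat x)
    (* the random output index, independent of all the batches *)
    (tau : {RV P >-> nat})
    (htau : forall t, (t <= T)%N ->
      P (tau @^-1` [set t]) = (theta t / \sum_(0 <= s < T.+1) theta s)%:E)
    (htau_indep : independent_events P (sigma_of [set (tau : W -> nat)])
      (sigma_of (\bigcup_(s in [set s | (s <= T)%N]) draws B s))) :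
  ('E_P[fun w =>
      (frob (grad_map Pxi F K psi Rg (eta (tau w)) (x (tau w) w)) ^+ 2)%R]
   <= (32 * cP /
         (3 * Num.sqrt b%:R * (T.+3%:R `^ (2 / 3) - 2 `^ (2 / 3))))%:E
        * (Psi0 Pxi F K psi Rg x0 - Psi0star Pxi F K psi Rg)
      + (32 * cQ / (3 * (T.+3%:R `^ (2 / 3) - 2 `^ (2 / 3)))
          * (2 `^ (1 / 3) / hb0%:R + 2 * (1 + ln T.+1%:R) / b%:R))%:E)%E.
Proof.
subst hb1 hb2.
have EE dU (U : measurableType dU) (PP : probability U R) (X : U -> R) :
    ('E_PP[X] = \int[PP]_w (X w)%:E)%E by rewrite unlock.
have dom : edom (Psi0 Pxi F K psi Rg) = edom Rg by exact: edom_Psi0.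
rewrite dom in hsmooth hvarF hvarJ hboundJ hx0.
have smooth x' y' : edom Rg x' -> edom Rg y' ->
    (\int[Pxi]_s (frob (Fjac F x' s - Fjac F y' s) ^+ 2)%:E
     <= (L_F ^+ 2 * frob (x' - y') ^+ 2)%:E)%E.
  by move=> dx dy; rewrite -EE; exact: hsmooth.
have varF x' : edom Rg x' ->
    (\int[Pxi]_s (frob (F x' s - Fmean Pxi F x') ^+ 2)%:E
     <= (sigma_F ^+ 2)%:E)%E by move=> dx; rewrite -EE; exact: hvarF.
have varJ x' : edom Rg x' ->
    (\int[Pxi]_s (frob (Fjac F x' s - jac (Fmean Pxi F) x') ^+ 2)%:E
     <= (sigma_J ^+ 2)%:E)%E by move=> dx; rewrite -EE; exact: hvarJ.
have boundJ x' : edom Rg x' ->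
    (\int[Pxi]_s (frob (Fjac F x' s) ^+ 2)%:E <= (M_F ^+ 2)%:E)%E.
  by move=> dx; rewrite -EE; exact: hboundJ.
have psi_bounded y : edom psi y -> frob y <= M_psi.
  move=> dy; rewrite -lee_fin; apply: le_trans hbound_psi.
  by apply: ereal_sup_ubound; exists y.
have [kF_ge1 kFP] := kappa_cases P (B1 B) (B2 B) T.
have [kJ_ge1 kJP] := kappa_cases P (hB1 B) (hB2 B) T.
rewrite -hkappaE in kF_ge1 kFP; rewrite -hhkappaE in kJ_ge1 kJP.
have nK_ge0 := specnorm_ge0 K.
have cP_ge0 : 0 <= cP by rewrite hcP; exact: constP_ge0.
have L_ge0 : 0 <= L_Phi.
  by rewrite hL_Phi /constLPhi addr_ge0 // !mulr_ge0 // ltW.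
(* the positivity of the first step size excludes [L_Phi = 0] and [cP = 0] *)
have [th0 _] := andP (htheta01 0%N (leq0n T)).
have cP_gt0 : 0 < cP.
  rewrite lt_def cP_ge0 andbT; apply: contraTneq th0 => cP0.
  by rewrite htheta cP0 mul0r invr0 mulr0 ltxx.
have L_gt0 : 0 < L_Phi.
  rewrite lt_def L_ge0 andbT; apply: contraTneq th0 => L0.
  by rewrite htheta L0 !mul0r ltxx.
have Psi0_x0 := Psi0E Pxi F K hpsi_proper hpsi_closed hpsi_strong hRg_proper hx0.
have DstarE : Psi0star Pxi F K psi Rg = (fine (Psi0star Pxi F K psi Rg))%:E.
  rewrite fineK // fin_numE gt_eqF //= lt_eqF //.
  apply: le_lt_trans (_ : Psi0 Pxi F K psi Rg x0 < +oo)%E.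
    by apply: ereal_inf_lbound; exists x0.
  by rewrite Psi0_x0 ltry.
have Dstar_le y : edom Rg y ->
    fine (Psi0star Pxi F K psi Rg) <= Phi0 Pxi F K psi y + fine (Rg y).
  move=> dy; rewrite -lee_fin -DstarE -Psi0E //.
  by apply: ereal_inf_lbound; exists y.
have F_reg := F_regular hRg_proper hRg_convex hF_integrable hF_diff hFmean_diff
  varF boundJ.
have J_reg := Fjac_regular hF_integrable hF_diff hJ_integrable hFmean_diff
  hFmean_jac smooth varJ.
have G_bounded := jac_mean_bounded hJ_integrable hFmean_jac (ltW hM_F) boundJ.
have G_lipschitz := jac_mean_lipschitz hJ_integrable hFmean_jac (ltW hL_F) smooth.
have betaE t : beta t = 1 - 1 / cbrt R t ^+ 2 by rewrite hbeta cbrt2.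
have h := random_gradient_rate hpsi_proper hpsi_closed hpsi_strong psi_bounded
  hRg_proper hRg_closed hRg_convex (ltW hL_F) (ltW hM_F) (ltW hM_psi) hc0 kF_ge1
  kJ_ge1 F_reg J_reg hFmean_diff hFmean_jac G_bounded G_lipschitz hb hhb0 hb0E
  hb1E hb2E hB kFP kJP hL_Phi hcP hcQ L_gt0 cP_gt0 betaE htheta heta htheta01 hx0
  hrun Dstar_le htau htau_indep.
rewrite EE; apply: le_trans h _.
rewrite DstarE Psi0_x0 -EFinB -EFinM -EFinD lee_fin.
by rewrite (cbrt2 R T.+1) (cbrt2 R 0).
Qed.
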